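(* Let $a+b\in\mathbb{C}\setminus\mathbb{Z}_{\leqslant 0}$ and $y\in\mathbb{C}$. As $\rho\to0$ in $|\arg(\rho)|<\pi$, we have $$\Phi_1[a,b;a+b;1-\rho,y]=-\frac{\Gamma(a+b)}{\Gamma(a)\Gamma(b)}\left\{e^{y}\bigl(2\gamma+\psi(a)+\psi(b)+\log\rho\bigr)+\frac{y}{a}\,F_{1:0;1}^{0:1;2}\left[\begin{matrix}-:\ 1;\ a,1\\ 2:\ -;\ a+1\end{matrix};y,y\right]\right\}+o(1),$$ where $$F_{1:0;1}^{0:1;2}\left[\begin{matrix}-:\ a;\ b,b'\\ c:\ -;\ d\end{matrix};u,v\right]=\sum_{m,n=0}^{\infty}\frac{(a)_m(b)_n(b')_n}{(c)_{m+n}(d)_n}\frac{u^m}{m!}\frac{v^n}{n!}\qquad(|u|<\infty,\ |v|<\infty)$$ is a special case of the Kamp\'e de F\'eriet function.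
   Context: $(\alpha)_n=\Gamma(\alpha+n)/\Gamma(\alpha)$ is the Pochhammer symbol, $\psi=\Gamma'/\Gamma$ the Psi (digamma) function, $\gamma=-\psi(1)$ the Euler--Mascheroni constant, $\log$ the principal logarithm. If $a$ or $b$ is a nonpositive integer, the right-hand side is understood as its limiting value in the parameters. The Humbert function $\Phi_1$ is defined for $|x|<1$, $y\in\mathbb{C}$ by $$\Phi_1[a,b;c;x,y]=\sum_{m,n=0}^{\infty}\frac{(a)_{m+n}(b)_m}{(c)_{m+n}}\frac{x^m}{m!}\frac{y^n}{n!},$$ and is continued analytically to all $x\in\mathbb{C}\setminus[1,\infty)$, $y\in\mathbb{C}$ by $$\Phi_1[a,b;c;x,y]=\sum_{n=0}^{\infty}\frac{(a)_n}{(c)_n}\,{}_2F_1\left[\begin{matrix}a+n,b\\ c+n\end{matrix};x\right]\frac{y^n}{n!}$$ (principal branch of ${}_2F_1$). *)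

(* Defs.v *)
From Stdlib Require Import Reals Factorial ClassicalEpsilon.
From Coquelicot Require Import Coquelicot.
Open Scope C_scope.

(* Coquelicot's [lim] is total; it is the limit as soon as one exists, see
   [Flim_unique]. *)
Definition Flim {T : Type} (F : (T -> Prop) -> Prop) (f : T -> C) : C :=
  @lim C_CompleteNormedModule (filtermap f F).

Lemma Flim_unique (T : Type) (F : (T -> Prop) -> Prop) (FF : ProperFilter F)
    (f : T -> C) (l : C) :
  filterlim f F (locally l) -> Flim F f = l.
Proof.
intros H.
apply (@eq_close C_AbsRing C_NormedModule).
intros eps.
destruct (filter_ex (F := filtermap f F)
  (fun z => ball (Flim F f) (pos_div_2 eps) z /\ ball l (pos_div_2 eps) z))
  as [z [H1 H2]].
- apply filter_and.
  + apply (C_complete_ax1 (filtermap f F)); [now apply filtermap_proper_filter |].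
    intros e; exists l; apply H; now exists e.
  + apply H; now exists (pos_div_2 eps).
- rewrite <- (Rplus_half_diag eps).
  apply ball_triangle with z; [exact H1 | now apply ball_sym].
Qed.

Definition CSeries (u : nat -> C) : C := Flim eventually (sum_n u).

(* The double series below are all absolutely convergent, so that summing by
   rows gives the sum over all pairs (m, n). *)
Definition CSeries2 (u : nat -> nat -> C) : C :=
  CSeries (fun n => CSeries (fun m => u m n)).

Definition nonpos_int (z : C) : Prop := exists n : nat, z = - INR n.

Definition Cexp (z : C) : C :=
  RtoC (exp (Re z)) * (cos (Im z), sin (Im z)).

(* Principal argument, in (-PI, PI]; the value at 0 is irrelevant. *)
Definition Carg (z : C) : R :=
  if Rle_dec 0 (Im z) then acos (Re z / Cmod z) else (- acos (Re z / Cmod z))%R.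

Definition Clog (z : C) : C := (ln (Cmod z), Carg z).

(* a (a+1) ... (a+n-1), which is Gamma(a+n)/Gamma(a) when a is not a nonpositive
   integer, and its continuous extension in a otherwise. *)
Fixpoint poch (a : C) (n : nat) : C :=
  match n with
  | O => 1
  | S k => poch a k * (a + INR k)
  end.

Definition cfact (n : nat) : C := RtoC (INR (fact n)).

(* Euler's limit n! n^z / (z (z+1) ... (z+n)). *)
Definition Gamma (z : C) : C :=
  Flim eventually
    (fun n : nat => cfact n * Cexp (z * ln (INR n)) / poch z (S n)).

Definition psi (z : C) : C := C_derive Gamma z / Gamma z.

Definition euler_gamma : C := - psi 1.

Definition analytic_at (f : C -> C) (z0 : C) : Prop :=
  exists (u : nat -> C) (r : R), (0 < r)%R /\
    forall z : C, (Cmod (z - z0) < r)%R -> is_pseries u (z - z0) (f z).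

Definition in_cut (x : C) : Prop := (1 <= Re x)%R /\ Im x = 0%R.

Definition gauss_coeff (a b c : C) (n : nat) : C :=
  poch a n * poch b n / (poch c n * cfact n).

Definition is_principal_2F1 (a b c : C) (G : C -> C) : Prop :=
  (forall x : C, ~ in_cut x -> analytic_at G x) /\
  (forall x : C, (Cmod x < 1)%R -> is_pseries (gauss_coeff a b c) x (G x)).

(* When c is not a nonpositive integer, such a G exists and its values off the
   cut [1, +oo) are unique; its values on the cut are arbitrary. *)
Definition hyp2F1 (a b c : C) : C -> C :=
  epsilon (inhabits (fun _ : C => RtoC 0)) (is_principal_2F1 a b c).

Definition Phi1_series (a b c x y : C) : C :=
  CSeries2 (fun m n =>
    poch a (m + n) * poch b m / poch c (m + n)
    * (x ^ m / cfact m) * (y ^ n / cfact n)).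

Definition Phi1_cont (a b c x y : C) : C :=
  CSeries (fun n =>
    poch a n / poch c n * hyp2F1 (a + INR n) b (c + INR n) x
    * (y ^ n / cfact n)).

Definition Phi1 (a b c x y : C) : C :=
  if Rlt_dec (Cmod x) 1 then Phi1_series a b c x y else Phi1_cont a b c x y.

(* F^{0:1;2}_{1:0;1}[ - : a ; b, b' ; c : - ; d ; u, v ] *)
Definition kampe_de_feriet (a b b' c d u v : C) : C :=
  CSeries2 (fun m n =>
    poch a m * poch b n * poch b' n / (poch c (m + n) * poch d n)
    * (u ^ m / cfact m) * (v ^ n / cfact n)).

Definition rhs_generic (a b y rho : C) : C :=
  - (Gamma (a + b) / (Gamma a * Gamma b)) *
    (Cexp y * (2 * euler_gamma + psi a + psi b + Clog rho)
     + y / a * kampe_de_feriet 1 a 1 2 (a + 1) y y).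

Definition regular_params (p : C * C) : Prop :=
  ~ nonpos_int (fst p) /\ ~ nonpos_int (snd p).

(* When a or b is a nonpositive integer, [rhs_generic] is meaningless there
   (poles of Gamma and psi, zero denominators) but extends continuously in
   (a, b) as long as a + b is not a nonpositive integer. *)
Definition rhs (a b y rho : C) : C :=
  if excluded_middle_informative (regular_params (a, b))
  then rhs_generic a b y rho
  else Flim (within regular_params (locally (a, b)))
            (fun p : C * C => rhs_generic (fst p) (snd p) y rho).

(* Main.v *)
Require Import Defs.
From Stdlib Require Import Reals Factorial Wf_nat Ranalysis5 Lra Lia Psatz.
From Stdlib Require Import ClassicalEpsilon Classical FunctionalExtensionality.
From Coquelicot Require Import Coquelicot.
Open Scope C_scope.

(** The argument.  Put [c = a + b].  Collecting powers of [y],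
    [Phi1 (a, b; c; x, y)] is the sum over [n] of
    [(a)_n / (c)_n * 2F1 (a + n, b; c + n; x) * y^n / n!], and each of these Gauss
    functions is zero-balanced, hence has a logarithmic singularity at [x = 1]:
    [2F1 (a, b; a + b; 1 - rho)] is
    [- Gamma (a + b) / (Gamma a Gamma b) * (2 gamma + psi a + psi b + log rho) + o(1)]
    ([hyp2F1_log]).  The prefactor of the [n]-th row times [(a)_n / (c)_n] does not
    depend on [n], and [psi (a + n) = psi a + sum_(k < n) 1 / (a + k)], so summing the
    limiting forms gives [e^y] times the first bracket plus
    [sum_n y^n / n! sum_(k < n) 1 / (a + k)]; exchanging the two sums gives the
    Kampe de Feriet series ([harmonic_series], [dpoch_series_kampe]).

    The logarithmic form has to hold in the whole slit neighbourhood of [1], outside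
    the unit disc as well, and the analytic continuation of [2F1] has to be
    constructed.  When [Re a] and [Re (b - a)] are large both come from one formula.
    The coefficients [(a)_n (b)_n / ((a + b)_n n!)] are, up to the constant
    [Gamma (a + b) / (Gamma a Gamma b)], the moments [int_0^1 t^n h(t) dt] of
    [h(t) = t^(a-1) * 2F1 (a, 1 - b; 1; 1 - t)], whose expansion in powers of [1 - t] is
    absolutely convergent up to [t = 0].  So [2F1] is a Stieltjes transform
    [int_0^1 h(t) / (1 - x t) dt], analytic off the cut ([stieltjes_series_analytic]), and
    the integrals of [(1 - t)^j / (1 - x t)] reduce recursively to
    [- log (1 - x) / x], which shows the singularity at [1]
    ([stieltjes_series_log]).  The moments are computed by telescoping
    ([large_m_rec]), the constant from two integrals for [psi] ([large_constant]).

    A contiguous relation between the parameters [a, a + 1, a + 2], valid first in the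
    disc and then off the cut by the identity theorem, lowers [a] and, by symmetry,
    [b] by integers ([log_form_step], [log_form_all]).  The same relation, read in
    [n], is a three-term recurrence for the rows; the limiting forms satisfy its
    specialization to [rho = 0].  Hence the errors of all rows are bounded by
    [K^n] times the errors of finitely many of them ([row_err_growth]), and
    dividing by [n!] makes the sum of the errors tend to [0] ([Phi1_asymptotics]).

    To treat nonpositive integers [a] or [b] on the same footing, all formulas are
    written with the entire function [1 / Gamma] and its derivative, obtained as
    limits of Euler's products.  The main term is then continuous in [(a, b)]
    ([main_term_continuous]), and so equals the limiting value prescribed at
    the exceptional parameters ([rhs_main_term]). *)


(** * Limits and series of complex numbers *)

Ltac triangle := eapply Rle_trans; [apply Cmod_triangle |].

Definition tends {T : Type} (F : (T -> Prop) -> Prop) (f : T -> C) (l : C) : Prop :=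
  forall eps : R, (0 < eps)%R -> F (fun x => (Cmod (f x - l) < eps)%R).

(** The topology of [C] is the product topology, given by squares; [tends]
    rephrases limits with the modulus, which is the form all estimates take. *)
Lemma tends_filterlim {T} (F : (T -> Prop) -> Prop) {FF : Filter F} (f : T -> C) (l : C) :
  tends F f l <-> filterlim f F (locally l).
Proof.
split; intros H.
- apply filterlim_locally; intros eps.
  generalize (H eps (cond_pos eps)); apply filter_imp; intros x Hx.
  now apply C_NormedModule_mixin_compat1.
- intros eps He.
  assert (He' : (0 < eps / 2)%R) by lra.
  generalize (proj1 (filterlim_locally f l) H (mkposreal _ He')).
  apply filter_imp; intros x Hx.
  apply C_NormedModule_mixin_compat2 in Hx; simpl in Hx.
  apply Rlt_le_trans with (1 := Hx).
  assert (sqrt 2 <= 2)%R.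
  { rewrite <- (sqrt_Rsqr 2) at 2 by lra. apply sqrt_le_1; unfold Rsqr; lra. }
  nra.
Qed.

Lemma tends_ext {T} (F : (T -> Prop) -> Prop) {FF : Filter F} (f g : T -> C) (l : C) :
  F (fun x => f x = g x) -> tends F f l -> tends F g l.
Proof.
intros E H eps He; generalize (filter_and _ _ E (H eps He)); apply filter_imp.
now intros x [-> Hx].
Qed.

Lemma tends_const {T} (F : (T -> Prop) -> Prop) {FF : Filter F} (c : C) :
  tends F (fun _ => c) c.
Proof.
intros eps He; apply filter_forall; intros x.
now replace (c - c) with (RtoC 0) by ring; rewrite Cmod_0.
Qed.

Lemma tends_plus {T} (F : (T -> Prop) -> Prop) {FF : Filter F} (f g : T -> C) (l m : C) :
  tends F f l -> tends F g m -> tends F (fun x => f x + g x) (l + m).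
Proof.
intros Hf Hg eps He.
assert (He' : (0 < eps / 2)%R) by lra.
generalize (filter_and _ _ (Hf _ He') (Hg _ He')); apply filter_imp; intros x [H1 H2].
replace (f x + g x - (l + m)) with ((f x - l) + (g x - m)) by ring.
apply Rle_lt_trans with (1 := Cmod_triangle _ _); lra.
Qed.

Lemma tends_mult {T} (F : (T -> Prop) -> Prop) {FF : Filter F} (f g : T -> C) (l m : C) :
  tends F f l -> tends F g m -> tends F (fun x => f x * g x) (l * m).
Proof.
intros Hf Hg eps He.
set (K := (Cmod l + Cmod m + 1)%R).
assert (HK : (0 < K)%R) by (unfold K; generalize (Cmod_ge_0 l) (Cmod_ge_0 m); lra).
assert (He' : (0 < Rmin 1 (eps / K))%R).
{ apply Rmin_case; [lra | now apply Rdiv_lt_0_compat]. }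
generalize (filter_and _ _ (Hf _ He') (Hg _ He')); apply filter_imp; intros x [H1 H2].
replace (f x * g x - l * m) with ((f x - l) * (g x - m) + (f x - l) * m + l * (g x - m))
  by ring.
assert (A : (Rmin 1 (eps / K) * K <= eps)%R).
{ apply Rle_trans with (eps / K * K)%R; [| right; now field; apply Rgt_not_eq].
  apply Rmult_le_compat_r; [lra | apply Rmin_r]. }
generalize (Rmin_l 1 (eps / K)) (Cmod_ge_0 (f x - l)) (Cmod_ge_0 (g x - m))
  (Cmod_ge_0 l) (Cmod_ge_0 m); intros B P1 P2 P3 P4.
eapply Rle_lt_trans; [apply Cmod_triangle |].
eapply Rle_lt_trans; [apply Rplus_le_compat_r, Cmod_triangle |].
rewrite !Cmod_mult.
set (d := Rmin 1 (eps / K)) in *.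
apply Rlt_le_trans with (2 := A); unfold K.
assert (Cmod (f x - l) * Cmod (g x - m) < d * 1)%R by (apply Rmult_le_0_lt_compat; lra).
nra.
Qed.

Lemma tends_opp {T} (F : (T -> Prop) -> Prop) {FF : Filter F} (f : T -> C) (l : C) :
  tends F f l -> tends F (fun x => - f x) (- l).
Proof.
intros H eps He; generalize (H eps He); apply filter_imp; intros x Hx.
now replace (- f x - - l) with (- (f x - l)) by ring; rewrite Cmod_opp.
Qed.

Lemma tends_minus {T} (F : (T -> Prop) -> Prop) {FF : Filter F} (f g : T -> C) (l m : C) :
  tends F f l -> tends F g m -> tends F (fun x => f x - g x) (l - m).
Proof. intros Hf Hg; apply tends_plus; [easy | exact Hf | now apply tends_opp]. Qed.

Lemma tends_inv {T} (F : (T -> Prop) -> Prop) {FF : Filter F} (f : T -> C) (l : C) :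
  l <> 0 -> tends F f l -> tends F (fun x => / f x) (/ l).
Proof.
intros Hl Hf eps He.
assert (Pl := proj1 (Cmod_gt_0 l) Hl).
assert (P : (0 < Rmin (Cmod l / 2) (eps * (Cmod l * Cmod l) / 2))%R).
{ apply Rmin_case; [lra | assert (0 < Cmod l * Cmod l)%R by nra; nra]. }
generalize (Hf _ P); apply filter_imp; intros x Hx.
assert (B1 := Rlt_le_trans _ _ _ Hx (Rmin_l _ _)).
assert (B2 := Rlt_le_trans _ _ _ Hx (Rmin_r _ _)).
assert (B3 : (Cmod l / 2 < Cmod (f x))%R).
{ assert (Cmod l <= Cmod (f x) + Cmod (f x - l))%R; [| lra].
  rewrite <- (Cmod_opp (f x - l)).
  replace l with (f x + - (f x - l)) at 1 by ring; apply Cmod_triangle. }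
assert (Hfx : f x <> 0) by (apply Cmod_gt_0; lra).
replace (/ f x - / l) with (- (f x - l) / (f x * l)) by (field; now split).
rewrite Cmod_div, Cmod_opp, Cmod_mult by now apply Cmult_neq_0.
apply Rmult_lt_reg_r with (Cmod (f x) * Cmod l)%R; [nra |].
unfold Rdiv; rewrite Rmult_assoc, Rinv_l, Rmult_1_r by nra.
apply Rlt_le_trans with (1 := B2).
assert (0 <= eps * Cmod l * (Cmod (f x) - Cmod l / 2))%R.
{ repeat apply Rmult_le_pos; lra. }
lra.
Qed.

Lemma tends_div {T} (F : (T -> Prop) -> Prop) {FF : Filter F} (f g : T -> C) (l m : C) :
  m <> 0 -> tends F f l -> tends F g m -> tends F (fun x => f x / g x) (l / m).
Proof. intros Hm Hf Hg; apply tends_mult; [easy | easy | now apply tends_inv]. Qed.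

Lemma tends_unique {T} (F : (T -> Prop) -> Prop) {FF : ProperFilter F} (f : T -> C) (l m : C) :
  tends F f l -> tends F f m -> l = m.
Proof.
intros H1 H2; apply Ceq_minus, Cmod_eq_0.
apply Rle_antisym; [| apply Cmod_ge_0].
apply le_epsilon; intros eps He.
assert (He' : (0 < eps / 2)%R) by lra.
destruct (filter_ex _ (filter_and _ _ (H1 _ He') (H2 _ He'))) as [x [A B]].
replace (l - m) with (- (f x - l) + (f x - m)) by ring.
triangle; rewrite Cmod_opp; lra.
Qed.

Lemma tends_squeeze {T} (F : (T -> Prop) -> Prop) {FF : Filter F} (f g : T -> C) (l : C) :
  F (fun x => (Cmod (f x - l) <= Cmod (g x))%R) -> tends F g 0 -> tends F f l.
Proof.
intros H1 H2 eps He; generalize (filter_and _ _ H1 (H2 _ He)); apply filter_imp.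
intros x [A B]; replace (g x - 0) with (g x) in B by ring; lra.
Qed.

Lemma tends_Cmod {T} (F : (T -> Prop) -> Prop) {FF : Filter F} (f : T -> C) :
  tends F f 0 -> tends F (fun x => RtoC (Cmod (f x))) 0.
Proof.
intros H; apply tends_squeeze with f; trivial.
apply filter_forall; intros x.
rewrite <- RtoC_minus, Cmod_R, Rminus_0_r, Rabs_pos_eq; [lra | apply Cmod_ge_0].
Qed.

Lemma tends_le {T} (F : (T -> Prop) -> Prop) {FF : ProperFilter F} (f : T -> C) l M :
  tends F f l -> F (fun x => (Cmod (f x) <= M)%R) -> (Cmod l <= M)%R.
Proof.
intros H1 H2; apply le_epsilon; intros eps He.
destruct (filter_ex _ (filter_and _ _ (H1 _ He) H2)) as [x [A B]].
replace l with (- (f x - l) + f x) by ring.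
triangle; rewrite Cmod_opp; lra.
Qed.

Lemma tends_succ (f : nat -> C) (l : C) :
  tends eventually f l -> tends eventually (fun n => f (S n)) l.
Proof. intros H eps He; destruct (H eps He) as [N HN]; exists N; intros n Hn; apply HN; lia. Qed.

Lemma tends_pred (f : nat -> C) (l : C) :
  tends eventually (fun n => f (S n)) l -> tends eventually f l.
Proof.
intros H eps He; destruct (H eps He) as [N HN]; exists (S N); intros [|n] Hn; [lia |].
apply HN; lia.
Qed.

Lemma tends_R (f : nat -> R) (l : R) :
  is_lim_seq f l <-> tends eventually (fun n => RtoC (f n)) l.
Proof.
split; intros H.
- intros eps He.
  apply is_lim_seq_spec in H; destruct (H (mkposreal eps He)) as [N HN]; exists N.
  intros n Hn; rewrite <- RtoC_minus, Cmod_R; now apply HN.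
- apply is_lim_seq_spec; intros eps.
  destruct (H eps (cond_pos eps)) as [N HN]; exists N; intros n Hn.
  generalize (HN n Hn); now rewrite <- RtoC_minus, Cmod_R.
Qed.

Notation Cis_series := (@is_series C_AbsRing C_NormedModule).

Lemma Cis_series_tends (u : nat -> C) (l : C) :
  Cis_series u l <-> tends eventually (sum_n u) l.
Proof. symmetry; apply tends_filterlim; apply eventually_filter. Qed.

Lemma CSeries_unique u l : Cis_series u l -> CSeries u = l.
Proof. intros H; apply Flim_unique; [apply eventually_filter | exact H]. Qed.

Lemma Csum_Sn (u : nat -> C) n : sum_n u (S n) = sum_n u n + u (S n).
Proof. exact (sum_Sn u n). Qed.

Lemma Csum_O (u : nat -> C) : sum_n u 0 = u 0%nat.
Proof. exact (sum_O u). Qed.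

Lemma Cmod_sum_n (u : nat -> C) n :
  (Cmod (sum_n u n) <= sum_n (fun k => Cmod (u k)) n)%R.
Proof.
induction n as [|n IH]; [rewrite Csum_O, sum_O; lra |].
rewrite Csum_Sn, sum_Sn; triangle.
now apply Rplus_le_compat_r.
Qed.

Lemma Csum_scal (c : C) (u : nat -> C) n : sum_n (fun k => c * u k) n = c * sum_n u n.
Proof. apply (sum_n_mult_l (K := C_Ring)). Qed.

Lemma Csum_ext (u v : nat -> C) n :
  (forall k, (k <= n)%nat -> u k = v k) -> sum_n u n = sum_n v n.
Proof. intros H; now apply sum_n_ext_loc. Qed.

Lemma Cis_series_ext (u v : nat -> C) (l : C) :
  (forall n, u n = v n) -> Cis_series u l -> Cis_series v l.
Proof. apply is_series_ext. Qed.

Lemma Cis_series_plus (u v : nat -> C) (l m : C) :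
  Cis_series u l -> Cis_series v m -> Cis_series (fun n => u n + v n) (l + m).
Proof. apply (is_series_plus (V := C_NormedModule)). Qed.

Lemma Cis_series_scal (c : C) (u : nat -> C) (l : C) :
  Cis_series u l -> Cis_series (fun n => c * u n) (c * l).
Proof. apply (is_series_scal (V := C_NormedModule) c). Qed.

Lemma Cis_series_minus (u v : nat -> C) (l m : C) :
  Cis_series u l -> Cis_series v m -> Cis_series (fun n => u n - v n) (l - m).
Proof.
intros Hu Hv; apply Cis_series_ext with (fun n => u n + (-1) * v n); [intros; ring |].
replace (l - m) with (l + (-1) * m) by ring.
now apply Cis_series_plus; [| apply Cis_series_scal].
Qed.

Lemma Cis_series_succ (u : nat -> C) (l : C) :
  Cis_series (fun n => u (S n)) l -> Cis_series u (u 0%nat + l).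
Proof.
intros H; apply (is_series_decr_1 (V := C_NormedModule)).
replace (plus _ _) with l; [exact H |].
change (l = (u 0%nat + l) + - u 0%nat); ring.
Qed.

Lemma Cis_series_pred (u : nat -> C) (l : C) :
  Cis_series u l -> Cis_series (fun n => u (S n)) (l - u 0%nat).
Proof.
intros H; apply (is_series_incr_1 (V := C_NormedModule)).
replace (plus _ _) with l; [exact H |].
change (l = (l - u 0%nat) + u 0%nat); ring.
Qed.

Lemma Cis_series_telescope (u V : nat -> C) (l : C) :
  (forall n, u n = V (S n) - V n) -> tends eventually V l -> Cis_series u (l - V 0%nat).
Proof.
intros Hu HV; apply Cis_series_tends.
apply (tends_ext eventually (fun n => V (S n) - V 0%nat)).
- exists 0%nat; intros n _; induction n as [|n IH]; [now rewrite Csum_O, Hu |].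
  rewrite Csum_Sn, <- IH, (Hu (Datatypes.S n)); ring.
- apply (tends_minus eventually); [now apply tends_succ | apply (tends_const eventually)].
Qed.

Definition summable (u : nat -> C) : Prop := ex_series (fun n => Cmod (u n)).

Lemma summable_le (u : nat -> C) (v : nat -> R) :
  (forall n, (Cmod (u n) <= v n)%R) -> ex_series v -> summable u.
Proof.
intros H Hv.
apply (ex_series_le (K := R_AbsRing) (V := R_CompleteNormedModule) _ v); trivial.
intros n; change (Rabs (Cmod (u n)) <= v n)%R.
now rewrite Rabs_pos_eq by apply Cmod_ge_0.
Qed.

Lemma CSeries_is_series u : summable u -> Cis_series u (CSeries u).
Proof.
intros H.
destruct (ex_series_le (K := C_AbsRing) (V := C_CompleteNormedModule) u
  (fun n => Cmod (u n))) as [l Hl]; [intros n; apply Rle_refl | exact H |].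
now rewrite (CSeries_unique u l).
Qed.

Lemma Cmod_series_le (u : nat -> C) (v : nat -> R) l m :
  (forall n, (Cmod (u n) <= v n)%R) -> Cis_series u l -> is_series v m -> (Cmod l <= m)%R.
Proof.
intros H Hu Hv; apply Cis_series_tends in Hu.
apply (tends_le eventually (sum_n u)); trivial.
exists 0%nat; intros n _.
apply Rle_trans with (1 := Cmod_sum_n _ _).
apply Rle_trans with (sum_n v n).
- apply sum_n_m_le; intros; apply H.
- apply (is_lim_seq_incr_compare (sum_n v) m); [exact Hv |].
  intros k; rewrite sum_Sn; change (sum_n v k <= sum_n v k + v (S k))%R.
  generalize (H (S k)) (Cmod_ge_0 (u (S k))); lra.
Qed.

Lemma Cmod_CSeries_le (u : nat -> C) (v : nat -> R) :
  (forall n, (Cmod (u n) <= v n)%R) -> ex_series v -> (Cmod (CSeries u) <= Series v)%R.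
Proof.
intros H Hv; apply Cmod_series_le with u v; trivial.
- apply CSeries_is_series; now apply summable_le with v.
- now apply Series_correct.
Qed.

Lemma CSeries_ext u v : (forall n, u n = v n) -> CSeries u = CSeries v.
Proof. now intros H; replace v with u; [| apply functional_extensionality]. Qed.

Lemma summable_scal (c : C) u : summable u -> summable (fun n => c * u n).
Proof.
intros H; apply summable_le with (fun n => (Cmod c * Cmod (u n))%R).
- intros n; rewrite Cmod_mult; lra.
- now apply (ex_series_scal (V := R_NormedModule)).
Qed.

Lemma CSeries_scal c u : summable u -> CSeries (fun n => c * u n) = c * CSeries u.
Proof. intros H; apply CSeries_unique, Cis_series_scal; now apply CSeries_is_series. Qed.

(** Tannery's theorem: dominated convergence for series. *)
Lemma tannery {T} (F : (T -> Prop) -> Prop) {FF : Filter F}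
    (f : T -> nat -> C) (l : nat -> C) (s : nat -> R) :
  ex_series s ->
  F (fun x => forall n, (Cmod (f x n) <= s n)%R) ->
  (forall n, (Cmod (l n) <= s n)%R) ->
  (forall n, tends F (fun x => f x n) (l n)) ->
  tends F (fun x => CSeries (f x)) (CSeries l).
Proof.
intros Hs Hf Hl Hn eps He.
assert (He' : (0 < eps / 4)%R) by lra.
assert (HS := Series_correct s Hs).
revert HS; generalize (Series s); intros S HS.
assert (HS' : is_lim_seq (sum_n s) S) by exact HS.
apply is_lim_seq_spec in HS'.
destruct (HS' (mkposreal _ He')) as [N HN]; simpl in HN.
assert (Tail : forall u : nat -> C, (forall n, (Cmod (u n) <= s n)%R) ->
  (Cmod (CSeries u - sum_n u N) <= eps / 4)%R).
{ intros u Hu.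
  assert (Hsu := CSeries_is_series u (summable_le _ _ Hu Hs)).
  apply Rle_trans with (S - sum_n s N)%R.
  - apply Cmod_series_le with (fun k => u (Datatypes.S N + k)%nat)
      (fun k => s (Datatypes.S N + k)%nat).
    + intros; apply Hu.
    + apply (is_series_incr_n (V := C_NormedModule)); [lia |]; simpl pred.
      replace (plus _ _) with (CSeries u); [exact Hsu |].
      change (CSeries u = CSeries u - sum_n u N + sum_n u N); ring.
    + apply (is_series_incr_n (V := R_NormedModule)); [lia |]; simpl pred.
      replace (plus _ _) with S; [exact HS |].
      change (@eq R S (S - sum_n s N + sum_n s N)%R); ring.
  - generalize (HN N (le_n _)); intros A; apply Rabs_def2 in A; lra. }
assert (Fin : tends F (fun x => sum_n (f x) N) (sum_n l N)).
{ clear - Hn FF; induction N as [|N IH].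
  - apply tends_ext with (fun x => f x 0%nat); trivial.
    + apply filter_forall; intros x; now rewrite Csum_O.
    + rewrite Csum_O; apply Hn.
  - apply tends_ext with (fun x => sum_n (f x) N + f x (Datatypes.S N)); trivial.
    + apply filter_forall; intros x; now rewrite Csum_Sn.
    + rewrite Csum_Sn; now apply tends_plus. }
generalize (filter_and _ _ Hf (Fin _ He')); apply filter_imp; intros x [A B].
replace (CSeries (f x) - CSeries l) with
  ((CSeries (f x) - sum_n (f x) N) + (sum_n (f x) N - sum_n l N)
   + - (CSeries l - sum_n l N)) by ring.
generalize (Tail _ A) (Tail _ Hl); intros T1 T2.
eapply Rle_lt_trans; [apply Cmod_triangle |].
eapply Rle_lt_trans; [apply Rplus_le_compat_r, Cmod_triangle |].
rewrite Cmod_opp; lra.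
Qed.

Lemma CSeries_sum_n (f : nat -> nat -> C) n :
  (forall j, summable (fun i => f i j)) ->
  Cis_series (fun i => sum_n (f i) n) (sum_n (fun j => CSeries (fun i => f i j)) n).
Proof.
intros H; induction n as [|n IH].
- rewrite Csum_O; apply Cis_series_ext with (fun i => f i 0%nat).
  + intros; now rewrite Csum_O.
  + now apply CSeries_is_series.
- rewrite Csum_Sn; apply Cis_series_ext with (fun i => sum_n (f i) n + f i (S n)).
  + intros; now rewrite Csum_Sn.
  + apply Cis_series_plus; [exact IH | now apply CSeries_is_series].
Qed.

(** Fubini for series follows from Tannery's theorem applied to the partial sums
    of the rows. *)
Lemma CSeries_fubini (f : nat -> nat -> C) (s : nat -> R) :
  (forall i, summable (f i)) ->
  (forall i, (Series (fun j => Cmod (f i j)) <= s i)%R) -> ex_series s ->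
  Cis_series (fun j => CSeries (fun i => f i j)) (CSeries (fun i => CSeries (f i))).
Proof.
intros H1 H2 H3.
assert (Part : forall i n, (sum_n (fun j => Cmod (f i j)) n <= s i)%R).
{ intros i n; apply Rle_trans with (2 := H2 i).
  apply (is_lim_seq_incr_compare (sum_n (fun j => Cmod (f i j)))).
  - apply (Series_correct _ (H1 i)).
  - intros k; rewrite sum_Sn; unfold plus; simpl.
    generalize (Cmod_ge_0 (f i (S k))); lra. }
assert (Term : forall i j, (Cmod (f i j) <= s i)%R).
{ intros i j; apply Rle_trans with (2 := Part i j); destruct j as [|j].
  - rewrite sum_O; lra.
  - rewrite sum_Sn; unfold plus; simpl.
    assert (0 <= sum_n (fun j => Cmod (f i j)) j)%R; [| lra].
    rewrite <- (Rmult_0_r (INR (S j))), <- (sum_n_const j 0).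
    apply sum_n_m_le; intros; apply Cmod_ge_0. }
apply Cis_series_tends.
apply (tends_ext eventually (fun n => CSeries (fun i => sum_n (f i) n))).
{ exists 0%nat; intros n _; apply CSeries_unique, CSeries_sum_n.
  intros j; now apply summable_le with s. }
apply (tannery eventually) with s; [exact H3 | | |].
- exists 0%nat; intros n _ i; apply Rle_trans with (1 := Cmod_sum_n _ _); apply Part.
- intros i; apply Rle_trans with (2 := H2 i); apply Cmod_CSeries_le; [intros; lra | apply H1].
- intros i; apply Cis_series_tends; now apply CSeries_is_series.
Qed.

Lemma CSeries_fubini_prod (f : nat -> nat -> C) (A B : nat -> R) :
  (forall i j, (Cmod (f i j) <= A i * B j)%R) -> ex_series A -> ex_series B ->
  CSeries (fun j => CSeries (fun i => f i j)) = CSeries (fun i => CSeries (f i)).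
Proof.
intros H HA HB.
assert (HAB : forall i, ex_series (fun j => A i * B j)%R)
  by (intros i; now apply (ex_series_scal (V := R_NormedModule))).
apply CSeries_unique, CSeries_fubini with (fun i => (A i * Series B)%R).
- intros i; now apply summable_le with (fun j => (A i * B j)%R).
- intros i; rewrite <- Series_scal_l; apply Series_le; [| apply HAB].
  intros j; split; [apply Cmod_ge_0 | apply H].
- apply (ex_series_scal_r (Series B) A HA).
Qed.

Lemma summable_ext u v : (forall n, u n = v n) -> summable u -> summable v.
Proof. intros H; apply ex_series_ext; intros n; now rewrite H. Qed.

Lemma Cis_series_shift (u : nat -> C) l j :
  Cis_series u l ->
  Cis_series (fun k => if Nat.ltb k j then RtoC 0 else u (k - j)%nat) l.
Proof.
intros H; induction j as [|j IH].
- apply Cis_series_ext with u; [intros n; simpl; now rewrite Nat.sub_0_r | exact H].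
- replace l with (RtoC 0 + l) by ring.
  apply (Cis_series_succ (fun k => if Nat.ltb k (S j) then RtoC 0 else u (k - S j)%nat)).
  exact IH.
Qed.

Definition convol (q p : nat -> C) (k : nat) : C :=
  sum_n (fun j => q (k - j)%nat * p j) k.

Lemma convol_summable q p : summable q -> summable p -> summable (convol q p).
Proof.
intros Hq Hp.
assert (E : forall u : nat -> C, summable u -> ex_series (fun n => Rabs (Cmod (u n)))).
{ intros u Hu; apply ex_series_ext with (2 := Hu).
  intros n; now rewrite Rabs_pos_eq by apply Cmod_ge_0. }
apply summable_le with
  (fun k => sum_f_R0 (fun j => Cmod (p j) * Cmod (q (k - j)%nat))%R k).
- intros k; unfold convol; apply Rle_trans with (1 := Cmod_sum_n _ _).
  rewrite <- sum_n_Reals; apply sum_n_m_le; intros j; rewrite Cmod_mult; lra.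
- exists (Series (fun n => Cmod (p n)) * Series (fun n => Cmod (q n)))%R.
  apply (is_series_mult (fun n => Cmod (p n)) (fun n => Cmod (q n)));
    [apply Series_correct; exact Hp | apply Series_correct; exact Hq | |]; now apply E.
Qed.

Lemma sum_n_truncate (u : nat -> C) k n :
  (k <= n)%nat ->
  sum_n (fun j => if Nat.ltb k j then RtoC 0 else u j) n = sum_n u k.
Proof.
intros H; induction H as [|n H IH].
- apply sum_n_ext_loc; intros j Hj; now rewrite (proj2 (Nat.ltb_ge _ _) Hj).
- assert (E : Nat.ltb k (S n) = true) by (apply Nat.ltb_lt; lia).
  rewrite Csum_Sn, IH, E; apply Cplus_0_r.
Qed.

(** Fubini for the triangular array [q (k - j) * p j * phi k], whose rows are
    shifted copies of [q].  With [phi] the moments of [(1 - t)^k], this is how the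
    product of two power series in [1 - t] is integrated. *)
Lemma convol_weight (q p phi : nat -> C) (M : R) :
  summable q -> summable p -> (forall k, (Cmod (phi k) <= M)%R) ->
  Cis_series (fun k => convol q p k * phi k)
    (CSeries (fun j => p j * CSeries (fun i => q i * phi (i + j)%nat))).
Proof.
intros Hq Hp HM.
set (f := fun j k => if Nat.ltb k j then RtoC 0 else q (k - j)%nat * p j * phi k).
assert (HqM : ex_series (fun i => Cmod (q i) * M)%R) by now apply ex_series_scal_r.
assert (Hw : forall j, summable (fun i => q i * phi (i + j)%nat)).
{ intros j; apply summable_le with (2 := HqM); intros i; rewrite Cmod_mult.
  apply Rmult_le_compat_l; [apply Cmod_ge_0 | apply HM]. }
assert (Eqf : forall j k, f j k =
  if Nat.ltb k j then RtoC 0 else (fun i => p j * (q i * phi (i + j)%nat)) (k - j)%nat).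
{ intros j k; unfold f; destruct (Nat.ltb k j) eqn:E; trivial.
  apply Nat.ltb_ge in E; replace (k - j + j)%nat with k by lia; ring. }
assert (Abs : forall j, is_series (fun k => Cmod (f j k))
  (Series (fun i => Cmod (p j * (q i * phi (i + j)%nat))))).
{ intros j; generalize (Series_correct _ (summable_scal (p j) _ (Hw j))).
  intros A; clear - A Eqf; revert A.
  set (v := fun n => Cmod (p j * (q n * phi (n + j)%nat))).
  intros A; apply is_series_ext with (fun k => if Nat.ltb k j then 0%R else v (k - j)%nat).
  { intros k; rewrite Eqf; destruct (Nat.ltb k j); [now rewrite Cmod_0 | reflexivity]. }
  revert A; generalize (Series v); clearbody v; intros l A; clear -A; induction j as [|j IH].
  - apply is_series_ext with v; [intros n; simpl; now rewrite Nat.sub_0_r | exact A].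
  - apply is_series_decr_1.
    match goal with |- is_series _ ?m => assert (m = l) as -> end.
    { change ((l + - 0)%R = l); ring. }
    exact IH. }
assert (Row : forall j, CSeries (f j) = p j * CSeries (fun i => q i * phi (i + j)%nat)).
{ intros j; apply CSeries_unique.
  apply Cis_series_ext with (2 := Cis_series_shift _ _ j (Cis_series_scal (p j) _ _
    (CSeries_is_series _ (Hw j)))).
  intros k; now rewrite Eqf. }
rewrite <- (CSeries_ext _ _ Row).
apply Cis_series_ext with (fun k => CSeries (fun j => f j k)).
- intros k; apply CSeries_unique, Cis_series_tends.
  apply (tends_ext eventually (fun _ => convol q p k * phi k)).
  + exists k; intros n Hn; unfold f.
    etransitivity;
      [| symmetry; exact (sum_n_truncate (fun j => q (k - j)%nat * p j * phi k) k n Hn)].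
    unfold convol; rewrite Cmult_comm, <- Csum_scal; apply Csum_ext; intros; ring.
  + apply (tends_const eventually).
- apply CSeries_fubini with (fun j => (Cmod (p j) * Series (fun i => Cmod (q i) * M))%R).
  + intros j; eexists; apply Abs.
  + intros j; rewrite (is_series_unique _ _ (Abs j)), <- Series_scal_l.
    apply Series_le; [| now apply (ex_series_scal (V := R_NormedModule))].
    intros i; split; [apply Cmod_ge_0 | rewrite !Cmod_mult].
    apply Rmult_le_compat_l; [apply Cmod_ge_0 |].
    apply Rmult_le_compat_l; [apply Cmod_ge_0 | apply HM].
  + now apply ex_series_scal_r.
Qed.

Lemma bounded_of_tail (f : nat -> R) (N : nat) (B : R) :
  (forall n, (N <= n)%nat -> (f n <= B)%R) ->
  exists M, (0 <= M)%R /\ forall n, (f n <= M)%R.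
Proof.
revert B; induction N as [|N IH]; intros B H.
- exists (Rmax 0 B); split; [apply Rmax_l |].
  intros n; apply Rle_trans with (2 := Rmax_r 0 B), H; lia.
- apply (IH (Rmax B (f N))); intros n Hn.
  destruct (Nat.eq_dec n N) as [-> | Hne]; [apply Rmax_r |].
  apply Rle_trans with (2 := Rmax_l _ _), H; lia.
Qed.

(** * Complex-valued functions of a real variable *)

Definition Cderiv (f : R -> C) (t : R) (l : C) : Prop :=
  is_derive (fun s => Re (f s)) t (Re l) /\ is_derive (fun s => Im (f s)) t (Im l).

Definition Ccont (f : R -> C) (t : R) : Prop := tends (locally t) f (f t).

Notation C_is_RInt := (@is_RInt C_R_NormedModule).

Lemma Ccont_continuous (f : R -> C) t : Ccont f t -> @continuous R_UniformSpace C_UniformSpace f t.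
Proof. intros H; apply tends_filterlim in H; [exact H | apply locally_filter]. Qed.

Lemma Ccont_RtoC (f : R -> R) t : continuous f t -> Ccont (fun s => RtoC (f s)) t.
Proof.
intros H eps He.
generalize (proj1 (filterlim_locally f (f t)) H (mkposreal eps He)); apply filter_imp.
intros s Hs; rewrite <- RtoC_minus, Cmod_R; exact Hs.
Qed.

Lemma Ccont_const (c : C) t : Ccont (fun _ => c) t.
Proof. apply (tends_const (locally t)). Qed.

Lemma Ccont_id t : Ccont (fun s => RtoC s) t.
Proof. apply Ccont_RtoC, continuous_id. Qed.

Lemma Ccont_plus (f g : R -> C) t : Ccont f t -> Ccont g t -> Ccont (fun s => f s + g s) t.
Proof. intros; now apply (tends_plus (locally t)). Qed.

Lemma Ccont_minus (f g : R -> C) t : Ccont f t -> Ccont g t -> Ccont (fun s => f s - g s) t.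
Proof. intros; now apply (tends_minus (locally t)). Qed.

Lemma Ccont_mult (f g : R -> C) t : Ccont f t -> Ccont g t -> Ccont (fun s => f s * g s) t.
Proof. intros; now apply (tends_mult (locally t)). Qed.

Lemma Ccont_div (f g : R -> C) t : g t <> 0 -> Ccont f t -> Ccont g t -> Ccont (fun s => f s / g s) t.
Proof. intros H1 H2 H3; exact (tends_div (locally t) f g (f t) (g t) H1 H2 H3). Qed.

Lemma Ccont_pow (f : R -> C) t n : Ccont f t -> Ccont (fun s => f s ^ n) t.
Proof.
intros H; induction n as [|n IH]; [apply (Ccont_const 1) |].
now apply (Ccont_mult f (fun s => f s ^ n)).
Qed.

Lemma Cderiv_ext (f g : R -> C) t (l : C) : (forall s, f s = g s) -> Cderiv f t l -> Cderiv g t l.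
Proof.
intros H [A B]; split; [eapply is_derive_ext; [| exact A] | eapply is_derive_ext; [| exact B]];
  intros s; simpl; now rewrite H.
Qed.

Lemma Cderiv_const (c : C) t : Cderiv (fun _ => c) t 0.
Proof. split; simpl; apply (is_derive_const (V := R_NormedModule)). Qed.

Lemma Cderiv_id t : Cderiv (fun s => RtoC s) t 1.
Proof. split; simpl; [exact (is_derive_id t) | apply (is_derive_const (V := R_NormedModule))]. Qed.

Lemma Cderiv_plus (f g : R -> C) t (l m : C) :
  Cderiv f t l -> Cderiv g t m -> Cderiv (fun s => f s + g s) t (l + m).
Proof.
intros [A B] [A' B']; split.
- exact (is_derive_plus (V := R_NormedModule) _ _ _ _ _ A A').
- exact (is_derive_plus (V := R_NormedModule) _ _ _ _ _ B B').
Qed.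

Lemma Cderiv_mult (f g : R -> C) t (l m : C) :
  Cderiv f t l -> Cderiv g t m -> Cderiv (fun s => f s * g s) t (l * g t + f t * m).
Proof.
intros [A B] [A' B'].
assert (M : forall (u v : R -> R) u' v', is_derive u t u' -> is_derive v t v' ->
  is_derive (fun s => u s * v s)%R t (u' * v t + u t * v')%R).
{ intros u v u' v' Hu Hv; apply (is_derive_mult u v t u' v' Hu Hv); intros; apply Rmult_comm. }
split.
- evar_last.
  + exact (is_derive_minus (V := R_NormedModule) _ _ _ _ _ (M _ _ _ _ A A') (M _ _ _ _ B B')).
  + destruct l, m, (f t), (g t); unfold minus, plus, opp; simpl; ring.
- evar_last.
  + exact (is_derive_plus (V := R_NormedModule) _ _ _ _ _ (M _ _ _ _ A B') (M _ _ _ _ B A')).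
  + destruct l, m, (f t), (g t); unfold minus, plus, opp; simpl; ring.
Qed.

Lemma Cderiv_scal (c : C) (f : R -> C) t (l : C) : Cderiv f t l -> Cderiv (fun s => c * f s) t (c * l).
Proof.
intros H; generalize (Cderiv_mult _ _ t _ _ (Cderiv_const c t) H).
now replace (0 * f t + c * l) with (c * l) by ring.
Qed.

Lemma Cderiv_Cexp (f : R -> C) t (l : C) : Cderiv f t l -> Cderiv (fun s => Cexp (f s)) t (l * Cexp (f t)).
Proof.
intros [A B].
assert (Dl : is_derive (fun s => exp (Re (f s))) t (Re l * exp (Re (f t)))%R).
{ apply (is_derive_comp exp (fun s => Re (f s))); [apply is_derive_exp | exact A]. }
assert (Dc : is_derive (fun s => cos (Im (f s))) t (Im l * - sin (Im (f t)))%R).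
{ apply (is_derive_comp cos (fun s => Im (f s))); [apply is_derive_cos | exact B]. }
assert (Ds : is_derive (fun s => sin (Im (f s))) t (Im l * cos (Im (f t)))%R).
{ apply (is_derive_comp sin (fun s => Im (f s))); [apply is_derive_sin | exact B]. }
assert (E : forall s, Cexp (f s) = RtoC (exp (Re (f s))) *
  ((fun s => RtoC (cos (Im (f s)))) s + Ci * (fun s => RtoC (sin (Im (f s)))) s)).
{ intros s; unfold Cexp, Ci; apply injective_projections; simpl; ring. }
apply Cderiv_ext with (1 := fun s => eq_sym (E s)).
assert (R1 : forall (u : R -> R) u', is_derive u t u' -> Cderiv (fun s => RtoC (u s)) t u').
{ intros u u' H; split; simpl; [exact H | apply (is_derive_const (V := R_NormedModule))]. }
generalize (Cderiv_mult _ _ t _ _ (R1 _ _ Dl)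
  (Cderiv_plus _ _ t _ _ (R1 _ _ Dc) (Cderiv_scal Ci _ t _ (R1 _ _ Ds)))).
match goal with |- Cderiv _ _ ?x -> Cderiv _ _ ?y => replace y with x; [easy |] end.
rewrite E; destruct l; unfold Ci; apply injective_projections; simpl; ring.
Qed.

Lemma Cderiv_cont (f : R -> C) t (l : C) : Cderiv f t l -> Ccont f t.
Proof.
intros [A B].
assert (E : forall s, f s = RtoC (Re (f s)) + Ci * RtoC (Im (f s))).
{ intros s; unfold Ci, Re, Im; apply injective_projections; simpl; ring. }
apply (tends_ext (locally t) (fun s => RtoC (Re (f s)) + Ci * RtoC (Im (f s)))).
- apply filter_forall; intros s; now rewrite <- E.
- rewrite (E t).
  apply (Ccont_plus (fun s => RtoC (Re (f s))) (fun s => Ci * RtoC (Im (f s)))).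
  + apply Ccont_RtoC, (ex_derive_continuous (V := R_NormedModule)); now exists (Re l).
  + apply Ccont_mult; [apply Ccont_const |].
    apply Ccont_RtoC, (ex_derive_continuous (V := R_NormedModule)); now exists (Im l).
Qed.

Lemma C_ex_RInt (f : R -> C) a b :
  (forall t, (Rmin a b <= t <= Rmax a b)%R -> Ccont f t) -> exists l, C_is_RInt f a b l.
Proof.
intros H; apply (ex_RInt_continuous (V := C_R_CompleteNormedModule)); intros t Ht.
now apply Ccont_continuous, H.
Qed.

Lemma C_FTC (f f' : R -> C) a b :
  (forall t, (Rmin a b <= t <= Rmax a b)%R -> Cderiv f t (f' t)) ->
  (forall t, (Rmin a b <= t <= Rmax a b)%R -> Ccont f' t) ->
  C_is_RInt f' a b (f b - f a).
Proof.
intros H1 H2.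
apply (is_RInt_fct_extend_pair (U := R_NormedModule) (V := R_NormedModule)).
- apply (is_RInt_derive (V := R_CompleteNormedModule) (fun t => fst (f t))); intros t Ht.
  + apply (H1 t Ht).
  + apply (continuous_comp f' fst); [now apply Ccont_continuous, H2 | apply continuous_fst].
- apply (is_RInt_derive (V := R_CompleteNormedModule) (fun t => snd (f t))); intros t Ht.
  + apply (H1 t Ht).
  + apply (continuous_comp f' snd); [now apply Ccont_continuous, H2 | apply continuous_snd].
Qed.

Lemma C_RInt_scal (c : C) (f : R -> C) a b (l : C) : C_is_RInt f a b l -> C_is_RInt (fun t => c * f t) a b (c * l).
Proof.
intros H.
assert (H1 := is_RInt_fct_extend_fst (U := R_NormedModule) (V := R_NormedModule) _ _ _ _ H).
assert (H2 := is_RInt_fct_extend_snd (U := R_NormedModule) (V := R_NormedModule) _ _ _ _ H).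
apply (is_RInt_fct_extend_pair (U := R_NormedModule) (V := R_NormedModule)); simpl.
- apply (is_RInt_minus (V := R_NormedModule) (fun t => fst c * fst (f t))%R
    (fun t => snd c * snd (f t))%R); now apply (is_RInt_scal (V := R_NormedModule)).
- apply (is_RInt_plus (V := R_NormedModule) (fun t => fst c * snd (f t))%R
    (fun t => snd c * fst (f t))%R); now apply (is_RInt_scal (V := R_NormedModule)).
Qed.

Lemma C_RInt_plus (f g : R -> C) a b (l m : C) : C_is_RInt f a b l -> C_is_RInt g a b m ->
  C_is_RInt (fun t => f t + g t) a b (l + m).
Proof. apply (is_RInt_plus (V := C_R_NormedModule)). Qed.

Lemma C_RInt_minus (f g : R -> C) a b (l m : C) : C_is_RInt f a b l -> C_is_RInt g a b m ->
  C_is_RInt (fun t => f t - g t) a b (l - m).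
Proof. apply (is_RInt_minus (V := C_R_NormedModule)). Qed.

Lemma C_RInt_ext (f g : R -> C) a b (l : C) : (forall t, f t = g t) -> C_is_RInt f a b l -> C_is_RInt g a b l.
Proof. intros H; apply is_RInt_ext; intros; apply H. Qed.

Lemma C_RInt_unique (f : R -> C) a b (l m : C) : C_is_RInt f a b l -> C_is_RInt f a b m -> l = m.
Proof.
intros H1 H2.
rewrite <- (is_RInt_unique (V := C_R_CompleteNormedModule) _ _ _ _ H1).
apply (is_RInt_unique (V := C_R_CompleteNormedModule) _ _ _ _ H2).
Qed.

Lemma C_RInt_le (f : R -> C) (g : R -> R) a b (l : C) m :
  (a <= b)%R -> (forall t, (a <= t <= b)%R -> (Cmod (f t) <= g t)%R) ->
  C_is_RInt f a b l -> is_RInt g a b m -> (Cmod l <= m)%R.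
Proof.
intros Hab H Hf Hg; rewrite Cmod_norm.
apply (norm_RInt_le (V := C_R_NormedModule) f g a b); trivial.
intros t Ht; apply Rle_trans with (2 := H t Ht); right; symmetry; exact (Cmod_norm (f t)).
Qed.

Lemma C_RInt_le_const (f : R -> C) (M : R) (l : C) :
  (forall t, (0 <= t <= 1)%R -> (Cmod (f t) <= M)%R) -> C_is_RInt f 0 1 l -> (Cmod l <= M)%R.
Proof.
intros H Hf; apply (C_RInt_le f (fun _ => M) 0 1); trivial; [lra |].
evar_last; [apply (is_RInt_const (V := R_NormedModule)) |].
unfold scal; simpl; unfold mult; simpl; ring.
Qed.

Lemma C_const_of_deriv0 (f : R -> C) a b :
  (forall t, (Rmin a b <= t <= Rmax a b)%R -> Cderiv f t 0) -> f b = f a.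
Proof.
intros H; apply Ceq_minus.
apply (C_RInt_unique (fun _ => RtoC 0) a b).
- apply C_FTC; [exact H | intros; apply Ccont_const].
- evar_last; [apply (is_RInt_const (V := C_R_NormedModule)) |].
  apply injective_projections; simpl; unfold scal; simpl; unfold mult; simpl; ring.
Qed.

(** * The complex exponential *)

Lemma Cexp_0 : Cexp 0 = 1.
Proof. unfold Cexp, Re, Im; simpl; rewrite exp_0, cos_0, sin_0; apply injective_projections; simpl; ring. Qed.

Lemma Cexp_plus z w : Cexp (z + w) = Cexp z * Cexp w.
Proof.
unfold Cexp, Re, Im; simpl; rewrite exp_plus, cos_plus, sin_plus.
apply injective_projections; simpl; ring.
Qed.

Lemma Cexp_neq_0 z : Cexp z <> 0.
Proof.
intros H; apply C1_nz; rewrite <- Cexp_0; replace (RtoC 0) with (z + - z) by ring.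
rewrite Cexp_plus, H; ring.
Qed.

Lemma Cexp_opp z : Cexp (- z) = / Cexp z.
Proof.
assert (H := Cexp_plus z (- z)); replace (z + - z) with (RtoC 0) in H by ring.
rewrite Cexp_0 in H.
assert (A := Cexp_neq_0 z); replace (/ Cexp z) with (1 / Cexp z) by (field; exact A).
rewrite H; field; exact A.
Qed.

Lemma Cmod_Cexp z : Cmod (Cexp z) = exp (Re z).
Proof.
unfold Cexp; rewrite Cmod_mult, Cmod_R, Rabs_pos_eq by (left; apply exp_pos).
replace (Cmod _) with 1%R; [ring |].
unfold Cmod; simpl; generalize (sin2_cos2 (Im z)); unfold Rsqr; intros H.
transitivity (sqrt 1); [symmetry; apply sqrt_1 | f_equal; lra].
Qed.

Lemma exp_le x y : (x <= y)%R -> (exp x <= exp y)%R.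
Proof. intros [H | ->]; [left; now apply exp_increasing | lra]. Qed.

Lemma RtoC_neq_0 (r : R) : r <> 0%R -> RtoC r <> 0.
Proof. intros H E; apply H; now apply RtoC_inj. Qed.

Lemma cfact_neq_0 n : cfact n <> 0.
Proof. unfold cfact; apply RtoC_neq_0, INR_fact_neq_0. Qed.

Lemma cfact_S n : cfact (S n) = RtoC (INR (S n)) * cfact n.
Proof. unfold cfact; rewrite <- RtoC_mult, <- mult_INR; reflexivity. Qed.

Lemma Cmod_cfact n : Cmod (cfact n) = INR (fact n).
Proof. unfold cfact; rewrite Cmod_R, Rabs_pos_eq; [easy | apply pos_INR]. Qed.

Lemma RtoC_INR_S_neq_0 n : RtoC (INR (S n)) <> 0.
Proof. apply RtoC_neq_0, not_0_INR; lia. Qed.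

(** Taylor remainders of [t |-> Cexp (t z)], numbered so that each one is the
    primitive of [z] times the preceding one that vanishes at [0]. *)
Definition Cexp_rest (z : C) (n : nat) (t : R) : C :=
  match n with
  | O => Cexp (t * z)
  | S m => Cexp (t * z) - sum_n (fun k => (t * z) ^ k / cfact k) m
  end.

Lemma Cexp_rest_deriv z n t : Cderiv (Cexp_rest z (S n)) t (z * Cexp_rest z n t).
Proof.
assert (D : forall t, Cderiv (fun s => s * z) t z).
{ intros s; generalize (Cderiv_mult _ _ s _ _ (Cderiv_id s) (Cderiv_const z s)).
  now replace (1 * z + s * 0) with z by ring. }
assert (DE := Cderiv_Cexp _ t _ (D t)).
assert (P : forall m, Cderiv (fun s => (s * z) ^ S m / cfact (S m)) t
  (z * ((t * z) ^ m / cfact m))).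
{ intros m.
  assert (Q : Cderiv (fun s => (s * z) ^ S m) t (RtoC (INR (S m)) * z * (t * z) ^ m)).
  { induction m as [|m IH].
    - apply Cderiv_ext with (fun s => s * z); [intros; simpl; ring |].
      simpl (RtoC _ * _ * _); replace (1 * z * 1) with z by ring; apply D.
    - apply Cderiv_ext with (fun s => (s * z) * (s * z) ^ S m); [reflexivity |].
      generalize (Cderiv_mult _ _ t _ _ (D t) IH).
      match goal with |- Cderiv _ _ ?x -> Cderiv _ _ ?y => replace x with y; [easy |] end.
      rewrite (S_INR (S m)), RtoC_plus, !Cpow_S; ring. }
  generalize (Cderiv_mult _ _ t _ _ Q (Cderiv_const (/ cfact (S m)) t)).
  match goal with |- Cderiv _ _ ?x -> Cderiv _ _ ?y => replace x with y; [easy |] end.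
  rewrite cfact_S; field; split; [apply cfact_neq_0 | apply RtoC_INR_S_neq_0]. }
induction n as [|n IH].
- apply Cderiv_ext with (fun s => Cexp (s * z) + - (1)).
  + intros s; simpl; rewrite Csum_O; unfold cfact; simpl; field.
  + generalize (Cderiv_plus _ _ t _ _ DE (Cderiv_const (- (1)) t)).
    now replace (z * Cexp (t * z) + 0) with (z * Cexp (t * z)) by ring.
- apply Cderiv_ext with
    (fun s => Cexp_rest z (S n) s + (-1) * ((s * z) ^ S n / cfact (S n))).
  + intros s; unfold Cexp_rest; rewrite Csum_Sn; ring.
  + generalize (Cderiv_plus _ _ t _ _ IH (Cderiv_scal (-1) _ t _ (P n))).
    match goal with |- Cderiv _ _ ?x -> Cderiv _ _ ?y => replace x with y; [easy |] end.
    destruct n as [|n]; simpl Cexp_rest.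
    * rewrite Csum_O; unfold cfact; simpl; field.
    * rewrite Csum_Sn; ring.
Qed.

Lemma Cexp_rest_bound z n t : (0 <= t <= 1)%R ->
  (Cmod (Cexp_rest z n t) <= exp (Cmod z) * (Cmod z * t) ^ n / INR (fact n))%R.
Proof.
revert t; induction n as [|n IH]; intros t Ht.
- simpl; unfold Rdiv; rewrite Rinv_1, !Rmult_1_r, Cmod_Cexp; apply exp_le.
  apply Rle_trans with (Rabs (Re (t * z))); [apply Rle_abs |].
  apply Rle_trans with (1 := re_le_Cmod _).
  rewrite Cmod_mult, Cmod_R, Rabs_pos_eq by lra; generalize (Cmod_ge_0 z); nra.
- assert (Z : Cexp_rest z (S n) 0 = 0).
  { clear; unfold Cexp_rest; replace (0 * z) with (RtoC 0) by ring; rewrite Cexp_0.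
    induction n as [|n IH]; [rewrite Csum_O; unfold cfact; simpl; field |].
    rewrite Csum_Sn, Cpow_S.
    replace (1 - (sum_n (fun k => 0 ^ k / cfact k) n + 0 * 0 ^ n / cfact (S n)))
      with (1 - sum_n (fun k => 0 ^ k / cfact k) n) by (field; apply cfact_neq_0).
    exact IH. }
  replace (Cexp_rest z (S n) t) with (Cexp_rest z (S n) t - Cexp_rest z (S n) 0)
    by (rewrite Z; ring).
  apply (C_RInt_le (fun s => z * Cexp_rest z n s)
    (fun s => Cmod z * (exp (Cmod z) * (Cmod z * s) ^ n / INR (fact n)))%R 0 t); [lra | | |].
  + intros s Hs; rewrite Cmod_mult; apply Rmult_le_compat_l; [apply Cmod_ge_0 |].
    apply IH; lra.
  + apply C_FTC; intros s _; [apply Cexp_rest_deriv |].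
    apply Ccont_mult; [apply Ccont_const |].
    destruct n as [|n]; [| eapply Cderiv_cont, Cexp_rest_deriv].
    eapply Cderiv_cont, Cderiv_Cexp, Cderiv_mult; [apply Cderiv_id | apply Cderiv_const].
  + evar_last.
    * apply (is_RInt_derive (V := R_CompleteNormedModule)
        (fun s => exp (Cmod z) * (Cmod z * s) ^ S n / INR (fact (S n)))%R).
      -- intros s _; rewrite fact_simpl, mult_INR.
         generalize (INR_fact_neq_0 n) (not_0_INR (S n) (Nat.neq_succ_0 n)).
         generalize (INR (fact n)); intros d Hd HS.
         auto_derive; [trivial |].
         change (Init.Nat.pred (S n)) with n.
         change (match n with 0%nat => 1 | S _ => INR n + 1 end)%R with (INR (S n)).
         field; now split.
      -- intros s _; apply (ex_derive_continuous (V := R_NormedModule)); auto_derive; trivial.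
    * unfold minus, plus, opp; simpl; rewrite Rmult_0_r, Rmult_0_l; unfold Rdiv; ring.
Qed.

(** Taylor's formula for [Cexp], whose definition only knows the real functions. *)
Lemma Cexp_taylor z n :
  (Cmod (Cexp z - sum_n (fun k => z ^ k / cfact k)%C n)
   <= exp (Cmod z) * Cmod z ^ S n / INR (fact (S n)))%R.
Proof.
assert (H := Cexp_rest_bound z (S n) 1 ltac:(lra)).
rewrite Rmult_1_r in H.
replace (Cexp_rest z (S n) 1) with (Cexp z - sum_n (fun k => z ^ k / cfact k) n) in H; trivial.
unfold Cexp_rest; now replace (1 * z) with z by ring.
Qed.

Lemma pow_fact_series (r : R) : is_series (fun n => r ^ n / INR (fact n))%R (exp r).
Proof.
apply is_series_ext with (2 := is_exp_Reals r); intros n.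
rewrite pow_n_pow; unfold scal; simpl; unfold mult; simpl; unfold Rdiv; ring.
Qed.

Lemma Cexp_series z : Cis_series (fun k => z ^ k / cfact k) (Cexp z).
Proof.
apply Cis_series_tends.
apply (tends_squeeze eventually _
  (fun n => RtoC (exp (Cmod z) * (Cmod z ^ S n / INR (fact (S n)))))).
- exists 0%nat; intros n _.
  replace (sum_n (fun k => z ^ k / cfact k) n - Cexp z)
    with (- (Cexp z - sum_n (fun k => z ^ k / cfact k) n)) by ring.
  rewrite Cmod_opp, Cmod_R; apply Rle_trans with (1 := Cexp_taylor z n).
  unfold Rdiv; rewrite Rmult_assoc; apply Rle_abs.
- apply tends_R.
  replace (Finite 0) with (Rbar_mult (exp (Cmod z)) 0) by (simpl; f_equal; ring).
  apply is_lim_seq_scal_l.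
  apply (is_lim_seq_incr_1 (fun n => Cmod z ^ n / INR (fact n))%R).
  apply ex_series_lim_0; eexists; apply pow_fact_series.
Qed.

Lemma Cexp_taylor_1 z : (Cmod z <= 1)%R -> (Cmod (Cexp z - 1 - z) <= 3 * (Cmod z * Cmod z))%R.
Proof.
intros H; generalize (Cexp_taylor z 1); rewrite Csum_Sn, Csum_O.
replace (Cexp z - (z ^ 0 / cfact 0 + z ^ 1 / cfact 1)) with (Cexp z - 1 - z)
  by (unfold cfact; simpl; field).
intros A; apply Rle_trans with (1 := A).
assert (exp (Cmod z) <= 3)%R
  by (apply Rle_trans with (2 := exp_le_3); now apply exp_le).
simpl; generalize (Cmod_ge_0 z) (exp_pos (Cmod z)); intros; nra.
Qed.

(** * The reciprocal Gamma function *)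

Definition inv_sq (n : nat) : R := / (INR (S n) * INR (S n)).

Lemma INR_S_pos n : (0 < INR (S n))%R.
Proof. apply lt_0_INR; lia. Qed.

Lemma inv_sq_pos n : (0 < inv_sq n)%R.
Proof. apply Rinv_0_lt_compat, Rmult_lt_0_compat; apply INR_S_pos. Qed.

Lemma inv_sq_series : ex_series inv_sq.
Proof.
assert (T : is_series (fun n => / INR (S n) - / INR (S (S n)))%R 1%R).
{ assert (E : forall n, sum_n (fun n => / INR (S n) - / INR (S (S n)))%R n
    = (1 - / INR (S (S n)))%R).
  { induction n as [|n IH]; [rewrite sum_O; simpl; field |].
    rewrite sum_Sn, IH; unfold plus; simpl; ring. }
  change (is_lim_seq (sum_n (fun n => / INR (S n) - / INR (S (S n)))%R) 1%R).
  apply (is_lim_seq_ext (fun n => 1 - / INR (S (S n)))%R); [intros; now rewrite E |].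
  replace (Finite 1) with (Finite (1 - 0)) by (f_equal; ring).
  apply is_lim_seq_minus'; [apply is_lim_seq_const |].
  apply (is_lim_seq_incr_1 (fun n => / INR (S n))%R 0), (is_lim_seq_incr_1 (fun n => / INR n)%R 0).
  replace (Finite 0) with (Rbar_inv p_infty) by reflexivity.
  apply is_lim_seq_inv; [apply is_lim_seq_INR | discriminate]. }
apply (ex_series_le (V := R_CompleteNormedModule) _
  (fun n => scal 2%R (/ INR (S n) - / INR (S (S n))))%R).
- intros n; change (Rabs (inv_sq n) <= 2 * (/ INR (S n) - / INR (S (S n))))%R.
  rewrite Rabs_pos_eq by (left; apply inv_sq_pos).
  unfold inv_sq; rewrite (S_INR (S n)).
  assert (H : (1 <= INR (S n))%R) by (rewrite S_INR; generalize (pos_INR n); lra).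
  revert H; generalize (INR (S n)); intros x H.
  replace (2 * (/ x - / (x + 1)))%R with (/ (x * x) * (2 * x / (x + 1)))%R by (field; lra).
  rewrite <- (Rmult_1_r (/ (x * x))) at 1.
  apply Rmult_le_compat_l; [left; apply Rinv_0_lt_compat; nra |].
  apply Rmult_le_reg_r with (x + 1)%R; [lra |].
  unfold Rdiv; rewrite Rmult_assoc, Rinv_l; lra.
- eexists; apply (is_series_scal (V := R_NormedModule)); exact T.
Qed.

(** Discrete Gronwall inequality.  Infinite products with factors
    [1 + O (1 / n^2)], their derivatives and their Taylor remainders all satisfy
    such a recurrence, hence are bounded. *)
Lemma gronwall_inv_sq (v : nat -> R) (K W : R) :
  (0 <= K)%R -> (0 <= W)%R -> (forall n, 0 <= v n)%R ->
  (forall n, v (S n) <= v n * (1 + K * inv_sq n) + K * inv_sq n * W)%R ->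
  forall n, (v n <= (v 0%nat + W) * exp (K * Series inv_sq))%R.
Proof.
intros HK HW Hv H.
assert (B : forall n, (v n + W <= (v 0%nat + W) * exp (K * Series inv_sq))%R);
  [| intros n; generalize (B n); lra].
intros [|n].
- rewrite <- (Rmult_1_r (v 0%nat + W)) at 1; apply Rmult_le_compat_l.
  + generalize (Hv 0%nat); lra.
  + rewrite <- exp_0; apply exp_le, Rmult_le_pos; [easy |].
    apply Rle_trans with (sum_n inv_sq 0%nat); [rewrite sum_O; left; apply inv_sq_pos |].
    apply (is_lim_seq_incr_compare (sum_n inv_sq)); [apply (Series_correct _ inv_sq_series) |].
    intros k; rewrite sum_Sn; unfold plus; simpl; generalize (inv_sq_pos (S k)); lra.
- apply Rle_trans with ((v 0%nat + W) * exp (K * sum_n inv_sq n))%R.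
  + induction n as [|n IH].
    * rewrite sum_O; generalize (H 0%nat) (exp_ineq1_le (K * inv_sq 0)) (Hv 0%nat); nra.
    * rewrite sum_Sn; unfold plus; simpl; rewrite Rmult_plus_distr_l, exp_plus.
      apply Rle_trans with ((v (S n) + W) * (1 + K * inv_sq (S n)))%R;
        [generalize (H (S n)); lra |].
      rewrite <- Rmult_assoc; apply Rmult_le_compat; trivial.
      -- generalize (Hv (S n)); lra.
      -- generalize (inv_sq_pos (S n)); nra.
      -- apply exp_ineq1_le.
  + apply Rmult_le_compat_l; [generalize (Hv 0%nat); lra |].
    apply exp_le, Rmult_le_compat_l; trivial.
    apply (is_lim_seq_incr_compare (sum_n inv_sq)); [apply (Series_correct _ inv_sq_series) |].
    intros k; rewrite sum_Sn; unfold plus; simpl; generalize (inv_sq_pos (S k)); lra.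
Qed.

Lemma tends_of_inv_sq (u : nat -> C) (K : R) :
  (forall n, (Cmod (u (S n) - u n) <= K * inv_sq n)%R) ->
  exists l, tends eventually u l.
Proof.
intros H.
assert (S1 : summable (fun n => u (S n) - u n)).
{ apply summable_le with (1 := H).
  apply (ex_series_scal (V := R_NormedModule) K), inv_sq_series. }
apply CSeries_is_series, Cis_series_tends in S1.
exists (CSeries (fun n => u (S n) - u n) + u 0%nat); apply tends_pred.
apply (tends_ext eventually (fun n => sum_n (fun n => u (S n) - u n) n + u 0%nat)).
- exists 0%nat; intros n _; induction n as [|n IH]; [rewrite Csum_O; ring |].
  rewrite Csum_Sn, <- IH; ring.
- apply (tends_plus eventually); [exact S1 | apply (tends_const eventually)].
Qed.

Definition rg_ln (n : nat) : R := (ln (INR (n + 2)) - ln (INR (n + 1)))%R.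
Definition rg_inv (n : nat) : R := (/ INR (n + 2))%R.

(** Euler's approximants of [1 / Gamma] are the partial products of
    [(1 + z / k) * (1 - 1 / k) ^ z = 1 + O (1 / k ^ 2)]; each factor comes with
    its derivative, so that derivatives converge along with values. *)
Definition rg_fac (n : nat) (z : C) : C := (1 + z * rg_inv n) * Cexp (- (z * rg_ln n)).
Definition rg_dfac (n : nat) (z : C) : C :=
  Cexp (- (z * rg_ln n)) * (rg_inv n - rg_ln n * (1 + z * rg_inv n)).

Fixpoint rg_prod (n : nat) (z : C) : C :=
  match n with
  | O => z * (z + 1)
  | S k => rg_prod k z * rg_fac k z
  end.

Fixpoint rg_dprod (n : nat) (z : C) : C :=
  match n with
  | O => 2 * z + 1
  | S k => rg_dprod k z * rg_fac k z + rg_prod k z * rg_dfac k z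
  end.

(** The product starts at [k = 2]: its first term [z (z + 1)] is Euler's
    approximant for [n = 1], which avoids [ln 0]. *)
Lemma rg_prod_euler n z :
  rg_prod n z = poch z (S (S n)) / cfact (S n) * Cexp (- (z * ln (INR (S n)))).
Proof.
induction n as [|n IH].
- simpl; rewrite ln_1; replace (- (z * 0)) with (RtoC 0) by ring; rewrite Cexp_0.
  unfold cfact; simpl; field.
- change (rg_prod n z * rg_fac n z = poch z (S (S n)) * (z + INR (S (S n))) / cfact (S (S n))
    * Cexp (- (z * ln (INR (S (S n)))))).
  rewrite IH; unfold rg_fac, rg_inv, rg_ln.
  replace (n + 2)%nat with (S (S n)) by lia; replace (n + 1)%nat with (S n) by lia.
  replace (- (z * ln (INR (S (S n))))) with
    (- (z * ln (INR (S n))) + - (z * (ln (INR (S (S n))) - ln (INR (S n)))%R))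
    by (rewrite RtoC_minus; ring).
  rewrite Cexp_plus, (cfact_S (S n)), RtoC_inv by (apply not_0_INR; lia).
  field; split; [apply cfact_neq_0 | apply RtoC_INR_S_neq_0].
Qed.

Lemma ln_le_sub x : (0 < x)%R -> (ln x <= x - 1)%R.
Proof.
intros H; generalize (exp_ineq1_le (ln x)); rewrite exp_ln by exact H; lra.
Qed.

Lemma rg_rates n :
  (0 < rg_inv n <= rg_ln n /\ rg_ln n <= / INR (S n) /\ rg_ln n <= 1 /\
   rg_ln n - rg_inv n <= inv_sq n /\ rg_ln n * rg_ln n <= inv_sq n /\
   rg_inv n * rg_ln n <= inv_sq n /\ rg_inv n <= 1)%R.
Proof.
unfold rg_inv, rg_ln, inv_sq.
replace (n + 2)%nat with (S (S n)) by lia; replace (n + 1)%nat with (S n) by lia.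
rewrite (S_INR (S n)).
assert (H : (1 <= INR (S n))%R) by (rewrite S_INR; generalize (pos_INR n); lra).
revert H; generalize (INR (S n)); intros x H.
assert (U : (ln (x + 1) - ln x <= / x)%R).
{ rewrite <- ln_div by lra; generalize (ln_le_sub ((x + 1) / x)).
  replace ((x + 1) / x - 1)%R with (/ x)%R by (field; lra); intros A; apply A.
  apply Rdiv_lt_0_compat; lra. }
assert (L : (/ (x + 1) <= ln (x + 1) - ln x)%R).
{ generalize (ln_le_sub (x / (x + 1))); rewrite ln_div by lra.
  replace (x / (x + 1) - 1)%R with (- / (x + 1))%R by (field; lra); intros A.
  assert (0 < x / (x + 1))%R by (apply Rdiv_lt_0_compat; lra); lra. }
revert U L; generalize (ln (x + 1) - ln x)%R; intros l U L.
assert (P : (0 < / (x + 1))%R) by (apply Rinv_0_lt_compat; lra).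
assert (X1 : (/ x <= 1)%R) by (rewrite <- Rinv_1; apply Rinv_le_contravar; lra).
assert (X2 : (/ (x + 1) <= / x)%R) by (apply Rinv_le_contravar; lra).
assert (E : (/ (x * x) = / x * / x)%R) by (field; lra).
assert (D : (/ x - / (x + 1) = / x * / (x + 1))%R) by (field; lra).
rewrite E; repeat split; try lra; nra.
Qed.

(** A bound on [|z| <= B] good for the factor, its derivative and its second-order
    remainder at once; the summands match the terms of the three estimates in
    [rg_fac_bounds]. *)
Definition rg_const (B : R) : R :=
  ((1 + B) * (exp B * (B * B)) + B + B * B + exp B * (1 + B)
   + exp B * ((2 + B) * 3 + 1))%R.

Lemma Cexp_taylor_quadratic w B :
  (Cmod w <= B)%R -> (Cmod (Cexp w - 1 - w) <= exp B * (Cmod w * Cmod w))%R.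
Proof.
intros H; generalize (Cexp_taylor w 1); rewrite Csum_Sn, Csum_O.
replace (Cexp w - (w ^ 0 / cfact 0 + w ^ 1 / cfact 1)) with (Cexp w - 1 - w)
  by (unfold cfact; simpl; field).
intros A; apply Rle_trans with (1 := A).
assert (exp (Cmod w) <= exp B)%R by now apply exp_le.
simpl; generalize (Cmod_ge_0 w) (exp_pos (Cmod w)); intros.
assert (0 <= Cmod w * Cmod w)%R by nra; nra.
Qed.

Lemma Cmod_RtoC_pos r : (0 <= r)%R -> Cmod r = r.
Proof. intros; now rewrite Cmod_R, Rabs_pos_eq. Qed.

Lemma rg_fac_bounds n z B :
  (1 <= B)%R -> (Cmod z <= B)%R ->
  (Cmod (rg_fac n z - 1) <= rg_const B * inv_sq n)%R /\
  (Cmod (rg_dfac n z) <= rg_const B * inv_sq n)%R /\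
  (forall h, (Cmod h <= 1)%R ->
    (Cmod (rg_fac n (z + h) - rg_fac n z - h * rg_dfac n z)
     <= rg_const B * inv_sq n * (Cmod h * Cmod h))%R).
Proof.
intros HB Hz.
destruct (rg_rates n) as [[I1 I2] [L1 [L2 [D [LL [IL I3]]]]]].
assert (L0 : (0 <= rg_ln n)%R) by lra.
assert (S0 := inv_sq_pos n).
assert (Z0 := Cmod_ge_0 z).
assert (EB := exp_pos B).
set (i := rg_inv n) in *; set (l := rg_ln n) in *; set (s := inv_sq n) in *.
assert (B1 : (Cmod (1 + z * i) <= 1 + B)%R).
{ triangle; rewrite Cmod_1, Cmod_mult, Cmod_RtoC_pos by lra.
  nra. }
assert (Ml : forall w, Cmod (- (w * l)) = (Cmod w * l)%R).
{ intros w; now rewrite Cmod_opp, Cmod_mult, Cmod_RtoC_pos by lra. }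
assert (Be : (Cmod (Cexp (- (z * l))) <= exp B)%R).
{ rewrite Cmod_Cexp; apply exp_le; apply Rle_trans with (Cmod (- (z * l))).
  - apply Rle_trans with (1 := Rle_abs _), re_le_Cmod.
  - rewrite Ml; nra. }
assert (Cpos : (0 <= B * B /\ 0 <= exp B * (B * B) /\ 0 <= exp B * B)%R).
{ repeat split; [nra | apply Rmult_le_pos; nra | nra]. }
assert (dil : Cmod (RtoC i - l) = (l - i)%R).
{ replace (RtoC i - l) with (- RtoC (l - i)) by (rewrite RtoC_minus; ring).
  now rewrite Cmod_opp, Cmod_RtoC_pos by lra. }
assert (dfac : (Cmod (i - l * (1 + z * i)) <= (1 + B) * s)%R).
{ replace (i - l * (1 + z * i)) with ((RtoC i - l) + - (z * RtoC (i * l)))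
    by (rewrite RtoC_mult; ring).
  triangle.
  rewrite dil, Cmod_opp, Cmod_mult, Cmod_RtoC_pos by nra; nra. }
unfold rg_const; split; [| split].
- unfold rg_fac; fold i l.
  replace ((1 + z * i) * Cexp (- (z * l)) - 1) with
    ((1 + z * i) * (Cexp (- (z * l)) - 1 - (- (z * l)))
     + (z * (RtoC i - l) + - (z * z * RtoC (i * l)))) by (rewrite RtoC_mult; ring).
  assert (T : (Cmod (Cexp (- (z * l)) - 1 - - (z * l)) <= exp B * (B * B) * s)%R).
  { apply Rle_trans with (1 := Cexp_taylor_quadratic (- (z * l)) B ltac:(rewrite Ml; nra)).
    rewrite Ml, (Rmult_assoc (exp B)); apply Rmult_le_compat_l; [lra |].
    replace (Cmod z * l * (Cmod z * l))%R with ((Cmod z * Cmod z) * (l * l))%R by ring.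
    apply Rmult_le_compat; nra. }
  apply Rle_trans with ((1 + B) * (exp B * (B * B) * s) + (B * s + B * B * s))%R.
  + triangle; apply Rplus_le_compat.
    * rewrite Cmod_mult; apply Rmult_le_compat; trivial; apply Cmod_ge_0.
    * triangle; apply Rplus_le_compat.
      -- rewrite Cmod_mult, dil; apply Rmult_le_compat; lra.
      -- rewrite Cmod_opp, !Cmod_mult, Cmod_RtoC_pos by nra.
         apply Rmult_le_compat; nra.
  + assert (0 <= exp B * (1 + B) * s)%R by (apply Rmult_le_pos; nra).
    assert (0 <= exp B * ((2 + B) * 3 + 1) * s)%R by (apply Rmult_le_pos; nra).
    lra.
- unfold rg_dfac; fold i l.
  apply Rle_trans with (exp B * ((1 + B) * s))%R.
  + rewrite Cmod_mult; apply Rmult_le_compat; trivial; apply Cmod_ge_0.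
  + assert (0 <= exp B * ((2 + B) * 3 + 1) * s)%R by (apply Rmult_le_pos; nra).
    assert (0 <= (1 + B) * (exp B * (B * B)) * s)%R
      by (apply Rmult_le_pos; [apply Rmult_le_pos |]; nra).
    nra.
- intros h Hh; assert (H0 := Cmod_ge_0 h).
  unfold rg_fac, rg_dfac; fold i l.
  replace (- ((z + h) * l)) with (- (z * l) + - (h * l)) by ring; rewrite Cexp_plus.
  set (eps := Cexp (- (h * l)) - 1 - (- (h * l))).
  replace (Cexp (- (h * l))) with (eps + 1 + (- (h * l))) by (unfold eps; ring).
  match goal with |- (Cmod ?x <= _)%R => replace x with
    (Cexp (- (z * l)) * (((1 + z * i) * eps + - (h * h * RtoC (i * l))) + h * i * eps))
    by (rewrite RtoC_mult; ring) end.
  set (q := (Cmod h * Cmod h)%R).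
  assert (Q0 : (0 <= q)%R) by (unfold q; nra).
  assert (T : (Cmod eps <= 3 * (s * q))%R).
  { unfold eps; apply Rle_trans with (1 := Cexp_taylor_1 (- (h * l)) ltac:(rewrite Ml; nra)).
    rewrite Ml; apply Rmult_le_compat_l; [lra |].
    replace (Cmod h * l * (Cmod h * l))%R with (l * l * q)%R by (unfold q; ring).
    apply Rmult_le_compat_r; lra. }
  assert (SQ : (0 <= s * q)%R) by nra.
  apply Rle_trans with (exp B * ((1 + B) * (3 * (s * q)) + s * q + 3 * (s * q)))%R.
  + rewrite Cmod_mult; apply Rmult_le_compat; trivial; try apply Cmod_ge_0.
    triangle; apply Rplus_le_compat.
    * triangle; apply Rplus_le_compat.
      -- rewrite Cmod_mult; apply Rmult_le_compat; trivial; apply Cmod_ge_0.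
      -- rewrite Cmod_opp, !Cmod_mult, Cmod_RtoC_pos by nra; fold q; nra.
    * rewrite !Cmod_mult, Cmod_RtoC_pos by lra.
      apply Rle_trans with (1 * Cmod eps)%R; [| lra].
      apply Rmult_le_compat_r; [apply Cmod_ge_0 | nra].
  + assert (0 <= ((1 + B) * (exp B * (B * B)) + B + B * B + exp B * (1 + B)) * (s * q))%R.
    { apply Rmult_le_pos; [| exact SQ].
      assert (0 <= (1 + B) * (exp B * (B * B)))%R by (apply Rmult_le_pos; nra); nra. }
    nra.
Qed.

Lemma rg_const_pos B : (1 <= B)%R -> (0 <= rg_const B)%R.
Proof.
intros H; unfold rg_const; generalize (exp_pos B); intros E.
assert (0 <= exp B * (B * B))%R by (apply Rmult_le_pos; nra).
assert (0 <= (1 + B) * (exp B * (B * B)))%R by (apply Rmult_le_pos; lra).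
assert (0 <= exp B * (1 + B))%R by nra.
assert (0 <= exp B * ((2 + B) * 3 + 1))%R by nra.
nra.
Qed.

Lemma rg_prod_bounded B : (1 <= B)%R ->
  exists M, (0 <= M)%R /\ forall n z, (Cmod z <= B)%R ->
    (Cmod (rg_prod n z) <= M)%R /\ (Cmod (rg_dprod n z) <= M)%R.
Proof.
intros HB; assert (K0 := rg_const_pos B HB).
set (X := exp (rg_const B * Series inv_sq)).
assert (X0 : (0 < X)%R) by apply exp_pos.
assert (F1 : forall n z, (Cmod z <= B)%R ->
  (Cmod (rg_fac n z) <= 1 + rg_const B * inv_sq n)%R).
{ intros n z Hz; replace (rg_fac n z) with (1 + (rg_fac n z - 1)) by ring.
  triangle; rewrite Cmod_1.
  generalize (proj1 (rg_fac_bounds n z B HB Hz)); lra. }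
set (M1 := (B * (B + 1) * X)%R).
assert (P1 : forall n z, (Cmod z <= B)%R -> (Cmod (rg_prod n z) <= M1)%R).
{ intros n z Hz.
  apply Rle_trans with ((Cmod (rg_prod 0 z) + 0) * X)%R.
  - apply (gronwall_inv_sq (fun n => Cmod (rg_prod n z))); trivial; [lra | intros; apply Cmod_ge_0 |].
    intros k; simpl; rewrite Cmod_mult, Rmult_0_r, Rplus_0_r.
    apply Rmult_le_compat_l; [apply Cmod_ge_0 | now apply F1].
  - unfold M1; apply Rmult_le_compat_r; [lra |]; rewrite Rplus_0_r; simpl.
    rewrite Cmod_mult; apply Rmult_le_compat; try apply Cmod_ge_0; trivial.
    triangle; rewrite Cmod_1; lra. }
assert (M1p : (0 <= M1)%R) by (unfold M1; apply Rmult_le_pos; nra).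
exists (M1 + (2 * B + 1 + M1) * X)%R; split; [nra |].
intros n z Hz; split; [generalize (P1 n z Hz); nra |].
apply Rle_trans with ((Cmod (rg_dprod 0 z) + M1) * X)%R.
- apply (gronwall_inv_sq (fun n => Cmod (rg_dprod n z))); trivial; [intros; apply Cmod_ge_0 |].
  intros k; simpl; triangle; rewrite !Cmod_mult.
  apply Rplus_le_compat.
  + apply Rmult_le_compat_l; [apply Cmod_ge_0 | now apply F1].
  + rewrite Rmult_comm; apply Rmult_le_compat; try apply Cmod_ge_0; [| now apply P1].
    now apply rg_fac_bounds.
- assert (Cmod (rg_dprod 0 z) <= 2 * B + 1)%R; [| nra].
  simpl; triangle.
  rewrite Cmod_1, Cmod_mult, Cmod_RtoC_pos by lra; lra.
Qed.

Lemma Cmod_bound_ge_1 z : exists B, (1 <= B)%R /\ (Cmod z <= B)%R.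
Proof. exists (1 + Cmod z)%R; generalize (Cmod_ge_0 z); lra. Qed.

Definition rGamma (z : C) : C := Flim eventually (fun n => rg_prod n z).
Definition drGamma (z : C) : C := Flim eventually (fun n => rg_dprod n z).

Lemma Flim_tends (u : nat -> C) : (exists l, tends eventually u l) ->
  tends eventually u (Flim eventually u).
Proof.
intros [l H]; rewrite (Flim_unique _ eventually _ u l); trivial.
now apply (tends_filterlim eventually).
Qed.

Lemma rGamma_lim z : tends eventually (fun n => rg_prod n z) (rGamma z).
Proof.
destruct (Cmod_bound_ge_1 z) as [B [HB Hz]].
destruct (rg_prod_bounded B HB) as [M [M0 HM]].
apply Flim_tends, (tends_of_inv_sq _ (M * rg_const B)); intros n; simpl.
replace (rg_prod n z * rg_fac n z - rg_prod n z) with (rg_prod n z * (rg_fac n z - 1)) by ring.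
rewrite Cmod_mult, Rmult_assoc; apply Rmult_le_compat; try apply Cmod_ge_0.
- now apply HM.
- now apply rg_fac_bounds.
Qed.

Lemma drGamma_lim z : tends eventually (fun n => rg_dprod n z) (drGamma z).
Proof.
destruct (Cmod_bound_ge_1 z) as [B [HB Hz]].
destruct (rg_prod_bounded B HB) as [M [M0 HM]].
apply Flim_tends, (tends_of_inv_sq _ (2 * (M * rg_const B))); intros n; simpl.
replace (rg_dprod n z * rg_fac n z + rg_prod n z * rg_dfac n z - rg_dprod n z) with
  (rg_dprod n z * (rg_fac n z - 1) + rg_prod n z * rg_dfac n z) by ring.
triangle.
rewrite !Cmod_mult.
destruct (HM n z Hz) as [A1 A2].
destruct (rg_fac_bounds n z B HB Hz) as [B1 [B2 _]].
assert (Cmod (rg_dprod n z) * Cmod (rg_fac n z - 1) <= M * (rg_const B * inv_sq n))%R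
  by (apply Rmult_le_compat; trivial; apply Cmod_ge_0).
assert (Cmod (rg_prod n z) * Cmod (rg_dfac n z) <= M * (rg_const B * inv_sq n))%R
  by (apply Rmult_le_compat; trivial; apply Cmod_ge_0).
lra.
Qed.

(** First-order Taylor formula for [1 / Gamma], locally uniform in the point: the
    quadratic remainder is controlled along the whole product.  It yields
    differentiability and the continuity of the derivative at once. *)
Lemma rGamma_taylor B : (1 <= B)%R ->
  exists K, (0 <= K)%R /\ forall z h, (Cmod z <= B)%R -> (Cmod h <= 1)%R ->
    (Cmod (rGamma (z + h) - rGamma z - h * drGamma z) <= K * (Cmod h * Cmod h))%R.
Proof.
intros HB; assert (HB1 : (1 <= B + 1)%R) by lra.
destruct (rg_prod_bounded (B + 1) HB1) as [M [M0 HM]].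
set (k := rg_const (B + 1)).
assert (k0 : (0 <= k)%R) by now apply rg_const_pos.
set (X := exp (k * Series inv_sq)).
exists ((1 + (M + 2 * M)) * X)%R; split; [generalize (exp_pos (k * Series inv_sq)); fold X; nra |].
intros z h Hz Hh.
set (q := (Cmod h * Cmod h)%R).
assert (H0 := Cmod_ge_0 h).
assert (Q0 : (0 <= q)%R) by (unfold q; nra).
apply (tends_le eventually
  (fun n => rg_prod n (z + h) - rg_prod n z - h * rg_dprod n z)).
{ apply (tends_minus eventually); [apply (tends_minus eventually) |];
    [apply rGamma_lim | apply rGamma_lim |].
  apply (tends_mult eventually); [apply (tends_const eventually) | apply drGamma_lim]. }
exists 0%nat; intros n _.
set (E := fun n => rg_prod n (z + h) - rg_prod n z - h * rg_dprod n z).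
change (Cmod (E n) <= (1 + (M + 2 * M)) * X * q)%R.
apply Rle_trans with ((Cmod (E 0%nat) + (M + 2 * M) * q) * X)%R.
- apply (gronwall_inv_sq (fun n => Cmod (E n))); trivial; [nra | intros; apply Cmod_ge_0 |].
  intros m.
  assert (Hz1 : (Cmod z <= B + 1)%R) by lra.
  assert (Hzh : (Cmod (z + h) <= B + 1)%R)
    by (triangle; lra).
  destruct (rg_fac_bounds m z _ HB1 Hz1) as [F1 [F2 F3]]; specialize (F3 h Hh).
  destruct (rg_fac_bounds m (z + h) _ HB1 Hzh) as [G1 _].
  destruct (HM m z Hz1) as [A1 A2]; fold k in F1, F2, F3, G1; fold q in F3.
  set (e := rg_fac m (z + h) - rg_fac m z - h * rg_dfac m z) in *.
  assert (S0 := inv_sq_pos m).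
  replace (E (S m)) with (E m * (1 + (rg_fac m (z + h) - 1)) + (rg_prod m z * e
    + (h * rg_dprod m z * e + h * h * rg_dprod m z * rg_dfac m z)))
    by (unfold E, e; simpl; ring).
  triangle; apply Rplus_le_compat.
  + rewrite Cmod_mult; apply Rmult_le_compat_l; [apply Cmod_ge_0 |].
    triangle; rewrite Cmod_1; lra.
  + replace (k * inv_sq m * ((M + 2 * M) * q))%R with
      (M * (k * inv_sq m * q) + (M * (k * inv_sq m * q) + M * (k * inv_sq m * q)))%R by ring.
    triangle; apply Rplus_le_compat.
    * rewrite Cmod_mult; apply Rmult_le_compat; trivial; apply Cmod_ge_0.
    * triangle; rewrite !Cmod_mult; apply Rplus_le_compat.
      -- apply Rmult_le_compat; trivial; try apply Cmod_ge_0; [| generalize (Cmod_ge_0 (rg_dprod m z)); nra].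
         apply Rmult_le_pos; apply Cmod_ge_0.
      -- fold q; replace (M * (k * inv_sq m * q))%R with (q * M * (k * inv_sq m))%R by ring.
         apply Rmult_le_compat; trivial; try apply Cmod_ge_0.
         ++ apply Rmult_le_pos; [nra | apply Cmod_ge_0].
         ++ apply Rmult_le_compat_l; trivial.
- replace (E 0%nat) with (h * h) by (unfold E; simpl; ring).
  rewrite Cmod_mult; fold q; right; ring.
Qed.

Lemma poch_S a n : poch a (S n) = poch a n * (a + INR n).
Proof. reflexivity. Qed.

Lemma poch_shift a n : poch a (S n) = a * poch (a + 1) n.
Proof.
induction n as [|n IH]; [simpl; ring |].
rewrite poch_S, IH, poch_S, S_INR, RtoC_plus; ring.
Qed.

Lemma poch_add a m n : poch a (m + n) = poch a n * poch (a + INR n) m.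
Proof.
induction m as [|m IH]; [simpl; ring |].
rewrite Nat.add_succ_l, !poch_S, IH, plus_INR, RtoC_plus; ring.
Qed.

Lemma regular_add a n : ~ nonpos_int a -> ~ nonpos_int (a + INR n).
Proof.
intros H [k Hk]; apply H; exists (n + k)%nat.
rewrite plus_INR, RtoC_plus; replace a with (a + INR n - INR n) by ring; rewrite Hk; ring.
Qed.

Lemma regular_neq_0 (a : C) : ~ nonpos_int a -> a <> 0.
Proof. intros H E; apply H; exists 0%nat; rewrite E; simpl; ring. Qed.

Lemma regular_add_neq_0 a n : ~ nonpos_int a -> a + INR n <> 0.
Proof. intros H; now apply regular_neq_0, regular_add. Qed.

Lemma poch_neq_0 a n : ~ nonpos_int a -> poch a n <> 0.
Proof.
intros H; induction n as [|n IH]; [apply C1_nz |].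
rewrite poch_S; apply Cmult_neq_0; [exact IH | now apply regular_add_neq_0].
Qed.

Lemma regular_pos_Re a : (0 < Re a)%R -> ~ nonpos_int a.
Proof.
intros H [n Hn]; rewrite Hn in H; simpl in H; generalize (pos_INR n); lra.
Qed.

Lemma tends_inv_INR : tends eventually (fun n => RtoC (/ INR (S n))) 0.
Proof.
apply tends_R, (is_lim_seq_incr_1 (fun n => / INR n)%R 0).
replace (Finite 0) with (Rbar_inv p_infty) by reflexivity.
apply is_lim_seq_inv; [apply is_lim_seq_INR | discriminate].
Qed.

Lemma rGamma_succ z : rGamma z = z * rGamma (z + 1).
Proof.
apply (tends_unique eventually (fun n => z * rg_prod n (z + 1)));
  [| apply (tends_mult eventually); [apply (tends_const eventually) | apply rGamma_lim]].
apply (tends_ext eventually (fun n => rg_prod n z * (1 + (z + 1) * RtoC (/ INR (S n))))).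
- exists 0%nat; intros n _; rewrite !rg_prod_euler.
  replace (- ((z + 1) * ln (INR (S n)))) with (- (z * ln (INR (S n))) + - RtoC (ln (INR (S n))))
    by ring.
  rewrite Cexp_plus, (Cexp_opp (RtoC _)).
  assert (E : Cexp (ln (INR (S n))) = RtoC (INR (S n))).
  { unfold Cexp; rewrite re_RtoC, im_RtoC, cos_0, sin_0, exp_ln by apply INR_S_pos.
    apply injective_projections; simpl; ring. }
  rewrite E, RtoC_inv by (apply not_0_INR; lia).
  assert (P : z * poch (z + 1) (S (S n)) = poch z (S (S n)) * (z + INR (S (S n))))
    by (now rewrite <- poch_shift).
  replace (z * (poch (z + 1) (S (S n)) / cfact (S n) * (Cexp (- (z * ln (INR (S n)))) * / INR (S n))))
    with (z * poch (z + 1) (S (S n)) / cfact (S n) * (Cexp (- (z * ln (INR (S n)))) * / INR (S n)))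
    by (unfold Cdiv; ring).
  rewrite P, (S_INR (S n)), RtoC_plus.
  field; split; [apply RtoC_INR_S_neq_0 | apply cfact_neq_0].
- replace (rGamma z) with (rGamma z * (1 + (z + 1) * 0)) by ring.
  apply (tends_mult eventually); [apply rGamma_lim |].
  apply (tends_plus eventually); [apply (tends_const eventually) |].
  apply (tends_mult eventually); [apply (tends_const eventually) | apply tends_inv_INR].
Qed.

Lemma rGamma_poch z n : rGamma z = poch z n * rGamma (z + INR n).
Proof.
induction n as [|n IH]; [simpl; replace (z + 0) with z by ring; ring |].
rewrite IH, (rGamma_succ (z + INR n)), poch_S, S_INR, RtoC_plus, Cplus_assoc; ring.
Qed.

(** Identifies derivatives through quadratic Taylor bounds, so that functional
    equations of [rGamma] can be differentiated. *)
Lemma taylor_derive_unique (f : C -> C) (z d d' : C) (K K' : R) :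
  (forall h, (Cmod h <= 1)%R -> (Cmod (f (z + h)%C - f z - h * d) <= K * (Cmod h * Cmod h))%R) ->
  (forall h, (Cmod h <= 1)%R -> (Cmod (f (z + h)%C - f z - h * d') <= K' * (Cmod h * Cmod h))%R) ->
  d = d'.
Proof.
intros H H'; apply Ceq_minus, Cmod_eq_0, Rle_antisym; [| apply Cmod_ge_0].
assert (B : forall r, (0 < r <= 1)%R -> (Cmod (d - d') <= (K + K') * r)%R).
{ intros r Hr.
  assert (Er : Cmod r = r) by (apply Cmod_RtoC_pos; lra).
  generalize (H r ltac:(lra)) (H' r ltac:(lra)); rewrite Er; intros A A'.
  apply Rmult_le_reg_l with r; [lra |].
  rewrite <- Er at 1; rewrite <- Cmod_mult.
  replace (r * (d - d')) with (- (f (z + r) - f z - r * d) + (f (z + r) - f z - r * d')) by ring.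
  triangle; rewrite Cmod_opp; lra. }
apply le_epsilon; intros eps He; rewrite Rplus_0_l.
set (Q := (Rabs (K + K') + 1)%R).
assert (Q1 : (1 <= Q)%R) by (unfold Q; generalize (Rabs_pos (K + K')); lra).
assert (Hq : (K + K' <= Q)%R) by (unfold Q; generalize (Rle_abs (K + K')); lra).
assert (R1 : (0 < Rmin 1 (eps / Q) <= 1)%R).
{ split; [apply Rmin_case; [lra | apply Rdiv_lt_0_compat; lra] | apply Rmin_l]. }
apply Rle_trans with (1 := B _ R1).
apply Rle_trans with (Q * (eps / Q))%R; [| right; field; lra].
apply Rle_trans with (Q * Rmin 1 (eps / Q))%R.
- apply Rmult_le_compat_r; lra.
- apply Rmult_le_compat_l; [lra | apply Rmin_r].
Qed.

Lemma rGamma_taylor_at z : exists K, (0 <= K)%R /\ forall h, (Cmod h <= 1)%R ->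
  (Cmod (rGamma (z + h) - rGamma z - h * drGamma z) <= K * (Cmod h * Cmod h))%R.
Proof.
destruct (Cmod_bound_ge_1 z) as [B [HB Hz]].
destruct (rGamma_taylor B HB) as [K [K0 HK]]; exists K; split; trivial.
intros h Hh; now apply HK.
Qed.

Lemma drGamma_succ z : drGamma z = rGamma (z + 1) + z * drGamma (z + 1).
Proof.
destruct (rGamma_taylor_at z) as [K [K0 HK]].
destruct (rGamma_taylor_at (z + 1)) as [K' [K0' HK']].
apply (taylor_derive_unique rGamma z _ _ K (Cmod z * K' + Cmod (drGamma (z + 1)) + K'));
  [exact HK |].
intros h Hh; rewrite (rGamma_succ (z + h)), (rGamma_succ z).
replace (z + h + 1) with (z + 1 + h) by ring.
specialize (HK' h Hh).
set (e := rGamma (z + 1 + h) - rGamma (z + 1) - h * drGamma (z + 1)) in *.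
replace ((z + h) * rGamma (z + 1 + h) - z * rGamma (z + 1)
  - h * (rGamma (z + 1) + z * drGamma (z + 1)))
  with (z * e + h * h * drGamma (z + 1) + h * e) by (unfold e; ring).
generalize (Cmod_ge_0 h) (Cmod_ge_0 z) (Cmod_ge_0 e); intros H0 Z0 E0.
set (q := (Cmod h * Cmod h)%R) in *.
assert (0 <= q)%R by (unfold q; nra).
triangle.
rewrite !Rmult_plus_distr_r; apply Rplus_le_compat.
- triangle.
  rewrite !Cmod_mult; fold q; apply Rplus_le_compat; [| right; ring].
  rewrite Rmult_assoc; now apply Rmult_le_compat_l.
- rewrite Cmod_mult; apply Rle_trans with (1 * Cmod e)%R; [| lra].
  now apply Rmult_le_compat_r.
Qed.

Lemma tends_locally_0 (f : C -> C) (z l : C) (K : R) :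
  (forall h, (Cmod h <= 1)%R -> (Cmod (f (z + h)%C - l) <= K * Cmod h)%R) ->
  tends (locally z) f l.
Proof.
intros H eps He.
assert (Id : tends (locally z) (fun w : C => w) z)
  by (apply (tends_filterlim (locally z)); intros P HP; exact HP).
set (Q := (Rabs K + 1)%R).
assert (Q1 : (1 <= Q)%R) by (unfold Q; generalize (Rabs_pos K); lra).
assert (Hq : (K <= Q)%R) by (unfold Q; generalize (Rle_abs K); lra).
assert (R1 : (0 < Rmin 1 (eps / Q))%R).
{ apply Rmin_case; [lra | apply Rdiv_lt_0_compat; lra]. }
generalize (Id _ R1); apply filter_imp; intros w Hw.
assert (W1 := Rlt_le_trans _ _ _ Hw (Rmin_l _ _)).
assert (W2 := Rlt_le_trans _ _ _ Hw (Rmin_r _ _)).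
replace w with (z + (w - z)) by ring.
apply Rle_lt_trans with (1 := H (w - z) ltac:(lra)).
apply Rle_lt_trans with (Q * Cmod (w - z))%R.
- apply Rmult_le_compat_r; [apply Cmod_ge_0 | lra].
- apply Rlt_le_trans with (Q * (eps / Q))%R; [apply Rmult_lt_compat_l; lra |].
  right; field; lra.
Qed.

Lemma rGamma_continuous (z : C) : tends (locally z) rGamma (rGamma z).
Proof.
destruct (rGamma_taylor_at z) as [K [K0 HK]].
apply (tends_locally_0 rGamma z _ (K + Cmod (drGamma z))).
intros h Hh.
replace (rGamma (z + h) - rGamma z) with
  ((rGamma (z + h) - rGamma z - h * drGamma z) + h * drGamma z) by ring.
triangle; rewrite Cmod_mult, Rmult_plus_distr_r.
apply Rplus_le_compat; [| lra].
apply Rle_trans with (1 := HK h Hh), Rmult_le_compat_l; trivial.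
generalize (Cmod_ge_0 h); nra.
Qed.

(** Exchanging the two end points in the uniform Taylor formula shows that the
    derivative is locally Lipschitz. *)
Lemma drGamma_continuous (z : C) : tends (locally z) drGamma (drGamma z).
Proof.
destruct (Cmod_bound_ge_1 z) as [B [HB Hz]].
destruct (rGamma_taylor (B + 1) ltac:(lra)) as [K [K0 HK]].
apply (tends_locally_0 drGamma z _ (2 * K)); intros h Hh.
destruct (Ceq_dec h 0) as [-> | Hn].
{ replace (z + 0) with z by ring; replace (drGamma z - drGamma z) with (RtoC 0) by ring.
  rewrite Cmod_0; lra. }
assert (Pn := proj1 (Cmod_gt_0 h) Hn).
apply Rmult_le_reg_l with (Cmod h); [easy |]; rewrite <- Cmod_mult.
assert (A1 := HK z h ltac:(lra) Hh).
assert (A2 := HK (z + h) (- h)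
  ltac:(triangle; lra) ltac:(now rewrite Cmod_opp)).
rewrite Cmod_opp in A2; replace (z + h + - h) with z in A2 by ring.
replace (h * (drGamma (z + h) - drGamma z)) with
  ((rGamma (z + h) - rGamma z - h * drGamma z)
   + (rGamma z - rGamma (z + h) - - h * drGamma (z + h))) by ring.
triangle; lra.
Qed.

Lemma Cinv_neq_0 (z : C) : z <> 0 -> / z <> 0.
Proof.
intros H E; apply C1_nz; rewrite <- (Cinv_r z H), E; ring.
Qed.

Lemma rg_prod_neq_0 n z : ~ nonpos_int z -> rg_prod n z <> 0.
Proof.
intros H; rewrite rg_prod_euler; apply Cmult_neq_0; [| apply Cexp_neq_0].
apply Cmult_neq_0; [now apply poch_neq_0 | apply Cinv_neq_0, cfact_neq_0].
Qed.

(** Apart from its explicit zeros the product stays away from [0], since the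
    inverse factors are [1 + O (1 / k ^ 2)] as well. *)
Lemma rGamma_neq_0 z : ~ nonpos_int z -> rGamma z <> 0.
Proof.
intros Hz.
destruct (Cmod_bound_ge_1 z) as [B [HB HzB]].
set (K := rg_const B); assert (K0 : (0 <= K)%R) by now apply rg_const_pos.
assert (HN : exists N, forall n, (K * inv_sq (N + n) <= / 2)%R).
{ assert (T : is_lim_seq (fun n => K * inv_sq n)%R 0).
  { replace (Finite 0) with (Rbar_mult K 0) by (simpl; f_equal; ring).
    apply is_lim_seq_scal_l, ex_series_lim_0, inv_sq_series. }
  apply is_lim_seq_spec in T; destruct (T (mkposreal (/ 2) ltac:(lra))) as [N HN].
  exists N; intros n; generalize (HN (N + n)%nat ltac:(lia)); simpl; rewrite Rminus_0_r.
  intros A; apply Rabs_def2 in A; lra. }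
destruct HN as [N HN].
set (v := fun n => Cmod (/ rg_prod (N + n) z)).
assert (vb : forall n, (v n <= (v 0%nat + 0) * exp (2 * K * Series inv_sq))%R).
{ apply gronwall_inv_sq; [lra | lra | intros; apply Cmod_ge_0 |].
  intros n; rewrite Rmult_0_r, Rplus_0_r; unfold v.
  rewrite Nat.add_succ_r; simpl.
  destruct (rg_fac_bounds (N + n) z B HB HzB) as [A _]; fold K in A.
  specialize (HN n).
  set (f := rg_fac (N + n) z) in *; set (x := (K * inv_sq (N + n))%R) in *.
  assert (Hx : (x <= K * inv_sq n)%R).
  { apply Rmult_le_compat_l; trivial; unfold inv_sq.
    assert (INR (S n) <= INR (S (N + n)))%R by (apply le_INR; lia).
    generalize (INR_S_pos n); intros; apply Rinv_le_contravar; nra. }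
  assert (F1 : (1 - x <= Cmod f)%R).
  { assert (Cmod 1 <= Cmod f + Cmod (f - 1))%R; [| rewrite Cmod_1 in *; lra].
    replace (RtoC 1) with (f + - (f - 1)) at 1 by ring.
    rewrite <- (Cmod_opp (f - 1)); apply Cmod_triangle. }
  assert (fn : f <> 0) by (apply Cmod_gt_0; lra).
  assert (pn := rg_prod_neq_0 (N + n) z Hz).
  replace (/ (rg_prod (N + n) z * f)) with (/ rg_prod (N + n) z * / f) by (field; now split).
  rewrite Cmod_mult; apply Rmult_le_compat_l; [apply Cmod_ge_0 |].
  rewrite Cmod_inv by exact fn.
  apply Rmult_le_reg_l with (Cmod f); [lra |]; rewrite Rinv_r by lra.
  assert (0 <= x)%R by (apply Rle_trans with (2 := A), Cmod_ge_0).
  assert ((1 - x) * (1 + 2 * x) <= Cmod f * (1 + 2 * x))%R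
    by (apply Rmult_le_compat_r; lra).
  assert (Cmod f * (1 + 2 * x) <= Cmod f * (1 + 2 * K * inv_sq n))%R
    by (apply Rmult_le_compat_l; lra).
  nra. }
rewrite Rplus_0_r in vb.
set (M := (v 0%nat * exp (2 * K * Series inv_sq))%R) in vb.
intros E; assert (L := rGamma_lim z); rewrite E in L.
assert (M0 : (0 < M)%R).
{ apply Rlt_le_trans with (v 0%nat); [| apply vb].
  apply Cmod_gt_0, Cinv_neq_0, rg_prod_neq_0, Hz. }
destruct (L (/ M)%R ltac:(now apply Rinv_0_lt_compat)) as [n0 Hn0].
specialize (Hn0 (N + n0)%nat ltac:(lia)); specialize (vb n0); unfold v in vb.
replace (rg_prod (N + n0) z - 0) with (rg_prod (N + n0) z) in Hn0 by ring.
assert (pn := rg_prod_neq_0 (N + n0) z Hz).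
rewrite Cmod_inv in vb by exact pn.
assert (pp := proj1 (Cmod_gt_0 _) pn).
apply (Rlt_irrefl (/ M)).
apply Rle_lt_trans with (2 := Hn0).
rewrite <- (Rinv_inv (Cmod (rg_prod (N + n0) z))).
apply Rinv_le_contravar; [now apply Rinv_0_lt_compat | exact vb].
Qed.

Lemma rGamma_eq_0 z : nonpos_int z -> rGamma z = 0.
Proof.
intros [n ->]; rewrite (rGamma_poch _ (S n)), poch_S.
replace (- INR n + INR n) with (RtoC 0) by ring; ring.
Qed.

Lemma Gamma_rGamma z : ~ nonpos_int z -> Gamma z = / rGamma z.
Proof.
intros H; unfold Gamma; apply (Flim_unique _ eventually _), (tends_filterlim eventually).
apply tends_pred, (tends_ext eventually (fun n => / rg_prod n z)).
- exists 0%nat; intros n _; rewrite rg_prod_euler, Cexp_opp.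
  assert (A := Cexp_neq_0 (z * ln (INR (S n)))); assert (B := poch_neq_0 z (S (S n)) H).
  assert (D := cfact_neq_0 (S n)).
  field; repeat split; trivial.
- apply (tends_inv eventually); [now apply rGamma_neq_0 | apply rGamma_lim].
Qed.

Lemma is_lim_of_tends (f : R -> C) (x : R) (l : C) :
  tends (locally' x) f l ->
  Lim (fun t => fst (f t)) x = fst l /\ Lim (fun t => snd (f t)) x = snd l.
Proof.
intros H; apply (tends_filterlim (locally' x)) in H.
assert (P : forall p : C -> R, (forall c, filterlim p (locally c) (locally (p c))) ->
  Lim (fun t => p (f t)) x = Finite (p l)).
{ intros p Hp; apply is_lim_unique; unfold is_lim, Rbar_locally'.
  apply (filterlim_comp _ _ _ f p _ _ _ H (Hp l)). }
split; rewrite P; trivial; intros c; [apply continuous_fst | apply continuous_snd].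
Qed.

(** Since [C_derive] is a limit along the horizontal direction only, the complex
    Taylor formula for [rGamma] is more than enough. *)
Lemma psi_rGamma z : ~ nonpos_int z -> psi z = - (drGamma z / rGamma z).
Proof.
intros H; assert (N := rGamma_neq_0 z H).
set (R0 := rGamma z) in *.
assert (D : C_derive Gamma z = - drGamma z / (R0 * R0)).
{ unfold C_derive, C_lim.
  set (g := fun x : R => (Gamma (x, snd z) - Gamma z) / ((x, snd z) - z)).
  assert (T : tends (locally' (fst z)) g (- drGamma z / (R0 * R0))).
  { assert (ID : tends (locally' (fst z)) (fun x => (x, snd z) - z) 0).
    { intros eps He; exists (mkposreal eps He); intros x Hx _.
      replace ((x, snd z) - z - 0) with (RtoC (x - fst z)%R).
      - rewrite Cmod_R; exact Hx.
      - destruct z; apply injective_projections; simpl; ring. }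
    assert (Sc : forall e : R, (0 < e)%R -> locally' (fst z)
      (fun x => (Cmod ((x, snd z) - z) < e)%R /\ (x, snd z) - z <> 0)).
    { intros e He; apply filter_and.
      - generalize (ID e He); apply filter_imp; intros x.
        now replace ((x, snd z) - z - 0) with ((x, snd z) - z) by ring.
      - exists (mkposreal 1 Rlt_0_1); intros x _ Hx E; apply Hx.
        apply (f_equal fst) in E; simpl in E; lra. }
    assert (LR : tends (locally' (fst z)) (fun x => rGamma (x, snd z)) R0).
    { destruct (rGamma_taylor_at z) as [K [K0 HK]].
      apply (tends_squeeze (locally' (fst z)) _
        (fun x => ((x, snd z) - z) * (K + Cmod (drGamma z))%R)).
      - generalize (Sc 1%R Rlt_0_1); apply filter_imp; intros x [Hx _].
        set (h := (x, snd z) - z) in *.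
        replace (x, snd z) with (z + h) by (unfold h; ring).
        replace (rGamma (z + h) - R0) with
          ((rGamma (z + h) - R0 - h * drGamma z) + h * drGamma z) by ring.
        triangle.
        assert (A := HK h ltac:(lra)); fold R0 in A.
        rewrite Cmod_mult, Cmod_mult, Cmod_RtoC_pos
          by (generalize (Cmod_ge_0 (drGamma z)); lra).
        generalize (Cmod_ge_0 h); intros; assert (Cmod h * Cmod h <= Cmod h)%R by nra; nra.
      - replace (RtoC 0) with (0 * (K + Cmod (drGamma z))%R) by ring.
        apply (tends_mult (locally' (fst z))); [exact ID | apply (tends_const (locally' (fst z)))]. }
    assert (LD : tends (locally' (fst z))
      (fun x => (rGamma (x, snd z) - R0) / ((x, snd z) - z)) (drGamma z)).
    { destruct (rGamma_taylor_at z) as [K [K0 HK]].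
      apply (tends_squeeze (locally' (fst z)) _ (fun x => ((x, snd z) - z) * RtoC K)).
      - generalize (Sc 1%R Rlt_0_1); apply filter_imp; intros x [Hx Hn].
        set (h := (x, snd z) - z) in *.
        replace (x, snd z) with (z + h) by (unfold h; ring).
        replace ((rGamma (z + h) - R0) / h - drGamma z) with
          ((rGamma (z + h) - R0 - h * drGamma z) / h) by (field; exact Hn).
        assert (P := proj1 (Cmod_gt_0 _) Hn).
        rewrite Cmod_div, Cmod_mult, Cmod_RtoC_pos by trivial.
        apply Rmult_le_reg_r with (Cmod h); trivial.
        unfold Rdiv; rewrite Rmult_assoc, Rinv_l, Rmult_1_r by lra.
        apply Rle_trans with (1 := HK h ltac:(lra)); right; ring.
      - replace (RtoC 0) with (0 * RtoC K) by ring.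
        apply (tends_mult (locally' (fst z))); [exact ID | apply (tends_const (locally' (fst z)))]. }
    apply (tends_ext (locally' (fst z))
      (fun x => - ((rGamma (x, snd z) - R0) / ((x, snd z) - z)) / (rGamma (x, snd z) * R0))).
    - generalize (filter_and _ _ (Sc 1%R Rlt_0_1) (LR _ (proj1 (Cmod_gt_0 _) N))).
      apply filter_imp; intros x [[_ Hn] Hx].
      assert (Nx : rGamma (x, snd z) <> 0).
      { intros E; rewrite E in Hx; replace (0 - R0) with (- R0) in Hx by ring.
        rewrite Cmod_opp in Hx; lra. }
      unfold g; rewrite !Gamma_rGamma; trivial.
      + fold R0; pose (w := (x, snd z) : C).
        change (- ((rGamma w - R0) / (w - z)) / (rGamma w * R0)
          = (/ rGamma w - / R0) / (w - z)).
        field; repeat split; trivial.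
      + intros P; apply Nx; now apply rGamma_eq_0.
    - apply (tends_div (locally' (fst z))); [now apply Cmult_neq_0 | |].
      + now apply (tends_opp (locally' (fst z))).
      + apply (tends_mult (locally' (fst z))); [exact LR | apply (tends_const (locally' (fst z)))]. }
  destruct (is_lim_of_tends g _ _ T) as [E1 E2]; unfold g in E1, E2.
  rewrite E1, E2; simpl; symmetry; apply surjective_pairing. }
unfold psi; rewrite D, Gamma_rGamma by exact H; fold R0; field; exact N.
Qed.

(** The [n]-th approximant is [z (z + 1) ... (z + n + 1) / (n + 1)! * (n + 1)^(- z)], whose
    logarithmic derivative is explicit. *)
Lemma rg_dprod_log n z : ~ nonpos_int z ->
  rg_dprod n z = rg_prod n z * (sum_n (fun k => / (z + INR k)) (S n) - ln (INR (S n))).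
Proof.
intros Hz; induction n as [|n IH].
- rewrite Csum_Sn, Csum_O; simpl; rewrite ln_1.
  assert (A := regular_add_neq_0 z 0 Hz); assert (B := regular_add_neq_0 z 1 Hz).
  simpl in A, B; field; repeat split; first [exact A | exact B | now apply regular_neq_0].
- rewrite Csum_Sn; simpl rg_dprod; simpl rg_prod; rewrite IH.
  unfold rg_fac, rg_dfac, rg_inv, rg_ln.
  replace (n + 2)%nat with (S (S n)) by lia; replace (n + 1)%nat with (S n) by lia.
  assert (A := regular_add_neq_0 z (S (S n)) Hz).
  rewrite RtoC_minus, RtoC_inv by (apply not_0_INR; lia).
  generalize (RtoC_INR_S_neq_0 (S n)); intros Bn.
  set (E := Cexp _); set (s := sum_n _ _).
  field; now split.
Qed.

(** [psi 1 - psi z]. *)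
Definition psi_shift (z : C) : C := drGamma z / rGamma z - drGamma 1 / rGamma 1.

(** The series [psi z - psi 1 = sum (1 / (1 + k) - 1 / (z + k))], read off the
    logarithmic derivative of Euler's approximants. *)
Lemma digamma_series z : ~ nonpos_int z ->
  Cis_series (fun k => / (z + INR k) - / (1 + INR k))
    (psi_shift z).
Proof.
intros Hz.
assert (H1 : ~ nonpos_int 1) by (apply regular_pos_Re; simpl; lra).
apply Cis_series_tends, tends_pred.
apply (tends_ext eventually
  (fun n => rg_dprod n z / rg_prod n z - rg_dprod n 1 / rg_prod n 1)).
- exists 0%nat; intros n _; rewrite !rg_dprod_log by trivial.
  assert (A := rg_prod_neq_0 n z Hz); assert (B := rg_prod_neq_0 n 1 H1).
  transitivity (sum_n (fun k => / (z + INR k)) (S n) - sum_n (fun k => / (1 + INR k)) (S n));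
    [field; now split |].
  generalize (S n); clear; intros n; induction n as [|n IH]; [now rewrite !Csum_O |].
  rewrite !Csum_Sn, <- IH; ring.
- apply (tends_minus eventually); apply (tends_div eventually);
    first [now apply rGamma_neq_0 | apply drGamma_lim | apply rGamma_lim].
Qed.

(** The coefficients of [2F1 (a, b; a + b; x)] are quotients of Euler's
    approximants: the powers of [n] cancel up to a factor [1 / n]. *)
Lemma gauss_coeff_asymptotics a b :
  ~ nonpos_int a -> ~ nonpos_int b -> ~ nonpos_int (a + b) ->
  tends eventually (fun n => INR n * gauss_coeff a b (a + b) n)
    (rGamma a * rGamma b / rGamma (a + b)).
Proof.
intros Ha Hb Hc; apply tends_pred, tends_pred.
apply (tends_ext eventually (fun n => rg_prod n a * rg_prod n b / rg_prod n (a + b))).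
- exists 0%nat; intros n _; rewrite !rg_prod_euler; unfold gauss_coeff.
  replace (- ((a + b) * ln (INR (S n)))) with
    (- (a * ln (INR (S n))) + - (b * ln (INR (S n)))) by ring.
  rewrite Cexp_plus, (cfact_S (S n)).
  field; repeat split; try apply Cexp_neq_0; try apply cfact_neq_0;
    try apply RtoC_INR_S_neq_0; now apply poch_neq_0.
- apply (tends_div eventually); [now apply rGamma_neq_0 | | apply rGamma_lim].
  apply (tends_mult eventually); apply rGamma_lim.
Qed.

(** * Analytic functions on the cut plane *)

Lemma Cpseries (u : nat -> C) (h l : C) :
  is_pseries (V := C_NormedModule) u h l <-> Cis_series (fun k => u k * h ^ k) l.
Proof.
assert (E : forall k, scal (V := C_NormedModule) (pow_n (K := C_AbsRing) h k) (u k) = u k * h ^ k).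
{ intros k; exact (Cmult_comm (h ^ k) (u k)). }
unfold is_pseries; split; apply is_series_ext; intros k; [apply E | symmetry; apply E].
Qed.

Lemma is_series_geom_scal (M q : R) (k : nat) : (0 <= q < 1)%R ->
  is_series (fun i => M * q ^ (k + i))%R (M * q ^ k * / (1 - q))%R.
Proof.
intros H; apply is_series_ext with (fun i => scal (M * q ^ k)%R (q ^ i)%R).
- intros i; rewrite pow_add; unfold scal; simpl; unfold mult; simpl; ring.
- apply (is_series_scal (V := R_NormedModule)), is_series_geom.
  rewrite Rabs_pos_eq; lra.
Qed.

Lemma Cis_series_drop (a : nat -> C) (k : nat) (l : C) :
  (forall j, (j < k)%nat -> a j = 0) -> Cis_series a l -> Cis_series (fun i => a (k + i)%nat) l.
Proof.
revert a; induction k as [|k IH]; intros a H Ha; [exact Ha |].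
apply (IH (fun i => a (S i))).
- intros j Hj; apply H; lia.
- replace l with (l - a 0%nat) by (rewrite (H 0%nat) by lia; ring).
  now apply Cis_series_pred.
Qed.

Lemma pseries_coeff_bound (u : nat -> C) (l : C) (r : R) : (0 <= r)%R ->
  Cis_series (fun k => u k * r ^ k) l ->
  exists M, (0 <= M)%R /\ forall k, (Cmod (u k) * r ^ k <= M)%R.
Proof.
intros Hr H.
assert (T : tends eventually (fun k => u k * r ^ k) 0).
{ apply tends_pred; apply Cis_series_tends in H.
  apply (tends_ext eventually (fun n => sum_n (fun k => u k * r ^ k) (S n)
    - sum_n (fun k => u k * r ^ k) n)).
  - exists 0%nat; intros n _; rewrite Csum_Sn; ring.
  - replace (RtoC 0) with (l - l) by ring.
    apply (tends_minus eventually); [now apply tends_succ | exact H]. }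
destruct (T 1%R Rlt_0_1) as [N HN].
assert (E : forall k, Cmod (u k * r ^ k) = (Cmod (u k) * r ^ k)%R).
{ intros k; now rewrite Cmod_mult, Cmod_pow, Cmod_RtoC_pos. }
apply (bounded_of_tail (fun k => Cmod (u k) * r ^ k)%R N 1); intros k Hk.
generalize (HN k Hk); replace (u k * r ^ k - 0) with (u k * r ^ k) by ring; rewrite E; lra.
Qed.

(** The zeros of a nonzero power series do not accumulate at its centre. *)
Lemma pseries_zero (u : nat -> C) (f : C -> C) (v : C) (r delta : R) :
  (0 < r)%R -> (0 < delta)%R -> v <> 0 ->
  (forall h, (Cmod h < r)%R -> Cis_series (fun k => u k * h ^ k) (f h)) ->
  (forall s : R, (0 < s < delta)%R -> f (s * v) = 0) ->
  forall k, u k = 0.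
Proof.
intros Hr Hd Hv Hf H0.
assert (Pv := proj1 (Cmod_gt_0 v) Hv).
set (r' := (r / 2)%R).
assert (Hr' : (0 < r' < r)%R) by (unfold r'; lra).
assert (Cr : Cmod r' = r') by (apply Cmod_RtoC_pos; lra).
destruct (pseries_coeff_bound u _ r' ltac:(lra) (Hf r' ltac:(rewrite Cr; lra))) as [M [M0 HM]].
intros k; induction k as [k IH] using lt_wf_ind.
assert (B : forall eta, (0 < eta)%R -> (eta < Cmod v * delta)%R -> (eta <= r' / 2)%R ->
  (Cmod (u k) * r' ^ S k <= 2 * M * eta)%R).
{ intros eta He1 He2 He3.
  set (s := (eta / Cmod v)%R).
  assert (Hs : (0 < s < delta)%R).
  { unfold s; split; [now apply Rdiv_lt_0_compat |].
    apply Rmult_lt_reg_r with (Cmod v); [easy |].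
    unfold Rdiv; rewrite Rmult_assoc, Rinv_l; lra. }
  set (h := RtoC s * v).
  assert (Eh : Cmod h = eta).
  { unfold h; rewrite Cmod_mult, Cmod_RtoC_pos by lra; unfold s; field; lra. }
  assert (Sh := Hf h ltac:(rewrite Eh; lra)); unfold h in Sh at 2; rewrite (H0 s Hs) in Sh.
  assert (S1 : Cis_series (fun i => u (k + i)%nat * h ^ (k + i)) (RtoC 0)).
  { apply (Cis_series_drop (fun j => u j * h ^ j) k); [| exact Sh].
    intros j Hj; rewrite (IH j Hj); ring. }
  apply Cis_series_pred in S1; rewrite Nat.add_0_r in S1.
  set (q := (eta / r')%R).
  assert (Hq : (0 <= q <= / 2)%R).
  { unfold q; split; [apply Rlt_le, Rdiv_lt_0_compat; lra |].
    apply Rmult_le_reg_r with r'; [lra |]; unfold Rdiv; rewrite Rmult_assoc, Rinv_l; lra. }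
  assert (A : (Cmod (0 - u k * h ^ k) <= M * q ^ S k * / (1 - q))%R).
  { apply (Cmod_series_le _ (fun i => M * q ^ (S k + i))%R _ _) with (2 := S1);
      [| apply is_series_geom_scal; lra].
    intros i; rewrite Nat.add_succ_r, <- Nat.add_succ_l, Cmod_mult, Cmod_pow, Eh.
    replace (eta ^ (S k + i))%R with (r' ^ (S k + i) * q ^ (S k + i))%R
      by (rewrite <- Rpow_mult_distr; f_equal; unfold q; field; lra).
    rewrite <- Rmult_assoc; apply Rmult_le_compat_r; [apply pow_le; lra | apply HM]. }
  replace (0 - u k * h ^ k) with (- (u k * h ^ k)) in A by ring.
  rewrite Cmod_opp, Cmod_mult, Cmod_pow, Eh in A.
  assert (Ek : (eta ^ k = r' ^ k * q ^ k)%R)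
    by (rewrite <- Rpow_mult_distr; f_equal; unfold q; field; lra).
  rewrite Ek in A.
  assert (q0 : (0 < q)%R) by (unfold q; apply Rdiv_lt_0_compat; lra).
  assert (Hk : (0 < q ^ k)%R) by now apply pow_lt.
  assert (I2 : (/ (1 - q) <= 2)%R).
  { rewrite <- (Rinv_inv 2); apply Rinv_le_contravar; lra. }
  assert (A2 : (Cmod (u k) * r' ^ k * q ^ k <= 2 * M * q * q ^ k)%R).
  { rewrite Rmult_assoc; apply Rle_trans with (1 := A); simpl.
    replace (2 * M * q * q ^ k)%R with (M * (q * q ^ k) * 2)%R by ring.
    apply Rmult_le_compat_l; [| exact I2].
    apply Rmult_le_pos; nra. }
  apply Rmult_le_reg_r in A2; [| exact Hk].
  simpl; replace (Cmod (u k) * (r' * r' ^ k))%R with (Cmod (u k) * r' ^ k * r')%R by ring.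
  replace (2 * M * eta)%R with (2 * M * q * r')%R by (unfold q; field; lra).
  apply Rmult_le_compat_r; lra. }
apply Cmod_eq_0, Rle_antisym; [| apply Cmod_ge_0].
assert (P : (0 < r' ^ S k)%R) by (apply pow_lt; lra).
apply Rmult_le_reg_r with (r' ^ S k)%R; trivial; rewrite Rmult_0_l.
apply le_epsilon; intros eps He; rewrite Rplus_0_l.
set (eta := Rmin (Rmin (Cmod v * delta / 2) (r' / 2)) (eps / (2 * M + 1))).
assert (X1 : (0 < Cmod v * delta)%R) by nra.
assert (X2 : (0 < eps / (2 * M + 1))%R) by (apply Rdiv_lt_0_compat; lra).
assert (Y1 := Rmin_l (Rmin (Cmod v * delta / 2) (r' / 2)) (eps / (2 * M + 1))).
assert (Y2 := Rmin_r (Rmin (Cmod v * delta / 2) (r' / 2)) (eps / (2 * M + 1))).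
assert (Y3 := Rmin_l (Cmod v * delta / 2) (r' / 2)).
assert (Y4 := Rmin_r (Cmod v * delta / 2) (r' / 2)).
assert (Y5 : (0 < eta)%R) by (unfold eta; repeat apply Rmin_case; lra).
fold eta in Y1, Y2.
apply Rle_trans with (1 := B eta Y5 ltac:(lra) ltac:(lra)).
apply Rle_trans with ((2 * M + 1) * (eps / (2 * M + 1)))%R; [| right; field; lra].
apply Rle_trans with ((2 * M + 1) * eta)%R; [nra | apply Rmult_le_compat_l; lra].
Qed.

Lemma analytic_plus (f g : C -> C) z :
  analytic_at f z -> analytic_at g z -> analytic_at (fun x => f x + g x) z.
Proof.
intros [u [r [Hr Hu]]] [v [s [Hs Hv]]].
exists (fun k => u k + v k), (Rmin r s); split; [now apply Rmin_case |].
intros x Hx.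
apply (is_pseries_plus (V := C_NormedModule)); [apply Hu | apply Hv];
  apply Rlt_le_trans with (1 := Hx); [apply Rmin_l | apply Rmin_r].
Qed.

(** Coefficients of the product of a power series with [al + be h]. *)
Definition PS_affine (al be : C) (u : nat -> C) (k : nat) : C :=
  al * u k + be * match k with O => 0 | S j => u j end.

Lemma pseries_affine (al be : C) (u : nat -> C) (h l : C) :
  Cis_series (fun k => u k * h ^ k) l ->
  Cis_series (fun k => PS_affine al be u k * h ^ k) ((al + be * h) * l).
Proof.
intros H.
replace ((al + be * h) * l) with (al * l + be * (0 + h * l)) by ring.
apply Cis_series_ext with (fun k => al * (u k * h ^ k)
  + be * (match k with O => 0 | S j => u j end * h ^ k)).
- intros k; unfold PS_affine; ring.
- apply Cis_series_plus; apply Cis_series_scal; trivial.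
  set (w := fun k => match k with O => 0 | S j => u j end * h ^ k).
  replace (RtoC 0) with (w 0%nat) by (unfold w; simpl; ring).
  apply (Cis_series_succ w), Cis_series_ext with (fun k => h * (u k * h ^ k)).
  + intros k; unfold w; simpl; ring.
  + now apply Cis_series_scal.
Qed.

Lemma analytic_affine (al be : C) (f : C -> C) z :
  analytic_at f z -> analytic_at (fun x => (al + be * x) * f x) z.
Proof.
intros [u [r [Hr Hu]]].
exists (PS_affine (al + be * z) be u), r; split; trivial.
intros x Hx; apply Cpseries.
replace (al + be * x) with (al + be * z + be * (x - z)) by ring.
exact (pseries_affine _ _ _ _ _ (proj1 (Cpseries _ _ _) (Hu x Hx))).
Qed.

Lemma cut_star x (s : R) : ~ in_cut x -> (0 <= s <= 1)%R -> ~ in_cut (s * x).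
Proof.
intros H Hs [A B]; apply H; destruct x as [x1 x2]; unfold in_cut in *; simpl in *.
assert (s <> 0)%R by (intros E; subst s; lra).
assert (s * x2 = 0)%R by lra.
assert (x2 = 0)%R by (apply Rmult_integral in H1; tauto).
split; [nra | easy].
Qed.

(** The cut plane is star-shaped about [0], so identities between analytic
    functions propagate from the unit disc along rays. *)
Lemma identity_theorem (f g : C -> C) :
  (forall x, ~ in_cut x -> analytic_at f x) -> (forall x, ~ in_cut x -> analytic_at g x) ->
  (forall x, (Cmod x < 1)%R -> f x = g x) ->
  forall x, ~ in_cut x -> f x = g x.
Proof.
intros Hf Hg Hfg x Hx.
set (d := fun z => f z + (-1 + 0 * z) * g z).
assert (Hd : forall z, ~ in_cut z -> analytic_at d z).
{ intros z Hz; apply analytic_plus; [now apply Hf | now apply analytic_affine, Hg]. }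
assert (Hd0 : forall z, (Cmod z < 1)%R -> d z = 0).
{ intros z Hz; unfold d; rewrite (Hfg z Hz); ring. }
cut (d x = 0).
{ intros E; unfold d in E; apply Ceq_minus; rewrite <- E; ring. }
destruct (Ceq_dec x 0) as [-> | Hn]; [apply Hd0; rewrite Cmod_0; lra |].
assert (Px := proj1 (Cmod_gt_0 x) Hn).
set (E := fun t : R => (0 <= t <= 1)%R /\ forall s, (0 <= s <= t)%R -> d (s * x) = 0).
set (t0 := Rmin 1 (/ (2 * Cmod x))).
assert (Ht0 : (0 < t0 <= 1)%R).
{ unfold t0; split; [apply Rmin_case; [lra | apply Rinv_0_lt_compat; lra] | apply Rmin_l]. }
assert (E0 : E t0).
{ split; [lra |]; intros s Hs; apply Hd0; rewrite Cmod_mult, Cmod_RtoC_pos by lra.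
  assert (t0 <= / (2 * Cmod x))%R by apply Rmin_r.
  apply Rle_lt_trans with (/ (2 * Cmod x) * Cmod x)%R.
  - apply Rmult_le_compat_r; lra.
  - rewrite Rinv_mult; field_simplify; lra. }
(* If [d] vanishes on the ray up to [tau], it vanishes near [tau * x], so [tau] was not
   the supremum unless [tau = 1]. *)
destruct (completeness E) as [tau [U L]].
{ exists 1%R; intros t [Ht _]; lra. }
{ now exists t0. }
assert (T0 : (t0 <= tau)%R) by now apply U.
assert (T1 : (tau <= 1)%R) by (apply L; intros t [Ht _]; lra).
assert (Below : forall s, (0 <= s < tau)%R -> d (s * x) = 0).
{ intros s Hs; apply NNPP; intros C0.
  assert (tau <= s)%R; [| lra].
  apply L; intros t [Ht HE]; apply Rnot_lt_le; intros Hst; apply C0, HE; lra. }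
assert (Hc : ~ in_cut (tau * x)) by (apply cut_star; [exact Hx | lra]).
destruct (Hd _ Hc) as [u [r [Hr Hu]]].
assert (Z : forall k, u k = 0).
{ apply (pseries_zero u (fun h => d (tau * x + h)) (- x) r tau); trivial; [lra | | |].
  - intros A; apply Hn; replace x with (- - x) by ring; rewrite A; ring.
  - intros h Hh; apply (proj1 (Cpseries u h (d (tau * x + h)))).
    replace h with (tau * x + h - tau * x) at 1 by ring.
    apply Hu; now replace (tau * x + h - tau * x) with h by ring.
  - intros s Hs; replace (tau * x + s * - x) with (RtoC (tau - s) * x)
      by (rewrite RtoC_minus; ring).
    apply Below; lra. }
assert (Disc : forall z, (Cmod (z - tau * x) < r)%R -> d z = 0).
{ intros z Hz; generalize (Hu z Hz); intros A; apply Cpseries, CSeries_unique in A.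
  rewrite <- A; apply CSeries_unique, Cis_series_tends.
  apply (tends_ext eventually (fun _ => 0)); [| apply (tends_const eventually)].
  exists 0%nat; intros n _; induction n as [|n IH]; [rewrite Csum_O, Z; ring |].
  rewrite Csum_Sn, <- IH, Z; ring. }
set (e := (r / (2 * Cmod x))%R).
assert (He : (0 < e)%R) by (apply Rdiv_lt_0_compat; lra).
assert (Near : forall s : R, (tau <= s <= tau + e)%R -> d (s * x) = 0).
{ intros s Hs; apply Disc.
  replace (s * x - tau * x) with (RtoC (s - tau) * x) by (rewrite RtoC_minus; ring).
  rewrite Cmod_mult, Cmod_RtoC_pos by lra.
  apply Rle_lt_trans with (e * Cmod x)%R; [apply Rmult_le_compat_r; lra |].
  unfold e; replace (r / (2 * Cmod x) * Cmod x)%R with (r / 2)%R by (field; lra); lra. }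
assert (All : forall s : R, (0 <= s <= tau + e)%R -> d (s * x) = 0).
{ intros s Hs; destruct (Rlt_le_dec s tau); [apply Below | apply Near]; lra. }
replace x with (1 * x) by ring; apply All; split; [lra |].
apply Rnot_lt_le; intros C0.
assert (E (tau + e)%R) by (split; [lra | exact All]).
generalize (U _ H); lra.
Qed.

Lemma is_principal_unique a b c (G1 G2 : C -> C) :
  is_principal_2F1 a b c G1 -> is_principal_2F1 a b c G2 ->
  forall x, ~ in_cut x -> G1 x = G2 x.
Proof.
intros [A1 P1] [A2 P2]; apply identity_theorem; trivial.
intros x Hx.
rewrite <- (CSeries_unique _ _ (proj1 (Cpseries _ _ _) (P1 x Hx))).
apply (CSeries_unique _ _ (proj1 (Cpseries _ _ _) (P2 x Hx))).
Qed.

Lemma hyp2F1_principal a b c (G : C -> C) :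
  is_principal_2F1 a b c G -> is_principal_2F1 a b c (hyp2F1 a b c).
Proof. intros H; unfold hyp2F1; apply epsilon_spec; now exists G. Qed.

(** * Stieltjes transforms *)

(** The [k]-th Taylor coefficient at [x] of the transform of [(1 - t)^j]. *)
Definition stieltjes_coeff (j k : nat) (x : C) : C :=
  RInt (V := C_R_CompleteNormedModule)
    (fun t => RtoC (1 - t) ^ j * RtoC t ^ k / (1 - x * RtoC t) ^ S k) 0 1.

Definition stieltjes (j : nat) (x : C) : C :=
  RInt (V := C_R_CompleteNormedModule) (fun t => RtoC (1 - t) ^ j / (1 - x * RtoC t)) 0 1.

Lemma cut_neq_0 x (t : R) : ~ in_cut x -> (0 <= t <= 1)%R -> 1 - x * t <> 0.
Proof.
intros Hx Ht E; apply (cut_star x t Hx Ht).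
replace (t * x) with (RtoC 1) by (replace (RtoC 1) with (1 - x * t + x * t) by ring; rewrite E; ring).
unfold in_cut; simpl; lra.
Qed.

Lemma Ccont_one_minus (x : C) t : Ccont (fun s => 1 - x * RtoC s) t.
Proof.
apply (Ccont_minus (fun _ => RtoC 1)); [apply Ccont_const |].
apply Ccont_mult; [apply Ccont_const | apply Ccont_id].
Qed.

Lemma Ccont_bern (j : nat) t : Ccont (fun s => RtoC (1 - s) ^ j) t.
Proof.
apply Ccont_pow, Ccont_RtoC.
apply (continuous_minus (V := R_NormedModule) (fun _ => 1%R)).
- apply continuous_const.
- apply continuous_id.
Qed.

Lemma unit_interval t : (Rmin 0 1 <= t <= Rmax 0 1)%R -> (0 <= t <= 1)%R.
Proof. rewrite Rmin_left, Rmax_right; lra. Qed.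

Lemma C_RInt_correct (f : R -> C) :
  (forall t, (0 <= t <= 1)%R -> Ccont f t) ->
  C_is_RInt f 0 1 (RInt (V := C_R_CompleteNormedModule) f 0 1).
Proof.
intros H; apply (RInt_correct (V := C_R_CompleteNormedModule)), C_ex_RInt.
intros t Ht; now apply H, unit_interval.
Qed.

Lemma stieltjes_correct j x : ~ in_cut x ->
  C_is_RInt (fun t => RtoC (1 - t) ^ j / (1 - x * RtoC t)) 0 1 (stieltjes j x).
Proof.
intros Hx; apply C_RInt_correct; intros t Ht.
apply Ccont_div; [now apply cut_neq_0 | apply Ccont_bern | apply Ccont_one_minus].
Qed.

Lemma stieltjes_coeff_correct j k x : ~ in_cut x ->
  C_is_RInt (fun t => RtoC (1 - t) ^ j * RtoC t ^ k / (1 - x * RtoC t) ^ S k) 0 1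
    (stieltjes_coeff j k x).
Proof.
intros Hx; apply C_RInt_correct; intros t Ht.
apply Ccont_div; [now apply Cpow_nz, cut_neq_0 | | apply Ccont_pow, Ccont_one_minus].
apply Ccont_mult; [apply Ccont_bern | apply Ccont_pow, Ccont_id].
Qed.

Lemma cut_distance x : ~ in_cut x ->
  exists d, (0 < d)%R /\ forall t, (0 <= t <= 1)%R -> (d <= Cmod (1 - x * t))%R.
Proof.
intros Hx.
destruct (continuity_ab_min (fun t => Cmod (1 - x * RtoC t)) 0 1 ltac:(lra)) as [m [Hm Im]].
- intros t Ht; apply continuity_pt_filterlim.
  intros P [eps HP]; unfold filtermap; generalize (Ccont_one_minus x t eps (cond_pos eps)).
  apply filter_imp; intros s Hs; apply HP.
  assert (T : forall v w, (Cmod v <= Cmod w + Cmod (v - w))%R).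
  { intros v w; replace v with (w + (v - w)) at 1 by ring; apply Cmod_triangle. }
  assert (A := T (1 - x * RtoC s) (1 - x * RtoC t)).
  assert (B := T (1 - x * RtoC t) (1 - x * RtoC s)).
  replace (1 - x * RtoC t - (1 - x * RtoC s)) with (- (1 - x * RtoC s - (1 - x * RtoC t))) in B
    by ring.
  rewrite Cmod_opp in B.
  apply Rabs_def1; unfold minus, plus, opp; simpl; lra.
- exists (Cmod (1 - x * RtoC m)); split; [now apply Cmod_gt_0, cut_neq_0 | exact Hm].
Qed.

Lemma Cmod_bern j t : (0 <= t <= 1)%R -> (Cmod (RtoC (1 - t) ^ j) <= 1)%R.
Proof.
intros Ht; rewrite Cmod_pow, Cmod_RtoC_pos by lra.
apply Rle_trans with (1 ^ j)%R; [apply pow_incr; lra | rewrite pow1; lra].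
Qed.

Lemma Cmod_unit_pow k t : (0 <= t <= 1)%R -> (Cmod (RtoC t ^ k) <= 1)%R.
Proof.
intros Ht; rewrite Cmod_pow, Cmod_RtoC_pos by lra.
apply Rle_trans with (1 ^ k)%R; [apply pow_incr; lra | rewrite pow1; lra].
Qed.

Section Expansion.

Variables (x : C) (d : R).
Hypotheses (Hx : ~ in_cut x) (Hd : (0 < d)%R)
  (Dist : forall t, (0 <= t <= 1)%R -> (d <= Cmod (1 - x * t))%R).

Lemma stieltjes_coeff_bound j k : (Cmod (stieltjes_coeff j k x) <= (/ d) ^ S k)%R.
Proof.
apply (C_RInt_le_const _ _ _) with (2 := stieltjes_coeff_correct j k x Hx).
intros t Ht; assert (N := cut_neq_0 x t Hx Ht).
rewrite Cmod_div by now apply Cpow_nz.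
rewrite Cmod_mult, Cmod_pow with (n := S k).
replace ((/ d) ^ S k)%R with (1 * 1 * (/ d) ^ S k)%R by ring.
unfold Rdiv; apply Rmult_le_compat; try (apply Rmult_le_pos; apply Cmod_ge_0).
- left; apply Rinv_0_lt_compat, pow_lt; now apply Cmod_gt_0.
- apply Rmult_le_compat; try apply Cmod_ge_0; [now apply Cmod_bern | now apply Cmod_unit_pow].
- rewrite <- pow_inv; apply pow_incr; split.
  + left; apply Rinv_0_lt_compat; now apply Cmod_gt_0.
  + apply Rinv_le_contravar; [lra | now apply Dist].
Qed.

Variable h : C.
Hypothesis Hh : (Cmod h < d)%R.

Lemma shifted_distance t : (0 <= t <= 1)%R -> (d - Cmod h <= Cmod (1 - (x + h) * t))%R.
Proof.
intros Ht.
assert (Cmod (1 - x * t) <= Cmod (1 - (x + h) * t) + Cmod (h * t))%R.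
{ replace (1 - x * t) with ((1 - (x + h) * t) + h * t) by ring; apply Cmod_triangle. }
rewrite Cmod_mult, Cmod_RtoC_pos in H by lra.
generalize (Dist t Ht) (Cmod_ge_0 h); intros; nra.
Qed.

Lemma shifted_neq_0 t : (0 <= t <= 1)%R -> 1 - (x + h) * t <> 0.
Proof. intros Ht; apply Cmod_gt_0; generalize (shifted_distance t Ht); lra. Qed.

(** The finite geometric expansion of [1 / (1 - (x + h) t)] in powers of [h],
    integrated; the bound does not depend on [j]. *)
Lemma stieltjes_expand j K :
  (Cmod (stieltjes j (x + h) - sum_n (fun k => stieltjes_coeff j k x * h ^ k)%C K)
   <= (Cmod h / d) ^ S K * / (d - Cmod h))%R.
Proof.
set (f := fun t : R => RtoC (1 - t) ^ j / (1 - (x + h) * RtoC t)).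
assert (I0 : C_is_RInt f 0 1 (stieltjes j (x + h))).
{ apply C_RInt_correct; intros t Ht.
  apply Ccont_div; [now apply shifted_neq_0 | apply Ccont_bern | apply Ccont_one_minus]. }
assert (I : C_is_RInt (fun t => f t - sum_n (fun k => h ^ k * (RtoC (1 - t) ^ j * RtoC t ^ k
    / (1 - x * RtoC t) ^ S k)) K) 0 1
  (stieltjes j (x + h) - sum_n (fun k => stieltjes_coeff j k x * h ^ k) K)).
{ apply C_RInt_minus; [exact I0 |].
  induction K as [|K IH].
  - rewrite Csum_O; apply C_RInt_ext with (fun t => h ^ 0 * (RtoC (1 - t) ^ j * RtoC t ^ 0
      / (1 - x * RtoC t) ^ 1)); [intros; now rewrite Csum_O |].
    rewrite Cmult_comm; apply C_RInt_scal, (stieltjes_coeff_correct j 0 x Hx).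
  - rewrite Csum_Sn.
    apply C_RInt_ext with (fun t => sum_n (fun k => h ^ k * (RtoC (1 - t) ^ j * RtoC t ^ k
      / (1 - x * RtoC t) ^ S k)) K + h ^ S K * (RtoC (1 - t) ^ j * RtoC t ^ S K
      / (1 - x * RtoC t) ^ S (S K))); [intros; now rewrite Csum_Sn |].
    apply C_RInt_plus; [exact IH |].
    rewrite Cmult_comm; apply C_RInt_scal, (stieltjes_coeff_correct j (S K) x Hx). }
apply (C_RInt_le_const _ _ _) with (2 := I); intros t Ht.
assert (N := cut_neq_0 x t Hx Ht); assert (N' := shifted_neq_0 t Ht).
assert (E : f t - sum_n (fun k => h ^ k * (RtoC (1 - t) ^ j * RtoC t ^ k
    / (1 - x * RtoC t) ^ S k)) K
  = RtoC (1 - t) ^ j * (h / (1 - x * RtoC t)) ^ S K * RtoC t ^ S K / (1 - (x + h) * RtoC t)).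
{ unfold f; clear I; induction K as [|K IH].
  - rewrite Csum_O; simpl; field; now split.
  - rewrite Csum_Sn.
    match goal with |- ?a - (?b + ?c) = _ => replace (a - (b + c)) with ((a - b) - c) by ring end.
    rewrite IH; unfold Cdiv at 3; rewrite !Cpow_S.
    replace ((h / (1 - x * RtoC t)) ^ K) with (h ^ K / (1 - x * RtoC t) ^ K)
      by (unfold Cdiv; rewrite Cpow_mult_l, Cpow_inv by exact N; reflexivity).
    assert (P := Cpow_nz _ K N).
    field; repeat split; trivial. }
rewrite E, Cmod_div, !Cmod_mult by exact N'; rewrite (Cmod_pow (h / _)), Cmod_div by exact N.
unfold Rdiv; apply Rmult_le_compat.
- apply Rmult_le_pos; [apply Rmult_le_pos; [apply Cmod_ge_0 |] | apply Cmod_ge_0].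
  apply pow_le, Rmult_le_pos; [apply Cmod_ge_0 | left; apply Rinv_0_lt_compat; now apply Cmod_gt_0].
- left; apply Rinv_0_lt_compat; now apply Cmod_gt_0.
- replace ((Cmod h * / d) ^ S K)%R with (1 * (Cmod h * / d) ^ S K * 1)%R by ring.
  assert (P : (0 <= Cmod h * / Cmod (1 - x * t))%R)
    by (apply Rmult_le_pos; [apply Cmod_ge_0 | left; apply Rinv_0_lt_compat; now apply Cmod_gt_0]).
  apply Rmult_le_compat; [| apply Cmod_ge_0 | | now apply Cmod_unit_pow].
  + apply Rmult_le_pos; [apply Cmod_ge_0 | now apply pow_le].
  + apply Rmult_le_compat; [apply Cmod_ge_0 | now apply pow_le | now apply Cmod_bern |].
    apply pow_incr; split; trivial.
    apply Rmult_le_compat_l; [apply Cmod_ge_0 |]; apply Rinv_le_contravar; [lra | now apply Dist].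
- apply Rinv_le_contravar; [lra | now apply shifted_distance].
Qed.

Variable g : nat -> C.
Hypothesis Hg : summable g.

(** The tail bound being uniform in [j], it survives summation against an
    absolutely summable sequence, without integrating any series. *)
Lemma stieltjes_series_expand :
  summable (fun j => g j * stieltjes j (x + h)) /\
  Cis_series (fun k => CSeries (fun j => g j * stieltjes_coeff j k x) * h ^ k)
    (CSeries (fun j => g j * stieltjes j (x + h))).
Proof.
assert (H0 := Cmod_ge_0 h).
assert (Sc : forall k, summable (fun j => g j * stieltjes_coeff j k x)).
{ intros k; apply summable_le with (fun j => Cmod (g j) * (/ d) ^ S k)%R.
  - intros j; rewrite Cmod_mult; apply Rmult_le_compat_l; [apply Cmod_ge_0 |].
    apply stieltjes_coeff_bound.
  - now apply ex_series_scal_r. }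
assert (Ss : summable (fun j => g j * stieltjes j (x + h))).
{ apply summable_le with (fun j => Cmod (g j) * / (d - Cmod h))%R; [| now apply ex_series_scal_r].
  intros j; rewrite Cmod_mult; apply Rmult_le_compat_l; [apply Cmod_ge_0 |].
  apply (C_RInt_le_const (fun t => RtoC (1 - t) ^ j / (1 - (x + h) * RtoC t))).
  - intros t Ht; assert (N' := shifted_neq_0 t Ht).
    rewrite Cmod_div by exact N'; rewrite <- (Rmult_1_l (/ _)); unfold Rdiv.
    apply Rmult_le_compat; [apply Cmod_ge_0 | | now apply Cmod_bern |].
    + left; apply Rinv_0_lt_compat; now apply Cmod_gt_0.
    + apply Rinv_le_contravar; [lra | now apply shifted_distance].
  - apply C_RInt_correct; intros t Ht.
    apply Ccont_div; [now apply shifted_neq_0 | apply Ccont_bern | apply Ccont_one_minus]. }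
split; [exact Ss |].
apply Cis_series_tends.
set (A := Series (fun j => Cmod (g j))).
set (q := (Cmod h / d)%R).
assert (Hq : (0 <= q < 1)%R).
{ unfold q; split; [apply Rmult_le_pos; [easy | left; now apply Rinv_0_lt_compat] |].
  apply Rmult_lt_reg_r with d; trivial; unfold Rdiv; rewrite Rmult_assoc, Rinv_l; lra. }
apply (tends_squeeze eventually _ (fun n => RtoC (A * / (d - Cmod h) * q * q ^ n))).
- exists 0%nat; intros n _.
  assert (Fin : Cis_series (fun j => g j * sum_n (fun k => stieltjes_coeff j k x * h ^ k) n)
    (sum_n (fun k => CSeries (fun j => g j * stieltjes_coeff j k x) * h ^ k) n)).
  { apply Cis_series_ext with (fun j => sum_n (fun k => h ^ k * (g j * stieltjes_coeff j k x)) n).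
    - intros j; rewrite <- Csum_scal; apply Csum_ext; intros; ring.
    - replace (sum_n (fun k => CSeries (fun j => g j * stieltjes_coeff j k x) * h ^ k) n) with
        (sum_n (fun k => CSeries (fun j => h ^ k * (g j * stieltjes_coeff j k x))) n).
      + apply (CSeries_sum_n (fun j k => h ^ k * (g j * stieltjes_coeff j k x))).
        intros k; exact (summable_scal (h ^ k) _ (Sc k)).
      + apply Csum_ext; intros k _; rewrite (CSeries_scal (h ^ k) _ (Sc k)); ring. }
  assert (Dif := Cis_series_minus _ _ _ _ (CSeries_is_series _ Ss) Fin).
  match goal with |- (Cmod (?a - ?b) <= _)%R => replace (a - b) with (- (b - a)) by ring end.
  rewrite Cmod_opp.
  assert (Pos : (0 <= A)%R).
  { apply Rle_trans with (Cmod (CSeries g)); [apply Cmod_ge_0 |].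
    apply Cmod_CSeries_le; [intros; lra | exact Hg]. }
  rewrite Cmod_RtoC_pos.
  + apply (Cmod_series_le _ (fun j => Cmod (g j) * (q ^ S n * / (d - Cmod h)))%R) with (2 := Dif).
    * intros j.
      match goal with |- (Cmod (?a * ?b - ?a * ?c) <= _)%R =>
        replace (a * b - a * c) with (a * (b - c)) by ring end.
      rewrite Cmod_mult; apply Rmult_le_compat_l; [apply Cmod_ge_0 | apply stieltjes_expand].
    * replace (A * / (d - Cmod h) * q * q ^ n)%R with (A * (q ^ S n * / (d - Cmod h)))%R
        by (simpl; ring).
      apply (is_series_scal_r (q ^ S n * / (d - Cmod h)) (fun j => Cmod (g j))).
      now apply Series_correct.
  + assert (0 < / (d - Cmod h))%R by (apply Rinv_0_lt_compat; lra).
    apply Rmult_le_pos; [apply Rmult_le_pos; [apply Rmult_le_pos |] | apply pow_le]; lra.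
- apply tends_R.
  replace (Finite 0) with (Rbar_mult (A * / (d - Cmod h) * q)%R 0) by (simpl; f_equal; ring).
  apply is_lim_seq_scal_l, is_lim_seq_geom; rewrite Rabs_pos_eq; lra.
Qed.

End Expansion.

Definition stieltjes_series (g : nat -> C) (x : C) : C := CSeries (fun j => g j * stieltjes j x).

Lemma stieltjes_series_analytic g : summable g ->
  forall x, ~ in_cut x -> analytic_at (stieltjes_series g) x.
Proof.
intros Hg x Hx; destruct (cut_distance x Hx) as [d [Hd Dist]].
exists (fun k => CSeries (fun j => g j * stieltjes_coeff j k x)), d; split; trivial.
intros z Hz; apply Cpseries.
destruct (stieltjes_series_expand x d Hx Hd Dist (z - x) Hz g Hg) as [_ H].
now replace (x + (z - x)) with z in H by ring.
Qed.

(** The Beta integral [int_0^1 t^n (1 - t)^k dt]. *)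
Definition beta_nk (n k : nat) : R := (INR (fact n) * INR (fact k) / INR (fact (S (n + k))))%R.

Lemma beta_nk_0 n : beta_nk n 0 = (/ INR (S n))%R.
Proof.
unfold beta_nk; rewrite Nat.add_0_r, fact_simpl, mult_INR.
replace (INR (fact 0)) with 1%R by reflexivity.
generalize (INR_fact_neq_0 n) (not_0_INR (S n) ltac:(lia)); intros; field; now split.
Qed.

Lemma beta_nk_rec n k : (beta_nk n (S k) = beta_nk n k - beta_nk (S n) k)%R.
Proof.
unfold beta_nk.
replace (S (n + S k)) with (S (S (n + k))) by lia.
replace (S (S n + k)) with (S (S (n + k))) by lia.
rewrite (fact_simpl (S (n + k))), (fact_simpl n), (fact_simpl k), !mult_INR, !S_INR, plus_INR.
generalize (INR_fact_neq_0 (S (n + k))) (pos_INR n) (pos_INR k); intros; field; split; lra.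
Qed.

Lemma beta_nk_pos n k : (0 < beta_nk n k)%R.
Proof.
unfold beta_nk; apply Rdiv_lt_0_compat; [apply Rmult_lt_0_compat |]; apply INR_fact_lt_0.
Qed.

Lemma beta_nk_le n k : (beta_nk n k <= / INR (S n))%R.
Proof.
induction k as [|k IH]; [rewrite beta_nk_0; lra |].
rewrite beta_nk_rec; generalize (beta_nk_pos (S n) k); lra.
Qed.

Lemma beta_nk_S_le n k : (beta_nk n (S k) <= / INR (S n) * / INR (S (S n)))%R.
Proof.
induction k as [|k IH].
- right; rewrite beta_nk_rec, !beta_nk_0.
  rewrite (S_INR (S n)); generalize (INR_S_pos n); intros; field; lra.
- rewrite beta_nk_rec; generalize (beta_nk_pos (S n) (S k)); lra.
Qed.

Lemma beta_nk_le_1 n k : (Cmod (beta_nk n k) <= 1)%R.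
Proof.
rewrite Cmod_RtoC_pos by (left; apply beta_nk_pos).
apply Rle_trans with (1 := beta_nk_le n k); rewrite <- Rinv_1.
apply Rinv_le_contravar; [lra |]; rewrite S_INR; generalize (pos_INR n); lra.
Qed.

Lemma beta_nk_integral n k :
  C_is_RInt (fun t => RtoC (1 - t) ^ k * RtoC t ^ n) 0 1 (RtoC (beta_nk n k)).
Proof.
revert n; induction k as [|k IH]; intros n.
- rewrite beta_nk_0.
  replace (RtoC (/ INR (S n))) with
    (RtoC 1 ^ S n * RtoC (/ INR (S n)) - RtoC 0 ^ S n * RtoC (/ INR (S n)))
    by (rewrite Cpow_1_l; simpl; ring).
  apply (C_FTC (fun t => RtoC t ^ S n * RtoC (/ INR (S n)))).
  + intros t _; split; simpl.
    * apply is_derive_ext with (fun s => s ^ S n * / INR (S n))%R.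
      { intros s; rewrite <- RtoC_pow; simpl; ring. }
      auto_derive; trivial.
      rewrite <- RtoC_pow; simpl (fst _).
      change (Init.Nat.pred (S n)) with n.
      change (match n with 0%nat => 1 | S _ => INR n + 1 end)%R with (INR (S n)).
      generalize (not_0_INR (S n) ltac:(lia)); intros; field; trivial.
    * apply is_derive_ext with (fun s => 0%R).
      { intros s; rewrite <- RtoC_pow; simpl; ring. }
      rewrite <- RtoC_pow; simpl; evar_last; [apply (is_derive_const (V := R_NormedModule)) |].
      unfold zero; simpl; ring.
  + intros t _; apply Ccont_mult; [apply (Ccont_bern 0) | apply Ccont_pow, Ccont_id].
- rewrite beta_nk_rec, RtoC_minus.
  apply C_RInt_ext with (fun t => RtoC (1 - t) ^ k * RtoC t ^ n - RtoC (1 - t) ^ k * RtoC t ^ S n).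
  + intros t; rewrite !Cpow_S, RtoC_minus; ring.
  + apply C_RInt_minus; apply IH.
Qed.

Lemma not_in_cut_disc x : (Cmod x < 1)%R -> ~ in_cut x.
Proof.
intros H [A _]; generalize (re_le_Cmod x) (Rle_abs (Re x)); lra.
Qed.

Lemma stieltjes_series_disc g x : summable g -> (Cmod x < 1)%R ->
  Cis_series (fun n => CSeries (fun j => g j * beta_nk n j) * x ^ n) (stieltjes_series g x).
Proof.
intros Hg Hx.
assert (H0 : ~ in_cut 0) by (apply not_in_cut_disc; rewrite Cmod_0; lra).
assert (D0 : forall t : R, (0 <= t <= 1)%R -> (1 <= Cmod (1 - 0 * t))%R).
{ intros t Ht; replace (1 - 0 * t) with (RtoC 1) by ring; rewrite Cmod_1; lra. }
destruct (stieltjes_series_expand 0 1 H0 Rlt_0_1 D0 x Hx g Hg) as [_ H].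
replace (0 + x) with x in H by ring.
apply Cis_series_ext with (2 := H); intros n; f_equal.
apply CSeries_ext; intros j; f_equal.
apply (C_RInt_unique (fun t => RtoC (1 - t) ^ j * RtoC t ^ n) 0 1).
- apply C_RInt_ext with (2 := stieltjes_coeff_correct j n 0 H0).
  intros t; replace (1 - 0 * RtoC t) with (RtoC 1) by ring.
  rewrite Cpow_1_l; field.
- apply beta_nk_integral.
Qed.

(** * The principal logarithm and behaviour at the branch point *)

Lemma Clog_Cexp w : (Rabs (Im w) < PI)%R -> Clog (Cexp w) = w.
Proof.
intros H; apply Rabs_def2 in H; destruct w as [p q]; simpl in H.
unfold Clog; rewrite Cmod_Cexp; simpl Re; rewrite ln_exp; f_equal.
assert (E := exp_pos p).
assert (X : (Re (Cexp (p, q)) / Cmod (Cexp (p, q)))%R = cos q).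
{ rewrite Cmod_Cexp; unfold Cexp; simpl; field; lra. }
assert (Y : Im (Cexp (p, q)) = (exp p * sin q)%R) by (unfold Cexp; simpl; ring).
unfold Carg; rewrite X, Y.
destruct (Rle_dec 0 (exp p * sin q)) as [S | S].
- assert (0 <= q)%R; [| apply acos_cos; lra].
  apply Rnot_lt_le; intros Q.
  assert (0 < sin (- q))%R by (apply sin_gt_0; lra).
  rewrite sin_neg in H0; nra.
- assert (q < 0)%R; [| rewrite <- cos_neg, acos_cos; lra].
  apply Rnot_le_lt; intros Q; apply S, Rmult_le_pos; [lra | apply sin_ge_0; lra].
Qed.

(** The integrand [x / (1 - x t)] has to be differentiated at both ends of
    [[0, 1]], hence on an open interval around it. *)
Lemma segment_margin x : ~ in_cut x ->
  exists d, (0 < d)%R /\ forall t : R, (- d < t < 1 + d)%R -> 1 - x * t <> 0.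
Proof.
intros Hx; destruct (cut_distance x Hx) as [d [Hd D]].
assert (P := Cmod_ge_0 x).
exists (d / (1 + Cmod x))%R; split; [apply Rdiv_lt_0_compat; lra |].
set (e := (d / (1 + Cmod x))%R).
assert (Ee : (e * (1 + Cmod x) = d)%R) by (unfold e; field; lra).
intros t Ht E.
set (s := Rmax 0 (Rmin t 1)).
assert (Hs : (0 <= s <= 1 /\ Rabs (t - s) < e)%R).
{ unfold s, Rmax, Rmin; assert (0 < e)%R by nra.
  destruct (Rle_dec t 1), (Rle_dec 0 _); split; try lra; apply Rabs_def1; lra. }
destruct Hs as [Hs Hts].
assert (A := D s Hs).
replace (1 - x * s) with ((1 - x * t) + x * RtoC (t - s)) in A by (rewrite RtoC_minus; ring).
rewrite E, Cplus_0_l, Cmod_mult, Cmod_R in A.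
nra.
Qed.

Lemma Cmod_log_le r : (0 < Cmod r)%R -> (Cmod (Clog r) <= Rabs (ln (Cmod r)) + PI)%R.
Proof.
intros _; unfold Clog.
replace (ln (Cmod r), Carg r) with (RtoC (ln (Cmod r)) + Ci * RtoC (Carg r))
  by (unfold Ci; apply injective_projections; simpl; ring).
triangle.
rewrite Cmod_mult, Cmod_Ci, !Cmod_R, Rmult_1_l; apply Rplus_le_compat_l.
unfold Carg; generalize (acos_bound (Re r / Cmod r)); intros B.
destruct (Rle_dec _ _); [| rewrite Rabs_Ropp]; rewrite Rabs_pos_eq; lra.
Qed.

(** The primitive [J] of [- x / (1 - x t)] satisfies [Cexp (J t) = 1 - x t] by
    differentiation.  Its imaginary part starts at [0] and cannot cross [PI] or
    [- PI], since [1 - x t] would then be a negative real and [t x] on the cut;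
    so [J] is the principal logarithm. *)
Lemma Clog_integral x : ~ in_cut x -> Clog (1 - x) = - x * stieltjes 0 x.
Proof.
intros Hx; destruct (segment_margin x Hx) as [d [Hd Nz]].
set (phi := fun t : R => - x / (1 - x * RtoC t)).
assert (Cphi : forall t : R, (- d < t < 1 + d)%R -> Ccont phi t).
{ intros t Ht; apply Ccont_div; [now apply Nz | apply Ccont_const | apply Ccont_one_minus]. }
set (J := fun tau : R => (RInt (fun t => fst (phi t)) 0 tau, RInt (fun t => snd (phi t)) 0 tau) : C).
assert (Part : forall p : C -> R,
  (forall c, filterlim p (locally c) (locally (p c))) ->
  forall tau, (- d < tau < 1 + d)%R ->
  is_derive (fun s => RInt (fun t => p (phi t)) 0 s) tau (p (phi tau))).
{ intros p Hp tau Ht.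
  assert (Cp : forall t : R, (- d < t < 1 + d)%R -> continuous (fun t => p (phi t)) t).
  { intros t Ht'; apply (filterlim_comp _ _ _ phi p _ (locally (phi t))); [| apply Hp].
    apply Ccont_continuous; now apply Cphi. }
  apply (is_derive_RInt (V := R_NormedModule) (fun t => p (phi t)) _ 0); [| now apply Cp].
  assert (Pm : (0 < Rmin (tau + d) (1 + d - tau))%R) by (apply Rmin_case; lra).
  exists (mkposreal _ Pm); intros s Hs.
  assert (Hs' : (Rabs (s - tau) < Rmin (tau + d) (1 + d - tau))%R) by exact Hs.
  assert (B1 := Rmin_l (tau + d) (1 + d - tau)); assert (B2 := Rmin_r (tau + d) (1 + d - tau)).
  apply Rabs_def2 in Hs'.
  apply (RInt_correct (V := R_CompleteNormedModule)).
  apply (ex_RInt_continuous (V := R_CompleteNormedModule)); intros t Ht'; apply Cp.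
  revert Ht'; unfold Rmin, Rmax; destruct (Rle_dec 0 s); intros; lra. }
assert (DJ : forall tau, (- d < tau < 1 + d)%R -> Cderiv J tau (phi tau)).
{ intros tau Ht; split.
  - apply (Part fst (fun c => continuous_fst (U := R_UniformSpace) (V := R_UniformSpace) (fst c) (snd c)) tau Ht).
  - apply (Part snd (fun c => continuous_snd (U := R_UniformSpace) (V := R_UniformSpace) (fst c) (snd c)) tau Ht). }
assert (J0 : J 0%R = 0).
{ unfold J; rewrite !RInt_point; reflexivity. }
assert (EJ : forall tau, (0 <= tau <= 1)%R -> Cexp (J tau) = 1 - x * tau).
{ intros tau Ht.
  assert (K : (1 - x * tau) * Cexp (- (1) * J tau) = (1 - x * RtoC 0) * Cexp (- (1) * J 0%R)).
  { apply (C_const_of_deriv0 (fun s => (1 - x * RtoC s) * Cexp (- (1) * J s)) 0 tau).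
    intros s; rewrite Rmin_left, Rmax_right by lra; intros Hs.
    assert (Ns := Nz s ltac:(lra)).
    generalize (Cderiv_mult _ _ s _ _
      (Cderiv_plus _ _ s _ _ (Cderiv_const 1 s) (Cderiv_scal (- x) _ s _ (Cderiv_id s)))
      (Cderiv_Cexp _ s _ (Cderiv_scal (- (1)) _ s _ (DJ s ltac:(lra))))).
    intros D; apply Cderiv_ext with (f := fun s => (1 + - x * RtoC s) * Cexp (- (1) * J s)).
    - intros r; f_equal; ring.
    - match type of D with Cderiv _ _ ?l => replace (RtoC 0) with l; [exact D |] end.
      unfold phi; field; exact Ns. }
  rewrite J0 in K; replace (- (1) * 0) with (RtoC 0) in K by ring; rewrite Cexp_0 in K.
  replace (- (1) * J tau) with (- J tau) in K by ring; rewrite Cexp_opp in K.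
  assert (Ne := Cexp_neq_0 (J tau)).
  replace (Cexp (J tau)) with (((1 - x * tau) * / Cexp (J tau)) * Cexp (J tau));
    [field; exact Ne | rewrite K; ring]. }
assert (Bar : forall v, (Rabs v = PI)%R -> forall tau, (0 <= tau <= 1)%R -> Im (J tau) <> v).
{ intros v Hv tau Ht E; apply (cut_star x tau Hx Ht).
  assert (A := EJ tau Ht); unfold Cexp in A; rewrite E in A.
  assert (cos v = -1 /\ sin v = 0)%R as [Cv Sv].
  { unfold Rabs in Hv; destruct (Rcase_abs v).
    - replace v with (- PI)%R by lra; rewrite cos_neg, sin_neg, cos_PI, sin_PI; lra.
    - rewrite Hv, cos_PI, sin_PI; lra. }
  rewrite Cv, Sv in A; replace (tau * x) with (1 - (1 - x * tau)) by ring; rewrite <- A.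
  generalize (exp_pos (Re (J tau))); generalize (exp (Re (J tau))); intros e He.
  unfold in_cut; simpl; split; lra. }
assert (CI : forall c tau, (0 <= tau <= 1)%R -> continuity_pt (fun s => c * Im (J s) - PI)%R tau).
{ intros c tau Ht; apply continuity_pt_filterlim.
  apply (ex_derive_continuous (V := R_NormedModule) (fun s => c * Im (J s) - PI)%R).
  eexists; apply (is_derive_minus (V := R_NormedModule) (fun s => c * Im (J s))%R (fun _ => PI)).
  - apply (is_derive_scal (fun s => Im (J s)) tau c), (DJ tau ltac:(lra)).
  - apply (is_derive_const (V := R_NormedModule)). }
assert (Side : forall c, (Rabs c = 1)%R -> (c * Im (J 1%R) < PI)%R).
{ intros c Hc; apply Rnot_le_lt; intros [Hge | Hge].
  - destruct (IVT_interv (fun s => c * Im (J s) - PI)%R 0 1) as [z [Hz Ez]];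
      [now apply CI | lra | rewrite J0; simpl; generalize PI_RGT_0; lra | lra |].
    apply (Bar (c * PI)%R) with z; trivial.
    + rewrite Rabs_mult, Hc, Rabs_pos_eq by (generalize PI_RGT_0; lra); ring.
    + unfold Rabs in Hc; destruct (Rcase_abs c); [replace c with (-1)%R in * by lra | subst c]; lra.
  - apply (Bar (c * PI)%R) with 1%R; [| lra |].
    + rewrite Rabs_mult, Hc, Rabs_pos_eq by (generalize PI_RGT_0; lra); ring.
    + unfold Rabs in Hc; destruct (Rcase_abs c); [replace c with (-1)%R in * by lra | subst c]; lra. }
assert (H1 : Cexp (J 1%R) = 1 - x) by (rewrite EJ by lra; ring).
rewrite <- H1, Clog_Cexp.
- apply (C_RInt_unique phi 0 1).
  + replace (J 1%R) with (J 1%R - J 0%R) by (rewrite J0; ring).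
    apply C_FTC; intros t Ht; apply unit_interval in Ht; [apply DJ | apply Cphi]; lra.
  + apply C_RInt_ext with (fun t => - x * (RtoC (1 - t) ^ 0 / (1 - x * RtoC t))).
    * intros t; unfold phi, Cdiv; simpl; ring.
    * now apply C_RInt_scal, stieltjes_correct.
- apply Rabs_def1.
  + generalize (Side 1%R ltac:(apply Rabs_R1)); lra.
  + generalize (Side (-1)%R ltac:(rewrite Rabs_left; lra)); lra.
Qed.

Definition slit : (C -> Prop) -> Prop :=
  within (fun rho : C => rho <> 0 /\ (Rabs (Carg rho) < PI)%R) (locally (0 : C)).

Instance slit_filter : Filter slit.
Proof. unfold slit; apply within_filter, locally_filter. Qed.

Lemma slit_not_cut (rho : C) : rho <> 0 -> (Rabs (Carg rho) < PI)%R -> ~ in_cut (1 - rho).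
Proof.
intros Hn Ha [A B]; destruct rho as [p q]; simpl in A, B.
assert (q = 0)%R by lra; subst q.
assert (p <> 0)%R by (intros E; apply Hn; now rewrite E).
revert Ha; unfold Carg; simpl Im; simpl Re.
destruct (Rle_dec 0 0); [| lra].
replace (Cmod (p, 0%R)) with (- p)%R.
- replace (p / - p)%R with (-1)%R by (field; lra).
  replace (-1)%R with (- (1))%R by ring; rewrite acos_opp, acos_1, Rminus_0_r.
  rewrite Rabs_pos_eq by (generalize PI_RGT_0; lra); lra.
- change (p, 0%R) with (RtoC p); rewrite Cmod_R, Rabs_left1; lra.
Qed.

Lemma slit_small eps : (0 < eps)%R ->
  slit (fun rho => (Cmod rho < eps)%R /\ rho <> 0 /\ ~ in_cut (1 - rho)).
Proof.
intros He.
assert (Id : tends (locally (0 : C)) (fun w : C => w) 0)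
  by (apply (tends_filterlim (locally (0 : C))); intros P HP; exact HP).
unfold slit, within; generalize (Id eps He); apply filter_imp; intros rho H [H1 H2].
change C in rho; replace (rho - 0) with rho in H by ring.
split; [exact H |]; split; [exact H1 | now apply slit_not_cut].
Qed.

Lemma slit_log : tends slit (fun rho => rho * Clog rho) 0.
Proof.
intros eps He.
set (e := Rmin 1 (eps / (2 + PI))).
assert (P := PI_RGT_0).
assert (X : (0 < eps / (2 + PI))%R) by (apply Rdiv_lt_0_compat; lra).
assert (E0 : (0 < e)%R) by (apply Rmin_case; lra).
assert (E1 : (e <= 1)%R) by apply Rmin_l.
assert (E2 : (e * (2 + PI) <= eps)%R).
{ apply Rle_trans with (eps / (2 + PI) * (2 + PI))%R; [| right; field; lra].
  apply Rmult_le_compat_r; [lra | apply Rmin_r]. }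
(* With [|rho| = s^2], the modulus is at most [s * (2 + s * PI)]. *)
generalize (slit_small (e * e) ltac:(nra)); apply filter_imp; intros rho [H [Hn _]].
replace (rho * Clog rho - 0) with (rho * Clog rho) by ring.
assert (R0 := proj1 (Cmod_gt_0 rho) Hn).
set (s := sqrt (Cmod rho)).
assert (S0 : (0 < s)%R) by now apply sqrt_lt_R0.
assert (S2 : (s * s = Cmod rho)%R) by (apply sqrt_sqrt; lra).
assert (Se : (s < e)%R) by nra.
rewrite Cmod_mult.
apply Rle_lt_trans with (Cmod rho * (Rabs (ln (Cmod rho)) + PI))%R.
- apply Rmult_le_compat_l; [lra | now apply Cmod_log_le].
- assert (L : (Rabs (ln (Cmod rho)) <= 2 * / s)%R).
  { rewrite <- S2, ln_mult by trivial.
    assert (A := ln_le_sub (/ s) ltac:(now apply Rinv_0_lt_compat)).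
    rewrite ln_Rinv in A by trivial.
    assert (B := ln_le_sub s S0).
    rewrite Rabs_left1 by lra; lra. }
  apply Rle_lt_trans with (s * s * (2 * / s + PI))%R.
  + rewrite S2; apply Rmult_le_compat_l; lra.
  + replace (s * s * (2 * / s + PI))%R with (s * (2 + s * PI))%R by (field; lra).
    apply Rlt_le_trans with (2 := E2).
    apply Rmult_le_0_lt_compat; nra.
Qed.

Lemma slit_id : tends slit (fun rho => rho) 0.
Proof.
intros eps He; generalize (slit_small eps He); apply filter_imp; intros rho [H _].
now replace (rho - 0) with rho by ring.
Qed.

(** Writing [1 - t = s + (1 - x t) / x] with [s = 1 - 1 / x] reduces all the
    transforms of [(1 - t) ^ j] to the logarithm. *)
Lemma stieltjes_succ j (x : C) : ~ in_cut x -> x <> 0 ->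
  stieltjes (S j) x = (1 - / x) * stieltjes j x + / x * RtoC (/ INR (S j)).
Proof.
intros Hx Hn.
apply (C_RInt_unique (fun t => (1 - / x) * (RtoC (1 - t) ^ j / (1 - x * RtoC t))
  + / x * (RtoC (1 - t) ^ j * RtoC t ^ 0)) 0 1).
- apply is_RInt_ext with (2 := stieltjes_correct (S j) x Hx).
  rewrite Rmin_left, Rmax_right by lra; intros t Ht.
  assert (N := cut_neq_0 x t Hx ltac:(lra)).
  change (RtoC (1 - t) ^ S j / (1 - x * RtoC t) = (1 - / x) * (RtoC (1 - t) ^ j / (1 - x * RtoC t))
    + / x * (RtoC (1 - t) ^ j * RtoC t ^ 0)).
  rewrite Cpow_S; simpl (RtoC t ^ 0); rewrite RtoC_minus; field; now split.
- apply C_RInt_plus; apply C_RInt_scal; [now apply stieltjes_correct |].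
  replace (/ INR (S j))%R with (beta_nk 0 j); [apply beta_nk_integral |].
  unfold beta_nk; simpl (0 + j)%nat; rewrite fact_simpl, mult_INR; simpl (fact 0); simpl (INR 1).
  generalize (INR_fact_neq_0 j) (not_0_INR (S j) ltac:(lia)); intros; field; now split.
Qed.

Lemma inv_INR_S_le_1 j : (Cmod (RtoC (/ INR (S j))) <= 1)%R.
Proof.
rewrite Cmod_RtoC_pos by (left; apply Rinv_0_lt_compat, INR_S_pos).
rewrite <- Rinv_1; apply Rinv_le_contravar; [lra |].
rewrite S_INR; generalize (pos_INR j); lra.
Qed.

(** Only [j = 0] contributes a logarithm: for [j > 0] the recursion shows that the
    transform differs from its value [1 / j] at [x = 1] by [O (rho log rho)],
    uniformly in [j] and up to the slit. *)
Lemma stieltjes_series_log g : summable g ->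
  tends slit (fun rho => stieltjes_series g (1 - rho) + g 0%nat * Clog rho)
    (CSeries (fun j => g (S j) * RtoC (/ INR (S j)))).
Proof.
intros Hg.
set (A := Series (fun j => Cmod (g (S j)))).
assert (Hg1 : summable (fun j => g (S j)))
  by (apply (ex_series_incr_1 (V := R_NormedModule) (fun j => Cmod (g j))) in Hg; exact Hg).
apply (tends_squeeze slit _ (fun rho => RtoC (2 * (Cmod (g 0%nat) + 3 / 2 * A)) *
  RtoC (Cmod (rho * Clog rho)) + RtoC (8 * A) * RtoC (Cmod rho))).
- generalize (slit_small (/ 4) ltac:(lra)); apply filter_imp; intros rho [H [Hn Hc]].
  set (x := 1 - rho) in *; set (s := 1 - / x).
  assert (X1 : (3 / 4 <= Cmod x)%R).
  { assert (Cmod 1 <= Cmod x + Cmod rho)%R; [| rewrite Cmod_1 in *; lra].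
    replace (RtoC 1) with (x + rho) by (unfold x; ring); apply Cmod_triangle. }
  assert (Xn : x <> 0) by (apply Cmod_gt_0; lra).
  assert (Es : s = - rho / x) by (unfold s; replace (- rho) with (x - 1) by (unfold x; ring); field; exact Xn).
  assert (Ix : (/ Cmod x <= 2)%R) by (rewrite <- (Rinv_inv 2); apply Rinv_le_contravar; lra).
  assert (R0 := Cmod_ge_0 rho).
  assert (Sb : (Cmod s <= 2 * Cmod rho)%R).
  { rewrite Es, Cmod_div, Cmod_opp by exact Xn; unfold Rdiv; rewrite Rmult_comm.
    now apply Rmult_le_compat_r. }
  assert (S0 := Cmod_ge_0 s).
  set (l := Clog rho); assert (L0 := Cmod_ge_0 l).
  assert (K0 : stieltjes 0 x = - l * (1 - s)).
  { unfold l; replace rho with (1 - x) by (unfold x; ring).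
    rewrite Clog_integral by exact Hc; unfold s; field; exact Xn. }
  assert (K0b : (Cmod (stieltjes 0 x) <= 3 / 2 * Cmod l)%R).
  { rewrite K0, Cmod_mult, Cmod_opp, Rmult_comm; apply Rmult_le_compat_r; trivial.
    triangle; rewrite Cmod_1, Cmod_opp; lra. }
  assert (Kb : forall j, (Cmod (stieltjes j x) <= 3 / 2 * Cmod l + 3)%R).
  { induction j as [|j IH]; [lra |].
    rewrite stieltjes_succ by trivial; fold s; replace (/ x) with (1 - s) by (unfold s; ring).
    triangle; rewrite !Cmod_mult.
    assert (Cmod (1 - s) <= 3 / 2)%R
      by (triangle; rewrite Cmod_1, Cmod_opp; lra).
    generalize (inv_INR_S_le_1 j) (Cmod_ge_0 (stieltjes j x)) (Cmod_ge_0 (RtoC (/ INR (S j))))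
      (Cmod_ge_0 (1 - s)); intros; nra. }
  assert (Kd : forall j, (Cmod (stieltjes (S j) x - RtoC (/ INR (S j)))
    <= Cmod s * (3 / 2 * Cmod l + 4))%R).
  { intros j; rewrite stieltjes_succ by trivial; fold s.
    replace (s * stieltjes j x + / x * RtoC (/ INR (S j)) - RtoC (/ INR (S j)))
      with (s * (stieltjes j x + - RtoC (/ INR (S j)))) by (unfold s; ring).
    rewrite Cmod_mult; apply Rmult_le_compat_l; trivial.
    triangle; rewrite Cmod_opp.
    generalize (Kb j) (inv_INR_S_le_1 j); lra. }
  assert (Sum : summable (fun j => g j * stieltjes j x)).
  { apply summable_le with (fun j => Cmod (g j) * (3 / 2 * Cmod l + 3))%R.
    - intros j; rewrite Cmod_mult; apply Rmult_le_compat_l; [apply Cmod_ge_0 | apply Kb].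
    - now apply ex_series_scal_r. }
  assert (T1 := Cis_series_pred _ _ (CSeries_is_series _ Sum)).
  assert (T2 : Cis_series (fun j => g (S j) * RtoC (/ INR (S j)))
    (CSeries (fun j => g (S j) * RtoC (/ INR (S j))))).
  { apply CSeries_is_series, summable_le with (2 := Hg1); intros j; rewrite Cmod_mult.
    rewrite <- (Rmult_1_r (Cmod (g (S j)))) at 2.
    apply Rmult_le_compat_l; [apply Cmod_ge_0 | apply inv_INR_S_le_1]. }
  assert (B := Cis_series_minus _ _ _ _ T1 T2).
  assert (B1 : Cis_series (fun j => g (S j) * (stieltjes (S j) x - RtoC (/ INR (S j))))
    (stieltjes_series g x - g 0%nat * stieltjes 0 x
     - CSeries (fun j => g (S j) * RtoC (/ INR (S j))))).
  { apply Cis_series_ext with (2 := B); intros j; ring. }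
  assert (B2 : (Cmod (stieltjes_series g x - g 0%nat * stieltjes 0 x
     - CSeries (fun j => g (S j) * RtoC (/ INR (S j)))%C)
     <= A * (Cmod s * (3 / 2 * Cmod l + 4)))%R).
  { apply (Cmod_series_le _ (fun j => Cmod (g (S j)) * (Cmod s * (3 / 2 * Cmod l + 4)))%R)
      with (2 := B1).
    - intros j; rewrite Cmod_mult; apply Rmult_le_compat_l; [apply Cmod_ge_0 | apply Kd].
    - apply is_series_scal_r; now apply Series_correct. }
  assert (A0 : (0 <= A)%R).
  { apply Rle_trans with (Cmod (CSeries (fun j => g (S j)))); [apply Cmod_ge_0 |].
    apply Cmod_CSeries_le; [intros; lra | exact Hg1]. }
  match goal with |- (Cmod (?p + ?q - ?r) <= _)%R =>
    replace (p + q - r) with ((p - g 0%nat * stieltjes 0 x - r) + g 0%nat * (s * l))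
      by (rewrite K0; ring) end.
  rewrite <- !RtoC_mult, <- RtoC_plus.
  rewrite Cmod_RtoC_pos.
  + triangle.
    rewrite !Cmod_mult.
    assert (Cmod s * Cmod l <= 2 * (Cmod rho * Cmod l))%R by nra.
    assert (A * (Cmod s * (3 / 2 * Cmod l + 4)) <= A * (3 * (Cmod rho * Cmod l) + 8 * Cmod rho))%R
      by (apply Rmult_le_compat_l; nra).
    assert (Cmod (g 0%nat) * (Cmod s * Cmod l) <= Cmod (g 0%nat) * (2 * (Cmod rho * Cmod l)))%R
      by (apply Rmult_le_compat_l; [apply Cmod_ge_0 | lra]).
    fold l; nra.
  + generalize (Cmod_ge_0 (g 0%nat)) (Cmod_ge_0 (rho * l)); intros.
    apply Rplus_le_le_0_compat; apply Rmult_le_pos; lra.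
- replace (RtoC 0) with (RtoC (2 * (Cmod (g 0%nat) + 3 / 2 * A)) * 0 + RtoC (8 * A) * 0) by ring.
  apply (tends_plus slit); apply (tends_mult slit); try apply (tends_const slit);
    apply (tends_Cmod slit); [apply slit_log | apply slit_id].
Qed.

(** * The case of large real parts *)

Lemma Cmod_shift_le (z : C) (eps : R) : (0 < eps)%R ->
  exists N, forall j, (N <= j)%nat -> (Cmod (z + INR j) <= INR j + Re z + eps)%R.
Proof.
intros He; destruct z as [x y]; simpl Re.
destruct (INR_unbounded (Rabs x + y * y / (2 * eps))) as [N HN].
exists N; intros j Hj; apply le_INR in Hj.
assert (Y : (0 <= y * y / (2 * eps))%R).
{ apply Rmult_le_pos; [nra | left; apply Rinv_0_lt_compat; lra]. }
assert (Y2 : (y * y / (2 * eps) * (2 * eps) = y * y)%R) by (field; lra).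
assert (X : (- Rabs x <= x)%R) by (unfold Rabs; destruct (Rcase_abs x); lra).
unfold Cmod; simpl fst; simpl snd.
replace (INR j + x + eps)%R with (sqrt ((INR j + x + eps) * (INR j + x + eps)))
  by (apply sqrt_square; lra).
apply sqrt_le_1_alt; simpl; nra.
Qed.

(** Raabe's test: the ratio condition makes [i (i - 1) |w i|] nonincreasing. *)
Lemma raabe (w : nat -> C) (N : nat) :
  (forall i, (N <= i)%nat -> (Cmod (w (S i)) * INR (S i) <= (INR i - 1) * Cmod (w i))%R) ->
  exists K, (0 <= K)%R /\ forall i, (Cmod (w i) <= K * inv_sq i)%R.
Proof.
intros H.
(* For [i >= 2] one has [(i + 1)^2 <= 8 * i * (i - 1)]. *)
set (N2 := (N + 2)%nat).
set (v := fun i => (Cmod (w i) * (INR i * (INR i - 1)))%R).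
assert (V : forall k, (v (N2 + k)%nat <= v N2)%R).
{ induction k as [|k IH]; [rewrite Nat.add_0_r; lra |].
  apply Rle_trans with (2 := IH); rewrite Nat.add_succ_r; unfold v.
  assert (A := H (N2 + k)%nat ltac:(unfold N2; lia)).
  rewrite S_INR in *; set (x := INR (N2 + k)) in *.
  assert (0 <= x)%R by apply pos_INR.
  replace (Cmod (w (S (N2 + k))) * ((x + 1) * (x + 1 - 1)))%R with
    (x * (Cmod (w (S (N2 + k))) * (x + 1)))%R by ring.
  replace (Cmod (w (N2 + k)%nat) * (x * (x - 1)))%R with
    (x * ((x - 1) * Cmod (w (N2 + k)%nat)))%R by ring.
  now apply Rmult_le_compat_l. }
destruct (bounded_of_tail (fun i => Cmod (w i) / inv_sq i)%R N2 (8 * v N2)) as [K [K0 HK]].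
- intros i Hi; assert (A := V (i - N2)%nat); replace (N2 + (i - N2))%nat with i in A by lia.
  assert (I2 : (2 <= INR i)%R) by (apply (le_INR 2); unfold N2 in Hi; lia).
  unfold inv_sq; rewrite S_INR; revert A; unfold v at 1; set (x := INR i) in *; intros A.
  apply Rle_trans with (8 * (Cmod (w i) * (x * (x - 1))))%R; [| lra].
  replace (Cmod (w i) / / ((x + 1) * (x + 1)))%R with (Cmod (w i) * ((x + 1) * (x + 1)))%R
    by (field; lra).
  replace (8 * (Cmod (w i) * (x * (x - 1))))%R with (Cmod (w i) * (8 * (x * (x - 1))))%R by ring.
  apply Rmult_le_compat_l; [apply Cmod_ge_0 | nra].
- exists K; split; trivial; intros i; assert (I := inv_sq_pos i).
  replace (Cmod (w i)) with (Cmod (w i) / inv_sq i * inv_sq i)%R by (field; lra).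
  apply Rmult_le_compat_r; [lra | apply HK].
Qed.

Lemma inv_sq_summable (w : nat -> C) K : (forall i, (Cmod (w i) <= K * inv_sq i)%R) -> summable w.
Proof.
intros H; apply summable_le with (1 := H).
apply (ex_series_scal (V := R_NormedModule) K), inv_sq_series.
Qed.

(** Coefficients of [t ^ (z - 1)] in powers of [1 - t]. *)
Definition power_coeff (z : C) (i : nat) : C := poch (1 - z) i / cfact i.

Lemma power_coeff_S z i :
  power_coeff z (S i) = power_coeff z i * (1 - z + INR i) / INR (S i).
Proof.
unfold power_coeff; rewrite poch_S, cfact_S; field; split;
  [apply cfact_neq_0 | apply RtoC_INR_S_neq_0].
Qed.

Lemma INR_plus_1_neq_0 n : RtoC (INR n) + 1 <> 0.
Proof. rewrite <- RtoC_plus, <- S_INR; apply RtoC_INR_S_neq_0. Qed.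

Lemma power_coeff_decay z : (3 <= Re z)%R ->
  exists K, (0 <= K)%R /\ forall i, (Cmod (power_coeff z i) <= K * inv_sq i)%R.
Proof.
intros Hz; destruct (Cmod_shift_le (1 - z) 1 Rlt_0_1) as [N HN].
apply (raabe _ N); intros i Hi.
rewrite power_coeff_S, Cmod_div, Cmod_mult, (Cmod_RtoC_pos (INR (S i)))
  by first [apply RtoC_INR_S_neq_0 | apply pos_INR].
unfold Rdiv; rewrite Rmult_assoc, Rinv_l, Rmult_1_r, Rmult_comm by (apply not_0_INR; lia).
apply Rmult_le_compat_r; [apply Cmod_ge_0 |].
apply Rle_trans with (1 := HN i Hi); destruct z; simpl in *; lra.
Qed.

Lemma beta_nk_S n k :
  RtoC (beta_nk n (S k)) * (RtoC (INR n) + INR k + 2) = RtoC (beta_nk n k) * INR (S k).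
Proof.
rewrite <- !RtoC_plus, <- !RtoC_mult; f_equal.
unfold beta_nk; replace (S (n + S k)) with (S (S (n + k))) by lia.
rewrite (fact_simpl (S (n + k))), (fact_simpl k), !mult_INR, !S_INR, plus_INR.
generalize (INR_fact_neq_0 (S (n + k))) (pos_INR n) (pos_INR k); intros; field; split; lra.
Qed.

Lemma tends_inv_sq_lin (w : nat -> C) (K c : R) : (0 <= K)%R -> (0 <= c)%R ->
  (forall i, (Cmod (w i) <= K * inv_sq i * (c + INR i + 1))%R) -> tends eventually w 0.
Proof.
intros HK Hc H.
apply (tends_squeeze eventually _ (fun i => RtoC (K * (c + 1)) * RtoC (/ INR (S i)))).
- exists 0%nat; intros i _; replace (w i - 0) with (w i) by ring.
  rewrite <- RtoC_mult, Cmod_RtoC_pos.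
  + apply Rle_trans with (1 := H i); rewrite !Rmult_assoc; apply Rmult_le_compat_l; trivial.
    unfold inv_sq; rewrite Rinv_mult, Rmult_comm, <- Rmult_assoc.
    apply Rmult_le_compat_r; [left; apply Rinv_0_lt_compat, INR_S_pos |].
    rewrite S_INR; generalize (pos_INR i); intros.
    apply Rmult_le_reg_r with (INR i + 1)%R; [lra |].
    rewrite Rmult_assoc, Rinv_l, Rmult_1_r by lra; nra.
  + apply Rmult_le_pos; [nra | left; apply Rinv_0_lt_compat, INR_S_pos].
- replace (RtoC 0) with (RtoC (K * (c + 1)) * 0) by ring.
  apply (tends_mult eventually); [apply (tends_const eventually) | apply tends_inv_INR].
Qed.

(** [int_0^1 t^(n + z - 1) dt = 1 / (z + n)], as a telescoping series. *)
Lemma power_coeff_moment z n : (3 <= Re z)%R ->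
  Cis_series (fun i => power_coeff z i * beta_nk n i) (/ (z + INR n)).
Proof.
intros Hz; destruct (power_coeff_decay z Hz) as [K [K0 HK]].
assert (Nz : z + INR n <> 0).
{ apply regular_add_neq_0, regular_pos_Re; lra. }
set (tau := fun i => power_coeff z i * beta_nk n i * (RtoC (INR n) + INR i + 1)).
assert (T : tends eventually tau 0).
{ apply (tends_inv_sq_lin tau K (INR n) K0 (pos_INR n)); intros i; unfold tau.
  rewrite Cmod_mult; rewrite <- !RtoC_plus, (Cmod_RtoC_pos (_ + 1))
    by (generalize (pos_INR n) (pos_INR i); lra).
  apply Rmult_le_compat_r; [generalize (pos_INR n) (pos_INR i); lra |].
  rewrite Cmod_mult; apply Rle_trans with (Cmod (power_coeff z i) * 1)%R;
    [apply Rmult_le_compat_l; [apply Cmod_ge_0 | apply beta_nk_le_1] | rewrite Rmult_1_r; apply HK]. }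
assert (S1 : Cis_series (fun i => - (z + INR n) * (power_coeff z i * beta_nk n i)) (0 - tau 0%nat)).
{ apply Cis_series_telescope with (2 := T); intros i; unfold tau.
  rewrite power_coeff_S, (S_INR i), RtoC_plus.
  assert (B := beta_nk_S n i); rewrite S_INR, RtoC_plus in B.
  assert (Ni : RtoC (INR i) + 1 <> 0)
    by (rewrite <- RtoC_plus, <- S_INR; apply RtoC_INR_S_neq_0).
  replace (power_coeff z i * (1 - z + INR i) / (INR i + 1) * beta_nk n (S i)
    * (INR n + (INR i + 1) + 1)) with
    (power_coeff z i * (1 - z + INR i) / (INR i + 1) * (beta_nk n (S i) * (INR n + INR i + 2)))
    by (field; exact Ni).
  rewrite B; field; exact Ni. }
assert (T0 : tau 0%nat = 1).
{ unfold tau, power_coeff; rewrite beta_nk_0, RtoC_inv, S_INR, RtoC_plus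
    by (apply not_0_INR; lia); unfold cfact; simpl.
  field; exact (INR_plus_1_neq_0 n). }
rewrite T0 in S1.
replace (/ (z + INR n)) with (- / (z + INR n) * (0 - 1)) by ring.
apply Cis_series_ext with (2 := Cis_series_scal (- / (z + INR n)) _ _ S1).
intros i; field; exact Nz.
Qed.

Lemma power_coeff_summable z : (3 <= Re z)%R -> summable (power_coeff z).
Proof. intros H; destruct (power_coeff_decay z H) as [K [_ HK]]; now apply inv_sq_summable with K. Qed.

Lemma summable_weight (w : nat -> C) (phi : nat -> C) : summable w ->
  (forall k, (Cmod (phi k) <= 1)%R) -> summable (fun k => w k * phi k).
Proof.
intros H B; apply summable_le with (2 := H); intros k; rewrite Cmod_mult.
rewrite <- (Rmult_1_r (Cmod (w k))) at 2; apply Rmult_le_compat_l; [apply Cmod_ge_0 | apply B].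
Qed.

Lemma summable_succ (w : nat -> C) : summable w -> summable (fun k => w (S k)).
Proof. intros H; apply (ex_series_incr_1 (V := R_NormedModule) (fun k => Cmod (w k))), H. Qed.

Lemma tends_scal_inv_INR (w : nat -> C) (A : R) :
  (0 <= A)%R -> (forall n, (Cmod (w n) <= A * / INR (S n))%R) -> tends eventually w 0.
Proof.
intros HA H; apply (tends_squeeze eventually _ (fun n => RtoC A * RtoC (/ INR (S n)))).
- exists 0%nat; intros n _; replace (w n - 0) with (w n) by ring.
  rewrite <- RtoC_mult, Cmod_RtoC_pos; [apply H |].
  apply Rmult_le_pos; [exact HA | left; apply Rinv_0_lt_compat, INR_S_pos].
- replace (RtoC 0) with (RtoC A * 0) by ring.
  apply (tends_mult eventually); [apply (tends_const eventually) | apply tends_inv_INR].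
Qed.

Lemma Series_Cmod_pos (w : nat -> C) : summable w -> (0 <= Series (fun k => Cmod (w k)))%R.
Proof.
intros H; apply Rle_trans with (Cmod (CSeries w)); [apply Cmod_ge_0 |].
apply Cmod_CSeries_le; [intros; lra | exact H].
Qed.

(** [int_0^1 (t^(z-1) - 1) / (1 - t) dt = psi 1 - psi z]: multiplying the
    integrand by [t^n] and letting [n] grow telescopes it into the digamma series. *)
Lemma digamma_power_series z : (3 <= Re z)%R ->
  CSeries (fun i => power_coeff z (S i) * RtoC (/ INR (S i)))
  = psi_shift z.
Proof.
intros Hz; assert (Sq := power_coeff_summable z Hz).
assert (Sq1 := summable_succ _ Sq).
set (S_ := fun n => CSeries (fun i => power_coeff z (S i) * beta_nk n i)).
assert (Sn : forall n, summable (fun i => power_coeff z (S i) * beta_nk n i))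
  by (intros n; apply summable_weight; [exact Sq1 | intros; apply beta_nk_le_1]).
assert (T : tends eventually (fun n => - S_ n) 0).
{ replace (RtoC 0) with (- RtoC 0) by ring; apply (tends_opp eventually).
  apply tends_scal_inv_INR with (Series (fun k => Cmod (power_coeff z (S k))));
    [now apply Series_Cmod_pos |].
  intros n; rewrite <- Series_scal_r; apply Cmod_CSeries_le; [| now apply ex_series_scal_r].
  intros i; rewrite Cmod_mult; apply Rmult_le_compat_l; [apply Cmod_ge_0 |].
  rewrite Cmod_RtoC_pos by (left; apply beta_nk_pos); apply beta_nk_le. }
assert (A : Cis_series (fun k => / (z + INR k) - / (1 + INR k)) (0 - - S_ 0%nat)).
{ apply Cis_series_telescope with (2 := T); intros n.
  assert (E : / (z + INR n) - / (1 + INR n) = S_ n - S_ (S n)); [| rewrite E; ring].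
  assert (B := Cis_series_pred _ _ (power_coeff_moment z n Hz)); cbv beta in B.
  assert (Dif := Cis_series_minus _ _ _ _ (CSeries_is_series _ (Sn n)) (CSeries_is_series _ (Sn (S n)))).
  apply Cis_series_ext with (v := fun i => power_coeff z (S i) * beta_nk n (S i)) in Dif.
  - apply CSeries_unique in B; apply CSeries_unique in Dif; unfold S_; rewrite <- Dif, B.
    rewrite beta_nk_0, RtoC_inv, S_INR, RtoC_plus by (apply not_0_INR; lia).
    unfold power_coeff, cfact; simpl.
    assert (N1 : 1 + RtoC (INR n) <> 0)
      by (rewrite Cplus_comm, <- RtoC_plus, <- S_INR; apply RtoC_INR_S_neq_0).
    assert (N2 : RtoC (INR n) + 1 <> 0) by now rewrite Cplus_comm.
    assert (N3 : z + INR n <> 0) by (apply regular_add_neq_0, regular_pos_Re; lra).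
    field; repeat split; trivial.
  - intros i; rewrite beta_nk_rec, RtoC_minus; ring. }
apply CSeries_unique in A.
rewrite (CSeries_unique _ _ (digamma_series z ltac:(apply regular_pos_Re; lra))) in A.
rewrite A; replace (0 - - S_ 0%nat) with (S_ 0%nat) by ring.
apply CSeries_ext; intros i; f_equal; f_equal.
unfold beta_nk; simpl (0 + i)%nat; rewrite fact_simpl, mult_INR; simpl (fact 0); simpl (INR 1).
generalize (INR_fact_neq_0 i) (not_0_INR (S i) ltac:(lia)); intros; field; now split.
Qed.

(** The limiting form of [2F1 (a, b; a + b; 1 - rho)], written with [1 / Gamma]
    so that it makes sense for all [a] and [b]. *)
Definition gauss_log (a b rho : C) : C :=
  - / rGamma (a + b) * ((2 * euler_gamma + Clog rho) * (rGamma a * rGamma b)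
    - (drGamma a * rGamma b + rGamma a * drGamma b)).

(** Existence of the continuation is carried along with its asymptotics, since
    contiguous relations transport both. *)
Definition has_log_form (a b : C) : Prop :=
  exists G, is_principal_2F1 a b (a + b) G /\
    tends slit (fun rho => G (1 - rho) - gauss_log a b rho) 0.

Lemma euler_gamma_rGamma : euler_gamma = drGamma 1 / rGamma 1.
Proof.
unfold euler_gamma; rewrite psi_rGamma; [ring |].
apply regular_pos_Re; simpl; lra.
Qed.

Lemma Cmult_cancel_l (c x y : C) : c <> 0 -> c * x = c * y -> x = y.
Proof.
intros Hc H; replace x with (/ c * (c * x)) by (field; exact Hc); rewrite H; field; exact Hc.
Qed.

Section Large.

Variables a b : C.
Hypotheses (Ha : (3 <= Re a)%R) (Hb : (Re a + 3 <= Re b)%R).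

(* [h(t) = t^(a-1) * 2F1 (a, 1 - b; 1; 1 - t)] in powers of [1 - t]: [q] and [p] are the
   coefficients of the two factors, [g] those of [h]. *)
Let q := power_coeff a.
Let p := fun j => poch a j * poch (1 - b) j / (cfact j * cfact j).
Let g := convol q p.

Lemma large_p_S j : p (S j) = p j * ((a + INR j) * (1 - b + INR j)) / (INR (S j) * INR (S j)).
Proof.
unfold p; rewrite !poch_S, cfact_S; field; split; first [apply RtoC_INR_S_neq_0 | apply cfact_neq_0].
Qed.

Lemma large_p_decay : exists K, (0 <= K)%R /\ forall j, (Cmod (p j) <= K * inv_sq j)%R.
Proof.
destruct (Cmod_shift_le a (/ 2) ltac:(lra)) as [N1 H1].
destruct (Cmod_shift_le (1 - b) (/ 2) ltac:(lra)) as [N2 H2].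
apply (raabe _ (N1 + N2 + 1)); intros i Hi.
specialize (H1 i ltac:(lia)); specialize (H2 i ltac:(lia)).
assert (I1 : (1 <= INR i)%R) by (apply (le_INR 1); lia).
rewrite large_p_S, Cmod_div, !Cmod_mult, (Cmod_RtoC_pos (INR (S i)))
  by first [apply pos_INR | apply Cmult_neq_0; apply RtoC_INR_S_neq_0].
rewrite S_INR; set (x := INR i) in *.
replace (Re (1 - b)) with (1 - Re b)%R in H2 by (destruct b; simpl; ring).
set (A := Re a) in *; set (B := Re b) in *.
assert (P1 := Cmod_ge_0 (a + x)); assert (P2 := Cmod_ge_0 (1 - b + x)).
assert (Pr : (Cmod (a + x) * Cmod (1 - b + x) <= (x - 1) * (x + 1))%R).
{ apply Rle_trans with ((x + A + / 2) * (x + (1 - B) + / 2))%R; [now apply Rmult_le_compat |].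
  apply Rle_trans with ((x + A + / 2) * (x - 2 - A + / 2))%R; [apply Rmult_le_compat_l; lra |].
  nra. }
apply Rmult_le_reg_r with (x + 1)%R; [lra |].
replace (Cmod (p i) * (Cmod (a + x) * Cmod (1 - b + x)) / ((x + 1) * (x + 1)) * (x + 1) * (x + 1))%R
  with (Cmod (p i) * (Cmod (a + x) * Cmod (1 - b + x)))%R by (field; lra).
replace ((x - 1) * Cmod (p i) * (x + 1))%R with (Cmod (p i) * ((x - 1) * (x + 1)))%R by ring.
apply Rmult_le_compat_l; [apply Cmod_ge_0 | exact Pr].
Qed.

Lemma large_regular : ~ nonpos_int a /\ ~ nonpos_int b /\ ~ nonpos_int (a + b).
Proof.
repeat split; apply regular_pos_Re; try lra; destruct a, b; simpl in *; lra.
Qed.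

Lemma large_q_summable : summable q.
Proof. now apply power_coeff_summable. Qed.

Lemma large_p_summable : summable p.
Proof. destruct large_p_decay as [K [_ HK]]; now apply inv_sq_summable with K. Qed.

Lemma large_g_summable : summable g.
Proof. apply convol_summable; [apply large_q_summable | apply large_p_summable]. Qed.

Lemma large_g_0 : g 0%nat = 1.
Proof.
unfold g, convol; rewrite Csum_O; unfold q, p, power_coeff, cfact; simpl; field.
Qed.

(** [int_0^1 t^n (1 - t)^j t^(a-1) dt = j! / (a + n)_(j + 1)]: multiplying the integrand by
    [1 - t] is taking a difference in [n]. *)
Lemma large_q_moment j n :
  Cis_series (fun i => q i * beta_nk n (i + j)) (cfact j / poch (a + INR n) (S j)).
Proof.
destruct large_regular as [Ra _].
revert n; induction j as [|j IH]; intros n.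
- replace (cfact 0 / poch (a + INR n) 1) with (/ (a + INR n)).
  + apply Cis_series_ext with (2 := power_coeff_moment a n Ha).
    intros i; now rewrite Nat.add_0_r.
  + unfold cfact; simpl; field; now apply regular_add_neq_0.
- assert (D := Cis_series_minus _ _ _ _ (IH n) (IH (S n))).
  replace (cfact (S j) / poch (a + INR n) (S (S j))) with
    (cfact j / poch (a + INR n) (S j) - cfact j / poch (a + INR (S n)) (S j)).
  + apply Cis_series_ext with (2 := D).
    intros i; rewrite Nat.add_succ_r, beta_nk_rec, RtoC_minus; ring.
  + rewrite (poch_shift (a + INR n) (S j)), (poch_shift (a + INR n) j), !poch_S.
    rewrite !S_INR, cfact_S, S_INR, !RtoC_plus, !Cplus_assoc.
    assert (N1 := regular_add_neq_0 a n Ra).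
    assert (N2 := regular_add_neq_0 a (n + (1 + j)) Ra).
    assert (N3 := poch_neq_0 (a + INR (n + 1)) j (regular_add a (n + 1) Ra)).
    rewrite !plus_INR, !RtoC_plus, !Cplus_assoc in N2; rewrite plus_INR, RtoC_plus, Cplus_assoc in N3.
    simpl (INR 1) in *; field; repeat split; trivial.
Qed.

(* The moments of [h]. *)
Let m := fun n => CSeries (fun k => g k * beta_nk n k).

Lemma large_m_series n :
  Cis_series (fun j => poch a j * poch (1 - b) j / (cfact j * poch (a + INR n) (S j))) (m n).
Proof.
destruct large_regular as [Ra _].
assert (W := convol_weight q p (fun k => RtoC (beta_nk n k)) 1 large_q_summable large_p_summable
  (beta_nk_le_1 n)).
apply CSeries_unique in W; change (m n = CSeries (fun j => p j * CSeries (fun i => q i * beta_nk n (i + j)))) in W.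
rewrite W; apply Cis_series_ext with (fun j => p j * CSeries (fun i => q i * beta_nk n (i + j))).
- intros j; rewrite (CSeries_unique _ _ (large_q_moment j n)); unfold p.
  field; split; [| apply cfact_neq_0]; now apply poch_neq_0, regular_add.
- apply CSeries_is_series, summable_le with (fun j => Cmod (p j) * Series (fun i => Cmod (q i)))%R.
  + intros j; rewrite Cmod_mult; apply Rmult_le_compat_l; [apply Cmod_ge_0 |].
    apply Cmod_CSeries_le; [| apply large_q_summable].
    intros i; rewrite Cmod_mult; rewrite <- (Rmult_1_r (Cmod (q i))) at 2.
    apply Rmult_le_compat_l; [apply Cmod_ge_0 | apply beta_nk_le_1].
  + apply ex_series_scal_r, large_p_summable.
Qed.

Lemma Cmod_fact_poch_le z j : (1 <= Re z)%R -> (Cmod (cfact j / poch z j) <= 1)%R.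
Proof.
intros Hz; assert (Rz : ~ nonpos_int z) by (apply regular_pos_Re; lra).
induction j as [|j IH].
- replace (cfact 0 / poch z 0) with (RtoC 1) by (unfold cfact; simpl; field).
  rewrite Cmod_1; lra.
- assert (Nj := regular_add_neq_0 z j Rz).
  replace (cfact (S j) / poch z (S j)) with ((cfact j / poch z j) * (INR (S j) / (z + INR j)))
    by (rewrite poch_S, cfact_S; field; split; [exact Nj | now apply poch_neq_0]).
  rewrite Cmod_mult, <- (Rmult_1_l 1).
  apply Rmult_le_compat; try apply Cmod_ge_0; trivial.
  rewrite Cmod_div, Cmod_RtoC_pos by first [exact Nj | apply pos_INR].
  assert (P := proj1 (Cmod_gt_0 _) Nj).
  apply Rmult_le_reg_r with (Cmod (z + INR j)); trivial.
  unfold Rdiv; rewrite Rmult_assoc, Rinv_l, Rmult_1_r, Rmult_1_l by lra.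
  apply Rle_trans with (2 := re_le_Cmod _), Rle_trans with (2 := Rle_abs _).
  rewrite S_INR; destruct z; simpl in *; lra.
Qed.

(** Gauss's summation theorem enters only through this first-order recurrence,
    proved by telescoping: the two sides differ termwise by the increment of
    [j (a)_j (1 - b)_j / (j! (a + n + 1)_j)]. *)
Lemma large_m_rec n :
  (INR n + (a + b)) * (INR n + 1) * m (S n) = (INR n + a) * (INR n + b) * m n.
Proof.
destruct large_regular as [Ra _].
destruct large_p_decay as [K [K0 HK]].
set (z := a + INR (S n)).
assert (Rz : ~ nonpos_int z) by now apply regular_add.
set (V := fun j => INR j * (p j * (cfact j / poch z j))).
assert (TV : tends eventually V 0).
{ apply (tends_inv_sq_lin V K 0 K0 (Rle_refl 0)); intros j; unfold V.
  rewrite !Cmod_mult, Cmod_RtoC_pos by apply pos_INR.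
  assert (F := Cmod_fact_poch_le z j ltac:(unfold z; rewrite S_INR; destruct a; simpl in *;
    generalize (pos_INR n); lra)).
  generalize (HK j) (pos_INR j) (Cmod_ge_0 (p j)) (Cmod_ge_0 (cfact j / poch z j)) (inv_sq_pos j); intros.
  assert (Cmod (p j) * Cmod (cfact j / poch z j) <= K * inv_sq j * 1)%R
    by (apply Rmult_le_compat; trivial).
  assert (0 <= K * inv_sq j)%R by nra.
  apply Rle_trans with (INR j * (K * inv_sq j * 1))%R; [now apply Rmult_le_compat_l |].
  rewrite Rmult_1_r, Rmult_comm; apply Rmult_le_compat_l; lra. }
assert (D := Cis_series_minus _ _ _ _
  (Cis_series_scal ((INR n + (a + b)) * (INR n + 1)) _ _ (large_m_series (S n)))
  (Cis_series_scal ((INR n + a) * (INR n + b)) _ _ (large_m_series n))).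
assert (E : Cis_series (fun j => V (S j) - V j) (0 - V 0%nat))
  by now apply Cis_series_telescope with (2 := TV).
apply Ceq_minus.
apply CSeries_unique in D; apply CSeries_unique in E.
transitivity (0 - V 0%nat); [| unfold V; simpl; ring].
rewrite <- D, <- E; apply CSeries_ext; intros j; unfold V; rewrite large_p_S; unfold p.
rewrite (poch_shift (a + INR n) j); replace (a + INR n + 1) with z
  by (unfold z; rewrite S_INR, RtoC_plus; ring); fold z.
rewrite poch_S, cfact_S.
assert (N1 := poch_neq_0 z j Rz); assert (N2 := regular_add_neq_0 z j Rz).
assert (N3 := regular_add_neq_0 a n Ra); assert (N4 := cfact_neq_0 j).
assert (N5 := RtoC_INR_S_neq_0 j).
replace (a + INR n) with (z - 1) in * by (unfold z; rewrite S_INR, RtoC_plus; ring).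
replace (RtoC (INR n)) with (z - 1 - a) by (unfold z; rewrite S_INR, RtoC_plus; ring).
rewrite S_INR, RtoC_plus in *.
field; repeat split; trivial.
Qed.

(** [h(1) = 1], and the powers [(1 - t)^k] with [k > 0] have moments [O (1 / n^2)]. *)
Lemma large_m_lim : tends eventually (fun n => INR n * m n) 1.
Proof.
set (A := Series (fun k => Cmod (g (S k)))).
assert (Sg := large_g_summable).
assert (Sg1 := summable_succ _ Sg).
assert (A0 : (0 <= A)%R) by now apply Series_Cmod_pos.
cut (tends eventually (fun n => INR n * m n - 1) 0).
{ intros H; apply (tends_ext eventually (fun n => (INR n * m n - 1) + 1)).
  - exists 0%nat; intros; ring.
  - assert (X := tends_plus eventually _ _ _ _ H (tends_const eventually 1)).
    now rewrite Cplus_0_l in X. }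
apply tends_scal_inv_INR with (1 + A)%R; [lra |]; intros n.
assert (S1 := summable_weight g (fun k => RtoC (beta_nk n k)) Sg (beta_nk_le_1 n)).
assert (S2 := Cis_series_pred _ _ (CSeries_is_series _ S1)).
fold (m n) in S2; cbv beta in S2; rewrite large_g_0, beta_nk_0 in S2.
assert (P := INR_S_pos n).
assert (B : (Cmod (m n - 1 * RtoC (/ INR (S n))) <= A * (/ INR (S n) * / INR (S (S n))))%R).
{ apply (Cmod_series_le _ (fun k => Cmod (g (S k)) * (/ INR (S n) * / INR (S (S n))))%R) with (2 := S2).
  - intros k; rewrite Cmod_mult; apply Rmult_le_compat_l; [apply Cmod_ge_0 |].
    rewrite Cmod_RtoC_pos by (left; apply beta_nk_pos); apply beta_nk_S_le.
  - apply is_series_scal_r; now apply Series_correct. }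
replace (INR n * m n - 1) with (INR n * (m n - 1 * RtoC (/ INR (S n))) + - RtoC (/ INR (S n))).
- triangle.
  rewrite Cmod_mult, Cmod_opp, !Cmod_RtoC_pos
    by first [apply pos_INR | left; now apply Rinv_0_lt_compat].
  rewrite Rmult_plus_distr_r, Rmult_1_l, Rplus_comm; apply Rplus_le_compat_l.
  apply Rle_trans with (INR n * (A * (/ INR (S n) * / INR (S (S n)))))%R;
    [apply Rmult_le_compat_l; [apply pos_INR | exact B] |].
  replace (INR n * (A * (/ INR (S n) * / INR (S (S n)))))%R with
    (A * / INR (S n) * (INR n * / INR (S (S n))))%R by ring.
  rewrite <- (Rmult_1_r (A * / INR (S n))) at 2; apply Rmult_le_compat_l.
  + apply Rmult_le_pos; [exact A0 | left; now apply Rinv_0_lt_compat].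
  + rewrite !S_INR; generalize (pos_INR n); intros.
    apply Rmult_le_reg_r with (INR n + 1 + 1)%R; [lra |].
    rewrite Rmult_assoc, Rinv_l; lra.
- rewrite RtoC_inv by (apply not_0_INR; lia); rewrite S_INR, RtoC_plus.
  field; exact (INR_plus_1_neq_0 n).
Qed.

(* [Gamma (a + b) / (Gamma a Gamma b)]. *)
Let c0 := rGamma a * rGamma b / rGamma (a + b).

Lemma gauss_coeff_S c n : ~ nonpos_int c ->
  gauss_coeff a b c (S n) * ((INR n + c) * (INR n + 1))
  = gauss_coeff a b c n * ((INR n + a) * (INR n + b)).
Proof.
intros Rc; unfold gauss_coeff; rewrite !poch_S, cfact_S, S_INR, RtoC_plus.
assert (N1 := poch_neq_0 c n Rc); assert (N2 := regular_add_neq_0 c n Rc).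
assert (N3 := cfact_neq_0 n); assert (N4 := RtoC_INR_S_neq_0 n); rewrite S_INR, RtoC_plus in N4.
field; repeat split; trivial.
Qed.

(** Both sides satisfy the same first-order recurrence, and the constant of
    proportionality is read off as [n] tends to infinity. *)
Lemma large_coeff n : gauss_coeff a b (a + b) n = c0 * m n.
Proof.
destruct large_regular as [Ra [Rb Rc]].
assert (E : forall n, m n = m 0%nat * gauss_coeff a b (a + b) n).
{ clear n; induction n as [|n IH].
  - unfold gauss_coeff, cfact; simpl; field.
  - assert (N : (INR n + (a + b)) * (INR n + 1) <> 0).
    { apply Cmult_neq_0.
      - rewrite Cplus_comm; now apply regular_add_neq_0.
      - rewrite <- RtoC_plus, <- S_INR; apply RtoC_INR_S_neq_0. }
    assert (R1 := large_m_rec n); assert (R2 := gauss_coeff_S (a + b) n Rc).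
    rewrite IH in R1.
    assert (X : (INR n + (a + b)) * (INR n + 1) * m (S n)
      = (INR n + (a + b)) * (INR n + 1) * (m 0%nat * gauss_coeff a b (a + b) (S n))).
    { rewrite R1; transitivity (m 0%nat * (gauss_coeff a b (a + b) n * ((INR n + a) * (INR n + b))));
        [ring | rewrite <- R2; ring]. }
    exact (Cmult_cancel_l _ _ _ N X). }
assert (L : m 0%nat * c0 = 1).
{ apply (tends_unique eventually (fun n => INR n * m n)); [| exact large_m_lim].
  apply (tends_ext eventually (fun n => m 0%nat * (INR n * gauss_coeff a b (a + b) n))).
  - exists 0%nat; intros k _; rewrite (E k); ring.
  - apply (tends_mult eventually); [apply (tends_const eventually) | now apply gauss_coeff_asymptotics]. }
rewrite (E n); replace (gauss_coeff a b (a + b) n) with (1 * gauss_coeff a b (a + b) n) at 1 by ring.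
rewrite <- L; ring.
Qed.

(** [int_0^1 (h(t) - 1) / (1 - t) dt], with [h] the product of a power of [t] and of a
    series in [1 - t]: the constant term of the latter gives the integral for
    [psi a], and its term of index [j > 0] gives the [j]-th term of the integral for
    [psi b]. *)
Lemma large_constant :
  CSeries (fun j => g (S j) * RtoC (/ INR (S j)))
  = psi_shift a + psi_shift b.
Proof.
destruct large_regular as [Ra [Rb Rc]].
set (phi := fun k => match k with O => RtoC 0 | S i => RtoC (/ INR (S i)) end).
assert (Hphi : forall k, (Cmod (phi k) <= 1)%R).
{ intros [|k]; [simpl; rewrite Cmod_0; lra | apply inv_INR_S_le_1]. }
assert (W := convol_weight q p phi 1 large_q_summable large_p_summable Hphi).
assert (W1 := Cis_series_pred _ _ W); cbv beta in W1; fold g in W1.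
apply CSeries_unique in W1.
transitivity (CSeries (fun n => g (S n) * phi (S n))); [reflexivity |].
rewrite W1.
assert (Bphi : forall i, RtoC (/ INR (S i)) = beta_nk 0 i).
{ intros i; f_equal; unfold beta_nk; simpl (0 + i)%nat; rewrite fact_simpl, mult_INR.
  simpl (fact 0); simpl (INR 1).
  generalize (INR_fact_neq_0 i) (not_0_INR (S i) ltac:(lia)); intros; field; now split. }
assert (R0 : Cis_series (fun i => q i * phi (i + 0)%nat) (psi_shift a)).
{ rewrite <- (digamma_power_series a Ha).
  assert (Sq : summable (fun i => power_coeff a (S i) * RtoC (/ INR (S i))))
    by (apply summable_weight; [apply summable_succ, large_q_summable | apply inv_INR_S_le_1]).
  set (w := fun i => q i * phi (i + 0)%nat).
  assert (X : Cis_series w (w 0%nat + CSeries (fun i => power_coeff a (S i) * RtoC (/ INR (S i))))).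
  { apply Cis_series_succ, Cis_series_ext with (2 := CSeries_is_series _ Sq).
    intros i; unfold w; rewrite Nat.add_0_r; reflexivity. }
  replace (w 0%nat) with (RtoC 0) in X by (unfold w; simpl; ring).
  now rewrite Cplus_0_l in X. }
assert (Rj : forall j, p (S j) * CSeries (fun i => q i * phi (i + S j)%nat)
  = power_coeff b (S j) * RtoC (/ INR (S j))).
{ intros j.
  assert (X : CSeries (fun i => q i * phi (i + S j)%nat) = cfact j / poch (a + INR 0) (S j)).
  { rewrite <- (CSeries_unique _ _ (large_q_moment j 0)); apply CSeries_ext; intros i.
    rewrite Nat.add_succ_r; change (phi (S (i + j))) with (RtoC (/ INR (S (i + j)))).
    now rewrite Bphi. }
  rewrite X; simpl (INR 0); rewrite Cplus_0_r; unfold p, power_coeff.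
  rewrite cfact_S, RtoC_inv by (apply not_0_INR; lia).
  assert (N1 := poch_neq_0 a (S j) Ra); assert (N2 := cfact_neq_0 j).
  assert (N3 := RtoC_INR_S_neq_0 j).
  field; repeat split; trivial. }
assert (Hb3 : (3 <= Re b)%R) by lra.
assert (Tot : Cis_series (fun j => p j * CSeries (fun i => q i * phi (i + j)%nat))
  (psi_shift a + psi_shift b)).
{ assert (Sb : summable (fun j => power_coeff b (S j) * RtoC (/ INR (S j))))
    by (apply summable_weight; [now apply summable_succ, power_coeff_summable | apply inv_INR_S_le_1]).
  assert (Y := CSeries_is_series _ Sb); rewrite (digamma_power_series b Hb3) in Y.
  set (w := fun j => p j * CSeries (fun i => q i * phi (i + j)%nat)).
  assert (X : Cis_series w (w 0%nat + psi_shift b)).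
  { apply Cis_series_succ, Cis_series_ext with (2 := Y); intros j; symmetry; apply Rj. }
  unfold w at 2 in X; rewrite (CSeries_unique _ _ R0) in X.
  replace (p 0%nat) with (RtoC 1) in X by (unfold p, cfact; simpl; field).
  now rewrite Cmult_1_l in X. }
rewrite (CSeries_unique _ _ Tot); change (phi 0%nat) with (RtoC 0); ring.
Qed.

Lemma large_log_form : has_log_form a b.
Proof.
destruct large_regular as [Ra [Rb Rc]].
assert (Sg := large_g_summable).
exists (fun x => (c0 + 0 * x) * stieltjes_series g x); split; [split |].
- intros x Hx; now apply analytic_affine, stieltjes_series_analytic.
- intros x Hx; apply Cpseries.
  replace (c0 + 0 * x) with c0 by ring.
  apply Cis_series_ext with (2 := Cis_series_scal c0 _ _ (stieltjes_series_disc g x Sg Hx)).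
  intros n; rewrite large_coeff; unfold m; ring.
- assert (T := stieltjes_series_log g Sg); rewrite large_constant, large_g_0 in T.
  apply (tends_ext slit (fun rho => c0 * ((stieltjes_series g (1 - rho) + 1 * Clog rho) -
    (psi_shift a + psi_shift b)))).
  + apply filter_forall; intros rho; unfold gauss_log, c0, psi_shift; rewrite euler_gamma_rGamma.
    assert (N1 := rGamma_neq_0 a Ra); assert (N2 := rGamma_neq_0 b Rb).
    assert (N3 := rGamma_neq_0 _ Rc).
    assert (N4 := rGamma_neq_0 1 ltac:(apply regular_pos_Re; simpl; lra)).
    field; repeat split; trivial.
  + replace (RtoC 0) with (c0 * ((psi_shift a + psi_shift b) - (psi_shift a + psi_shift b))) by ring.
    apply (tends_mult slit); [apply (tends_const slit) |].
    apply (tends_minus slit); [exact T | apply (tends_const slit)].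
Qed.

End Large.

(** * A contiguous relation, and the case of arbitrary parameters *)

(** The relation between [2F1] at [a], [a + 1] and [a + 2] (with [c - a = b]) obtained from
    Euler's integral by integrating the derivative of
    [t^a (1 - t)^b (1 - x t)^(1 - b)].  Dividing it by [a] leaves only denominators
    in [a + b], so it remains valid when [a] is a nonpositive integer. *)
Definition step_combination (a b : C) (G1 G2 : C -> C) (x : C) : C :=
  (1 + (a + 1 - b) / (a + b) * x) * G1 x
  + (0 + - ((a + 1) * (a + 1) / ((a + b) * (a + b + 1))) * x) * G2 x.

Lemma step_coeff a b k : ~ nonpos_int (a + b) ->
  gauss_coeff a b (a + b) k =
  PS_affine 1 ((a + 1 - b) / (a + b)) (gauss_coeff (a + 1) b (a + 1 + b)) k
  + PS_affine 0 (- ((a + 1) * (a + 1) / ((a + b) * (a + b + 1))))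
      (gauss_coeff (a + 1 + 1) b (a + 1 + 1 + b)) k.
Proof.
intros Rc.
replace (a + 1 + b) with (a + b + 1) by ring.
replace (a + 1 + 1 + b) with (a + b + 1 + 1) by ring.
set (c := a + b) in *.
assert (C0 := regular_neq_0 c Rc).
assert (C1 : c + 1 <> 0) by (replace (c + 1) with (c + INR 1) by (simpl; ring); now apply regular_add_neq_0).
assert (Rc1 : ~ nonpos_int (c + 1)) by (replace (c + 1) with (c + INR 1) by (simpl; ring); now apply regular_add).
destruct k as [|n]; unfold PS_affine, gauss_coeff.
- unfold cfact; simpl; field; now split.
- assert (N1 := poch_neq_0 (c + 1) n Rc1); assert (N2 := regular_add_neq_0 (c + 1) n Rc1).
  assert (N3 := cfact_neq_0 n); assert (N4 := RtoC_INR_S_neq_0 n).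
  rewrite (poch_shift a), (poch_shift c), (poch_S (a + 1) n), (poch_S (c + 1) n), (poch_S b).
  assert (E : (a + 1) * poch (a + 1 + 1) n = poch (a + 1) n * (a + 1 + INR n))
    by now rewrite <- poch_shift.
  assert (Ec : (c + 1) * poch (c + 1 + 1) n = poch (c + 1) n * (c + 1 + INR n))
    by now rewrite <- poch_shift.
  assert (Rc2 : ~ nonpos_int (c + 1 + 1))
    by (replace (c + 1 + 1) with (c + INR 2) by (simpl; rewrite RtoC_plus; ring); now apply regular_add).
  assert (N5 := poch_neq_0 (c + 1 + 1) n Rc2); assert (N6 := poch_neq_0 (c + 1 + 1) (S n) Rc2).
  match goal with |- _ = _ + (_ + ?t) => replace t with
    (- ((a + 1) * ((a + 1) * poch (a + 1 + 1) n) * poch b n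
      / (c * ((c + 1) * poch (c + 1 + 1) n) * cfact n))) by (field; repeat split; trivial) end.
  rewrite E, Ec, cfact_S.
  rewrite S_INR, RtoC_plus in *.
  unfold c in *; field; repeat split; trivial.
Qed.

Lemma step_principal a b G1 G2 : ~ nonpos_int (a + b) ->
  is_principal_2F1 (a + 1) b (a + 1 + b) G1 ->
  is_principal_2F1 (a + 1 + 1) b (a + 1 + 1 + b) G2 ->
  is_principal_2F1 a b (a + b) (step_combination a b G1 G2).
Proof.
intros Rc [A1 S1] [A2 S2]; split.
- intros x Hx; apply analytic_plus; apply analytic_affine; auto.
- intros x Hx; apply Cpseries.
  apply Cis_series_ext with (2 := Cis_series_plus _ _ _ _
    (pseries_affine _ _ _ _ _ (proj1 (Cpseries _ _ _) (S1 x Hx)))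
    (pseries_affine _ _ _ _ _ (proj1 (Cpseries _ _ _) (S2 x Hx)))).
  intros k; rewrite (step_coeff a b k Rc); ring.
Qed.

Lemma gauss_log_step a b rho : ~ nonpos_int (a + b) ->
  gauss_log a b rho = (2 * a + 1) / (a + b) * gauss_log (a + 1) b rho
    - (a + 1) * (a + 1) / ((a + b) * (a + b + 1)) * gauss_log (a + 1 + 1) b rho.
Proof.
intros Rc; unfold gauss_log.
replace (a + 1 + b) with (a + b + 1) by ring.
replace (a + 1 + 1 + b) with (a + b + 1 + 1) by ring.
set (c := a + b) in *.
assert (C0 := regular_neq_0 c Rc).
assert (C1 : c + 1 <> 0) by (replace (c + 1) with (c + INR 1) by (simpl; ring); now apply regular_add_neq_0).
assert (Rc2 : ~ nonpos_int (c + 1 + 1))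
  by (replace (c + 1 + 1) with (c + INR 2) by (simpl; rewrite RtoC_plus; ring); now apply regular_add).
assert (N := rGamma_neq_0 _ Rc2).
rewrite (rGamma_succ c), (rGamma_succ (c + 1)).
rewrite (drGamma_succ a), (drGamma_succ (a + 1)).
rewrite (rGamma_succ a), (rGamma_succ (a + 1)).
field; repeat split; trivial.
Qed.

Lemma gauss_log_small a b : tends slit (fun rho => rho * gauss_log a b rho) 0.
Proof.
set (u := - / rGamma (a + b)); set (v := rGamma a * rGamma b).
set (w := drGamma a * rGamma b + rGamma a * drGamma b).
apply (tends_ext slit (fun rho => u * v * (rho * Clog rho) + u * (2 * euler_gamma * v - w) * rho)).
- apply filter_forall; intros rho; unfold gauss_log; fold u v w; ring.
- replace (RtoC 0) with (u * v * 0 + u * (2 * euler_gamma * v - w) * 0) by ring.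
  apply (tends_plus slit); apply (tends_mult slit); try apply (tends_const slit);
    [apply slit_log | apply slit_id].
Qed.

Lemma log_form_step a b : ~ nonpos_int (a + b) ->
  has_log_form (a + 1) b -> has_log_form (a + 1 + 1) b -> has_log_form a b.
Proof.
intros Rc [G1 [P1 T1]] [G2 [P2 T2]].
exists (step_combination a b G1 G2); split; [now apply step_principal |].
assert (C0 := regular_neq_0 _ Rc).
assert (C1 : a + b + 1 <> 0)
  by (replace (a + b + 1) with (a + b + INR 1) by (simpl; ring); now apply regular_add_neq_0).
set (be := (a + 1 - b) / (a + b)).
set (ga := - ((a + 1) * (a + 1) / ((a + b) * (a + b + 1)))).
assert (X : tends slit (fun rho => 1 - rho) (1 - 0))
  by (apply (tends_minus slit); [apply (tends_const slit) | apply slit_id]).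
apply (tends_ext slit (fun rho =>
  (1 + be * (1 - rho)) * (G1 (1 - rho) - gauss_log (a + 1) b rho)
  + ga * (1 - rho) * (G2 (1 - rho) - gauss_log (a + 1 + 1) b rho)
  + (- be * (rho * gauss_log (a + 1) b rho) + - ga * (rho * gauss_log (a + 1 + 1) b rho)))).
- apply filter_forall; intros rho; unfold step_combination; rewrite (gauss_log_step a b rho Rc).
  replace ((2 * a + 1) / (a + b)) with (1 + be) by (unfold be; field; exact C0).
  fold be; fold ga; unfold Cminus at 7.
  replace (- ((a + 1) * (a + 1) / ((a + b) * (a + b + 1)) * gauss_log (a + 1 + 1) b rho))
    with (ga * gauss_log (a + 1 + 1) b rho) by (unfold ga; ring).
  replace ((1 + be) * gauss_log (a + 1) b rho -
    (a + 1) * (a + 1) / ((a + b) * (a + b + 1)) * gauss_log (a + 1 + 1) b rho)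
    with ((1 + be) * gauss_log (a + 1) b rho + ga * gauss_log (a + 1 + 1) b rho) by (unfold ga; ring).
  ring.
- replace (RtoC 0) with ((1 + be * (1 - 0)) * 0 + ga * (1 - 0) * 0 + (- be * 0 + - ga * 0)) by ring.
  repeat first [exact T1 | exact T2 | exact X | apply gauss_log_small | apply (tends_const slit)
    | apply (tends_plus slit) | apply (tends_mult slit)].
Qed.

Lemma log_form_sym a b : has_log_form a b -> has_log_form b a.
Proof.
intros [G [[A S] T]]; exists G; rewrite (Cplus_comm b a); split; [split; [exact A |] |].
- intros x Hx; apply Cpseries; apply Cis_series_ext with (2 := proj1 (Cpseries _ _ _) (S x Hx)).
  intros k; unfold gauss_coeff; now rewrite (Cmult_comm (poch a k)).
- apply (tends_ext slit (fun rho => G (1 - rho) - gauss_log a b rho)); [| exact T].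
  apply filter_forall; intros rho; unfold gauss_log; rewrite (Cplus_comm b a); ring.
Qed.

Lemma log_form_down k : forall a b, ~ nonpos_int (a + b) ->
  (forall j, (k <= j)%nat -> has_log_form (a + INR j) b) -> has_log_form a b.
Proof.
induction k as [|k IH]; intros a b Rc H.
- generalize (H 0%nat (le_n 0)); simpl; now rewrite Cplus_0_r.
- assert (Sh : forall i, ~ nonpos_int (a + INR i + b)).
  { intros i; replace (a + INR i + b) with (a + b + INR i) by ring; now apply regular_add. }
  assert (H1 : forall i, (1 <= i)%nat -> has_log_form (a + INR i) b).
  { intros i Hi; apply IH; [apply Sh |]; intros j Hj.
    replace (a + INR i + INR j) with (a + INR (i + j)) by (rewrite plus_INR, RtoC_plus; ring).
    apply H; lia. }
  apply log_form_step; trivial.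
  + generalize (H1 1%nat (le_n 1)); now simpl.
  + generalize (H1 2%nat ltac:(lia)); simpl (INR 2).
    now replace (a + (1 + 1)%R) with (a + 1 + 1) by (rewrite RtoC_plus; ring).
Qed.

(** Both parameters may be lowered by integers, so the case of large real parts
    is enough. *)
Lemma log_form_all a b : ~ nonpos_int (a + b) -> has_log_form a b.
Proof.
assert (Big : forall a b, (3 <= Re a)%R -> ~ nonpos_int (a + b) -> has_log_form a b).
{ clear a b; intros a b Ha Rc; apply log_form_sym.
  destruct (INR_unbounded (Re a + 3 - Re b)) as [k Hk].
  apply (log_form_down k); [now rewrite Cplus_comm |].
  intros j Hj; apply log_form_sym, large_log_form; trivial.
  apply le_INR in Hj; destruct a, b; simpl in *; lra. }
intros Rc; destruct (INR_unbounded (3 - Re a)) as [k Hk].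
apply (log_form_down k); trivial.
intros j Hj; apply Big.
- apply le_INR in Hj; destruct a; simpl in *; lra.
- replace (a + INR j + b) with (a + b + INR j) by ring; now apply regular_add.
Qed.

Lemma hyp2F1_is_principal a b : ~ nonpos_int (a + b) ->
  is_principal_2F1 a b (a + b) (hyp2F1 a b (a + b)).
Proof. intros Rc; destruct (log_form_all a b Rc) as [G [P _]]; now apply hyp2F1_principal with G. Qed.

Lemma hyp2F1_log a b : ~ nonpos_int (a + b) ->
  tends slit (fun rho => hyp2F1 a b (a + b) (1 - rho) - gauss_log a b rho) 0.
Proof.
intros Rc; destruct (log_form_all a b Rc) as [G [P T]].
apply (tends_ext slit (fun rho => G (1 - rho) - gauss_log a b rho)); [| exact T].
generalize (slit_small 1 Rlt_0_1); apply filter_imp; intros rho [_ [_ Hc]].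
now rewrite (is_principal_unique a b (a + b) G _ P (hyp2F1_is_principal a b Rc) _ Hc).
Qed.

Lemma hyp2F1_step a b x : ~ nonpos_int (a + b) -> ~ in_cut x ->
  hyp2F1 a b (a + b) x = step_combination a b (hyp2F1 (a + 1) b (a + 1 + b))
    (hyp2F1 (a + 1 + 1) b (a + 1 + 1 + b)) x.
Proof.
intros Rc Hx; apply (is_principal_unique a b (a + b)); trivial; [now apply hyp2F1_is_principal |].
apply step_principal; trivial; apply hyp2F1_is_principal.
- replace (a + 1 + b) with (a + b + INR 1) by (simpl; ring); now apply regular_add.
- replace (a + 1 + 1 + b) with (a + b + INR 2) by (simpl; rewrite RtoC_plus; ring).
  now apply regular_add.
Qed.

(** * Summation over the second variable *)

Definition row (a b : C) (n : nat) (rho : C) : C :=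
  poch a n / poch (a + b) n * hyp2F1 (a + INR n) b (a + INR n + b) (1 - rho).

Definition row_log (a b : C) (n : nat) (rho : C) : C :=
  poch a n / poch (a + b) n * gauss_log (a + INR n) b rho.

Lemma INR_S_C n : RtoC (INR (S n)) = INR n + 1.
Proof. now rewrite S_INR, RtoC_plus. Qed.

Lemma regular_add_mid a b n : ~ nonpos_int (a + b) -> ~ nonpos_int (a + INR n + b).
Proof. replace (a + INR n + b) with (a + b + INR n) by ring; apply regular_add. Qed.

Lemma row_factor_S a b n : ~ nonpos_int (a + b) ->
  poch a (S n) / poch (a + b) (S n)
  = poch a n / poch (a + b) n * ((a + INR n) / (a + b + INR n)).
Proof.
intros Rc; rewrite !poch_S; field; split; [now apply regular_add_neq_0 | now apply poch_neq_0].
Qed.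

Lemma row_rec a b n rho : ~ nonpos_int (a + b) -> ~ in_cut (1 - rho) ->
  (a + INR n) * row a b n rho
  = ((a + INR n) * (2 - rho) + 1 - rho + rho * b) * row a b (S n) rho
    - (1 - rho) * (a + INR n + 1) * row a b (S (S n)) rho.
Proof.
intros Rc Hx; unfold row; rewrite (hyp2F1_step _ _ _ (regular_add_mid a b n Rc) Hx).
rewrite !(row_factor_S a b) by exact Rc; unfold step_combination.
assert (N1 := regular_add_neq_0 (a + b) n Rc); assert (N2 := regular_add_neq_0 (a + b) (S n) Rc).
assert (N3 := poch_neq_0 (a + b) n Rc).
rewrite !INR_S_C in *; rewrite !Cplus_assoc in *.
replace (a + INR n + b) with (a + b + INR n) by ring.
field; repeat split; trivial.
Qed.

Lemma row_log_rec a b n rho : ~ nonpos_int (a + b) ->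
  (a + INR n) * row_log a b n rho
  = (2 * (a + INR n) + 1) * row_log a b (S n) rho
    - (a + INR n + 1) * row_log a b (S (S n)) rho.
Proof.
intros Rc; unfold row_log; rewrite (gauss_log_step _ _ rho (regular_add_mid a b n Rc)).
rewrite !(row_factor_S a b) by exact Rc.
assert (N1 := regular_add_neq_0 (a + b) n Rc); assert (N2 := regular_add_neq_0 (a + b) (S n) Rc).
assert (N3 := poch_neq_0 (a + b) n Rc).
rewrite !INR_S_C in *; rewrite !Cplus_assoc in *.
replace (a + INR n + b) with (a + b + INR n) by ring.
field; repeat split; trivial.
Qed.

Lemma linear_growth (V : nat -> R) (N : nat) (Q : R) : (1 <= Q)%R ->
  (forall n, 0 <= V n)%R ->
  (forall n, (N <= n)%nat -> (V (S (S n)) <= Q * (V (S n) + V n))%R) ->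
  forall n, (V n <= sum_n V (S N) * (2 * Q) ^ n)%R.
Proof.
intros HQ HV H.
assert (Part : forall k n, (k <= n)%nat -> (V k <= sum_n V n)%R).
{ intros k n Hk; induction Hk as [|n Hk IH].
  - destruct k as [|k]; [rewrite sum_O; lra |].
    rewrite sum_Sn; unfold plus; simpl.
    assert (0 <= sum_n V k)%R; [| lra].
    induction k as [|k IH]; [now rewrite sum_O |].
    rewrite sum_Sn; unfold plus; simpl; generalize (HV (S k)); lra.
  - rewrite sum_Sn; unfold plus; simpl; generalize (HV (S n)); lra. }
set (W := sum_n V (S N)) in *.
assert (W0 : (0 <= W)%R) by (apply Rle_trans with (V 0%nat); [apply HV | apply Part; lia]).
assert (P1 : forall n, (1 <= (2 * Q) ^ n)%R) by (intros; apply pow_R1_Rle; lra).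
assert (Small : forall n, (n <= S N)%nat -> (V n <= W * (2 * Q) ^ n)%R).
{ intros n Hn; apply Rle_trans with (W * 1)%R; [rewrite Rmult_1_r; now apply Part |].
  apply Rmult_le_compat_l; auto. }
assert (Big : forall k, (V (N + k)%nat <= W * (2 * Q) ^ (N + k))%R /\
  (V (S (N + k)) <= W * (2 * Q) ^ (S (N + k)))%R).
{ induction k as [|k [I1 I2]].
  - rewrite Nat.add_0_r; split; apply Small; lia.
  - rewrite Nat.add_succ_r; split; [exact I2 |].
    apply Rle_trans with (1 := H (N + k)%nat ltac:(lia)).
    set (X := ((2 * Q) ^ (N + k))%R) in *.
    assert (X1 : (1 <= X)%R) by apply P1.
    change ((2 * Q) ^ S (N + k))%R with (2 * Q * X)%R in I2.
    change ((2 * Q) ^ S (S (N + k)))%R with (2 * Q * (2 * Q * X))%R.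
    assert (V (S (N + k)) + V (N + k)%nat <= 2 * (W * (2 * Q * X)))%R.
    { assert (W * X <= W * (2 * Q * X))%R by (apply Rmult_le_compat_l; nra); lra. }
    apply Rle_trans with (Q * (2 * (W * (2 * Q * X))))%R; [apply Rmult_le_compat_l; lra |].
    right; ring. }
intros n; destruct (Nat.le_gt_cases n N); [apply Small; lia |].
replace n with (N + (n - N))%nat by lia; apply Big.
Qed.

(** The second summand measures the perturbation term of the recurrence for the
    errors; including it makes the recurrence for [row_err] homogeneous. *)
Definition row_err (a b : C) (n : nat) (rho : C) : R :=
  (Cmod (row a b n rho - row_log a b n rho) + Cmod (rho * row_log a b n rho))%R.

Lemma eventually_Re_pos (a : C) : exists N, forall n, (N <= n)%nat -> (0 <= Re (a + INR n))%R.
Proof.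
destruct (INR_unbounded (- Re a)) as [N HN]; exists N; intros n Hn; apply le_INR in Hn.
destruct a; simpl in *; lra.
Qed.

(** The contiguous recurrence satisfied by the rows is a perturbation of size
    [rho] of the one satisfied by their limiting forms, so the errors of all
    rows are controlled, with geometric growth, by those of finitely many. *)
Lemma row_err_growth a b : ~ nonpos_int (a + b) ->
  exists N Q, (1 <= Q)%R /\ forall rho, (Cmod rho <= / 2)%R -> ~ in_cut (1 - rho) ->
    forall n, (row_err a b n rho <= sum_n (fun k => row_err a b k rho) (S N) * Q ^ n)%R.
Proof.
intros Rc; destruct (eventually_Re_pos a) as [N HN].
assert (B0 := Cmod_ge_0 b).
exists N, (2 * (11 + 2 * Cmod b))%R; split; [lra |]; intros rho Hr Hx.
apply (linear_growth (fun n => row_err a b n rho)); [lra | |].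
{ intros n; apply Rplus_le_le_0_compat; apply Cmod_ge_0. }
intros n Hn; specialize (HN n Hn); unfold row_err.
set (z := a + INR n) in *.
assert (R1 := row_rec a b n rho Rc Hx); assert (R2 := row_log_rec a b n rho Rc); fold z in R1, R2.
set (t0 := row_log a b n rho) in *; set (t1 := row_log a b (S n) rho) in *;
  set (t2 := row_log a b (S (S n)) rho) in *.
set (e0 := row a b n rho - t0); set (e1 := row a b (S n) rho - t1);
  set (e2 := row a b (S (S n)) rho - t2).
replace (row a b n rho) with (e0 + t0) in R1 by (unfold e0; ring).
replace (row a b (S n) rho) with (e1 + t1) in R1 by (unfold e1; ring).
replace (row a b (S (S n)) rho) with (e2 + t2) in R1 by (unfold e2; ring).
clearbody e0 e1 e2 t0 t1 t2.
set (w := z + 1) in *.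
assert (W1 : (1 <= Cmod w)%R).
{ apply Rle_trans with (2 := re_le_Cmod _), Rle_trans with (2 := Rle_abs _).
  unfold w; destruct z; simpl in *; lra. }
assert (Zw : z = w - 1) by (unfold w; ring).
assert (Cz : (Cmod z <= 2 * Cmod w)%R).
{ rewrite Zw; triangle; rewrite Cmod_opp, Cmod_1; lra. }
assert (C2z : (Cmod (2 * z + 1) <= 3 * Cmod w)%R).
{ replace (2 * z + 1) with (2 * w + - (1)) by (rewrite Zw; ring).
  triangle.
  rewrite Cmod_opp, Cmod_1, Cmod_mult, Cmod_RtoC_pos by lra; lra. }
assert (Cwb : (Cmod (w - b) <= (1 + Cmod b) * Cmod w)%R).
{ triangle; rewrite Cmod_opp; nra. }
assert (Cx : (/ 2 <= Cmod (1 - rho))%R).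
{ assert (Cmod 1 <= Cmod (1 - rho) + Cmod rho)%R; [| rewrite Cmod_1 in *; lra].
  replace (RtoC 1) with (1 - rho + rho) at 1 by ring; apply Cmod_triangle. }
assert (E0 := Cmod_ge_0 e0); assert (E1 := Cmod_ge_0 e1); assert (E2 := Cmod_ge_0 e2).
assert (T0 := Cmod_ge_0 t0); assert (T1 := Cmod_ge_0 t1); assert (T2 := Cmod_ge_0 t2).
assert (P0 := Cmod_ge_0 rho).
assert (Bt : (Cmod t2 <= 3 * Cmod t1 + 2 * Cmod t0)%R).
{ apply Rmult_le_reg_l with (Cmod w); [lra |]; rewrite <- Cmod_mult.
  replace (w * t2) with ((2 * z + 1) * t1 + - (z * t0)) by (rewrite R2; ring).
  triangle; rewrite Cmod_opp, !Cmod_mult.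
  assert (Cmod (2 * z + 1) * Cmod t1 <= 3 * Cmod w * Cmod t1)%R by now apply Rmult_le_compat_r.
  assert (Cmod z * Cmod t0 <= 2 * Cmod w * Cmod t0)%R by now apply Rmult_le_compat_r.
  lra. }
assert (Be : (Cmod e2 <= 2 * ((4 + Cmod b) * Cmod e1 + 2 * Cmod e0
  + (1 + Cmod b) * (Cmod rho * Cmod t1) + Cmod rho * Cmod t2))%R).
{ assert (Eq : (1 - rho) * w * e2 = (2 * z + 1) * e1 + (- (rho * (w - b) * e1) + (- (z * e0)
    + (- (rho * (w - b) * t1) + rho * w * t2)))).
  { replace ((1 - rho) * w * e2) with (((1 - rho) * w * (e2 + t2)) - (1 - rho) * w * t2) by ring.
    replace ((1 - rho) * w * (e2 + t2)) with
      ((z * (2 - rho) + 1 - rho + rho * b) * (e1 + t1) - z * (e0 + t0)) by (rewrite R1; ring).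
    replace (z * (e0 + t0)) with (z * e0 + z * t0) by ring; rewrite R2, Zw; ring. }
  apply Rmult_le_reg_l with (Cmod w); [lra |].
  apply Rle_trans with (2 * Cmod ((1 - rho) * w * e2))%R.
  { rewrite !Cmod_mult.
    assert (0 <= Cmod w * Cmod e2)%R by (apply Rmult_le_pos; lra).
    assert (/ 2 * (Cmod w * Cmod e2) <= Cmod (1 - rho) * (Cmod w * Cmod e2))%R
      by (apply Rmult_le_compat_r; lra).
    lra. }
  rewrite Eq.
  assert (A1 : (Cmod ((2 * z + 1) * e1) <= 3 * (Cmod w * Cmod e1))%R).
  { rewrite Cmod_mult, <- Rmult_assoc; now apply Rmult_le_compat_r. }
  assert (A2 : (Cmod (rho * (w - b) * e1) <= / 2 * (1 + Cmod b) * (Cmod w * Cmod e1))%R).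
  { rewrite !Cmod_mult.
    replace (/ 2 * (1 + Cmod b) * (Cmod w * Cmod e1))%R
      with (/ 2 * ((1 + Cmod b) * Cmod w) * Cmod e1)%R by ring.
    apply Rmult_le_compat_r; trivial; apply Rmult_le_compat; trivial; apply Cmod_ge_0. }
  assert (A3 : (Cmod (z * e0) <= 2 * (Cmod w * Cmod e0))%R).
  { rewrite Cmod_mult, <- Rmult_assoc; now apply Rmult_le_compat_r. }
  assert (A4 : (Cmod (rho * (w - b) * t1) <= (1 + Cmod b) * (Cmod w * (Cmod rho * Cmod t1)))%R).
  { rewrite !Cmod_mult.
    replace ((1 + Cmod b) * (Cmod w * (Cmod rho * Cmod t1)))%R
      with (Cmod rho * ((1 + Cmod b) * Cmod w) * Cmod t1)%R by ring.
    apply Rmult_le_compat_r; trivial; now apply Rmult_le_compat_l. }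
  assert (A5 : Cmod (rho * w * t2) = (Cmod w * (Cmod rho * Cmod t2))%R)
    by (rewrite !Cmod_mult; ring).
  assert (Tri : (Cmod ((2 * z + 1) * e1 + (- (rho * (w - b) * e1) + (- (z * e0)
    + (- (rho * (w - b) * t1) + rho * w * t2)))) <= Cmod ((2 * z + 1) * e1)
    + (Cmod (rho * (w - b) * e1) + (Cmod (z * e0)
    + (Cmod (rho * (w - b) * t1) + Cmod (rho * w * t2)))))%R).
  { rewrite <- (Cmod_opp (rho * (w - b) * e1)), <- (Cmod_opp (z * e0)),
      <- (Cmod_opp (rho * (w - b) * t1)).
    repeat (triangle; apply Rplus_le_compat_l).
    lra. }
  assert (0 <= Cmod w * Cmod e1)%R by nra.
  assert (0 <= Cmod b * (Cmod w * Cmod e1))%R by (apply Rmult_le_pos; lra).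
  lra. }
rewrite !Cmod_mult.
assert (Q1 : (0 <= Cmod rho * Cmod t0 /\ 0 <= Cmod rho * Cmod t1)%R) by (split; nra).
assert (Bt' : (Cmod rho * Cmod t2 <= 3 * (Cmod rho * Cmod t1) + 2 * (Cmod rho * Cmod t0))%R).
{ apply Rle_trans with (Cmod rho * (3 * Cmod t1 + 2 * Cmod t0))%R;
    [now apply Rmult_le_compat_l | right; ring]. }
assert (0 <= Cmod b * Cmod e1 /\ 0 <= Cmod b * Cmod e0)%R by (split; nra).
assert (0 <= Cmod b * (Cmod rho * Cmod t1) /\ 0 <= Cmod b * (Cmod rho * Cmod t0))%R by (split; nra).
lra.
Qed.

Lemma row_err_lim a b n : ~ nonpos_int (a + b) ->
  tends slit (fun rho => RtoC (row_err a b n rho)) 0.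
Proof.
intros Rc.
set (k := poch a n / poch (a + b) n).
assert (Rn := regular_add_mid a b n Rc).
apply (tends_ext slit (fun rho => RtoC (Cmod (k * (hyp2F1 (a + INR n) b (a + INR n + b) (1 - rho)
    - gauss_log (a + INR n) b rho))) + RtoC (Cmod (k * (rho * gauss_log (a + INR n) b rho))))).
- apply filter_forall; intros rho; unfold row_err, row, row_log; fold k.
  rewrite RtoC_plus; f_equal; f_equal; f_equal; ring.
- replace (RtoC 0) with (0 + 0) by ring.
  apply (tends_plus slit); apply (tends_Cmod slit); replace (RtoC 0) with (k * 0) by ring;
    apply (tends_mult slit); try apply (tends_const slit).
  + now apply hyp2F1_log.
  + apply gauss_log_small.
Qed.

Lemma exp_type_term (u y : C) (W Q : R) n :
  (Cmod u <= W * Q ^ n)%R ->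
  (Cmod (u * (y ^ n / cfact n)) <= W * ((Q * Cmod y) ^ n / INR (fact n)))%R.
Proof.
intros H; rewrite Cmod_mult, Cmod_div, Cmod_pow, Cmod_cfact by apply cfact_neq_0.
rewrite Rpow_mult_distr.
replace (W * (Q ^ n * Cmod y ^ n / INR (fact n)))%R with (W * Q ^ n * (Cmod y ^ n / INR (fact n)))%R
  by (unfold Rdiv; ring).
apply Rmult_le_compat_r; [| exact H].
apply Rmult_le_pos; [apply pow_le, Cmod_ge_0 | left; apply Rinv_0_lt_compat, INR_fact_lt_0].
Qed.

Lemma exp_type_majorant (y : C) (W Q : R) :
  is_series (fun n => W * ((Q * Cmod y) ^ n / INR (fact n)))%R (W * exp (Q * Cmod y))%R.
Proof. apply (is_series_scal (V := R_NormedModule) W), pow_fact_series. Qed.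

Lemma exp_type_summable (u : nat -> C) (y : C) (W Q : R) :
  (forall n, (Cmod (u n) <= W * Q ^ n)%R) -> summable (fun n => u n * (y ^ n / cfact n)).
Proof.
intros H; apply summable_le with (fun n => W * ((Q * Cmod y) ^ n / INR (fact n)))%R.
- intros n; now apply exp_type_term.
- eexists; apply exp_type_majorant.
Qed.

Lemma exp_type_bound (u : nat -> C) (y : C) (W Q : R) :
  (forall n, (Cmod (u n) <= W * Q ^ n)%R) ->
  (Cmod (CSeries (fun n => u n * (y ^ n / cfact n))%C) <= W * exp (Q * Cmod y))%R.
Proof.
intros H; rewrite <- (is_series_unique _ _ (exp_type_majorant y W Q)).
apply Cmod_CSeries_le; [intros n; now apply exp_type_term | eexists; apply exp_type_majorant].
Qed.

(** Inside the unit disc [Phi1] is the double series, outside it the series of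
    continued functions; off the cut both are the sum of the rows. *)
Lemma Phi1_rows a b y rho : ~ nonpos_int (a + b) -> ~ in_cut (1 - rho) ->
  Phi1 a b (a + b) (1 - rho) y = CSeries (fun n => row a b n rho * (y ^ n / cfact n)).
Proof.
intros Rc Hx; unfold Phi1; destruct (Rlt_dec (Cmod (1 - rho)) 1) as [H | _].
- apply CSeries_ext; intros n; apply CSeries_unique.
  destruct (hyp2F1_is_principal (a + INR n) b (regular_add_mid a b n Rc)) as [_ P].
  specialize (P _ H); apply Cpseries in P; unfold row.
  assert (X := Cis_series_scal (poch a n / poch (a + b) n * (y ^ n / cfact n)) _ _ P).
  replace (poch a n / poch (a + b) n * hyp2F1 (a + INR n) b (a + INR n + b) (1 - rho) * (y ^ n / cfact n))
    with (poch a n / poch (a + b) n * (y ^ n / cfact n) * hyp2F1 (a + INR n) b (a + INR n + b) (1 - rho))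
    by ring.
  apply Cis_series_ext with (2 := X); intros m; unfold gauss_coeff.
  rewrite !poch_add; replace (a + INR n + b) with (a + b + INR n) by ring.
  assert (N1 := poch_neq_0 (a + b) n Rc).
  assert (N2 := poch_neq_0 (a + b + INR n) m (regular_add _ n Rc)).
  assert (N3 := cfact_neq_0 n); assert (N4 := cfact_neq_0 m).
  field; repeat split; trivial.
- apply CSeries_ext; intros n; unfold row.
  now replace (a + INR n + b) with (a + b + INR n) by ring.
Qed.

(** The factor [1 / n!] absorbs the geometric growth of the errors. *)
Lemma Phi1_asymptotics a b y : ~ nonpos_int (a + b) ->
  tends slit (fun rho => Phi1 a b (a + b) (1 - rho) y
    - CSeries (fun n => row_log a b n rho * (y ^ n / cfact n))) 0.
Proof.
intros Rc; destruct (row_err_growth a b Rc) as [N [Q [HQ G]]].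
set (W := fun rho => sum_n (fun k => row_err a b k rho) (S N)).
apply (tends_squeeze slit _ (fun rho => RtoC (W rho) * RtoC (exp (Q * Cmod y)))).
- generalize (slit_small (/ 2) ltac:(lra)); apply filter_imp; intros rho [Hr [Hn Hx]].
  assert (Gr := G rho ltac:(lra) Hx); fold (W rho) in Gr.
  assert (Pr := proj1 (Cmod_gt_0 rho) Hn).
  assert (Be : forall n, (Cmod (row a b n rho - row_log a b n rho) <= W rho * Q ^ n)%R).
  { intros n; apply Rle_trans with (2 := Gr n); unfold row_err.
    generalize (Cmod_ge_0 (rho * row_log a b n rho)); lra. }
  assert (Bt : forall n, (Cmod (row_log a b n rho) <= W rho / Cmod rho * Q ^ n)%R).
  { intros n; apply Rmult_le_reg_l with (Cmod rho); trivial.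
    replace (Cmod rho * (W rho / Cmod rho * Q ^ n))%R with (W rho * Q ^ n)%R by (field; lra).
    rewrite <- Cmod_mult; apply Rle_trans with (2 := Gr n); unfold row_err.
    generalize (Cmod_ge_0 (row a b n rho - row_log a b n rho)); lra. }
  assert (Se := exp_type_summable _ y _ Q Be).
  assert (St := exp_type_summable _ y _ Q Bt).
  rewrite (Phi1_rows a b y rho Rc Hx).
  rewrite (CSeries_ext (fun n => row a b n rho * (y ^ n / cfact n)) (fun n =>
    (row a b n rho - row_log a b n rho) * (y ^ n / cfact n) + row_log a b n rho * (y ^ n / cfact n)))
    by (intros; ring).
  rewrite (CSeries_unique _ _ (Cis_series_plus _ _ _ _ (CSeries_is_series _ Se) (CSeries_is_series _ St))).
  set (q := CSeries (fun n => row_log a b n rho * (y ^ n / cfact n))).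
  set (p := CSeries (fun n => (row a b n rho - row_log a b n rho) * (y ^ n / cfact n))).
  replace (p + q - q - 0) with p by ring; unfold p.
  rewrite <- RtoC_mult.
  apply Rle_trans with (1 := exp_type_bound _ y _ Q Be).
  rewrite Cmod_R; apply Rle_abs.
- replace (RtoC 0) with (0 * RtoC (exp (Q * Cmod y))) by ring.
  apply (tends_mult slit); [| apply (tends_const slit)].
  unfold W; generalize (S N); clear - Rc; intros m; induction m as [|m IH].
  + apply (tends_ext slit (fun rho => RtoC (row_err a b 0 rho))); [| now apply row_err_lim].
    apply filter_forall; intros rho; now rewrite sum_O.
  + apply (tends_ext slit (fun rho => RtoC (sum_n (fun k => row_err a b k rho) m)
      + RtoC (row_err a b (S m) rho))).
    * apply filter_forall; intros rho; rewrite sum_Sn; now rewrite <- RtoC_plus.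
    * replace (RtoC 0) with (0 + 0) by ring; apply (tends_plus slit); [exact IH | now apply row_err_lim].
Qed.

(** * The closed form of the main term *)

(** For regular [a] this is [- psi (a + n) / Gamma a]; unlike that quotient it makes
    sense at the poles of [psi]. *)
Definition dpoch (a : C) (n : nat) : C := poch a n * drGamma (a + INR n).

Definition dpoch_series (a y : C) : C := CSeries (fun n => dpoch a n * (y ^ n / cfact n)).

Definition main_term (a b y rho : C) : C :=
  - / rGamma (a + b) * (Cexp y * ((2 * euler_gamma + Clog rho) * (rGamma a * rGamma b)
    - rGamma a * drGamma b) - rGamma b * dpoch_series a y).

Lemma row_log_eq a b n rho : ~ nonpos_int (a + b) ->
  row_log a b n rho = - / rGamma (a + b) *
    (((2 * euler_gamma + Clog rho) * (rGamma a * rGamma b) - rGamma a * drGamma b)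
     + - rGamma b * dpoch a n).
Proof.
intros Rc; unfold row_log, gauss_log, dpoch.
assert (N1 := rGamma_neq_0 _ (regular_add _ n Rc)); assert (N2 := poch_neq_0 _ n Rc).
rewrite (rGamma_poch (a + b) n), (rGamma_poch a n).
replace (a + INR n + b) with (a + b + INR n) by ring.
field; now split.
Qed.

Lemma dpoch_S a n : dpoch a (S n) = dpoch a n - poch a n * rGamma (a + INR n + 1).
Proof.
unfold dpoch; rewrite poch_S, INR_S_C, Cplus_assoc, (drGamma_succ (a + INR n)); ring.
Qed.

Lemma tends_comp {T} (F : (T -> Prop) -> Prop) {FF : Filter F} (f : T -> C) (g : C -> C) (l m : C) :
  tends F f l -> tends (locally l) g m -> tends F (fun x => g (f x)) m.
Proof.
intros Hf Hg; apply (tends_filterlim F) in Hf.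
intros eps He; exact (Hf _ (Hg eps He)).
Qed.

Lemma tends_locally_id (z : C) : tends (locally z) (fun w : C => w) z.
Proof. apply (tends_filterlim (locally z)); intros P HP; exact HP. Qed.

Lemma dpoch_continuous n (a0 : C) : tends (locally a0) (fun a => dpoch a n) (dpoch a0 n).
Proof.
assert (Sh : forall k : nat, tends (locally a0) (fun a : C => a + INR k) (a0 + INR k)).
{ intros k; apply (tends_plus (locally a0)); [apply tends_locally_id | apply (tends_const (locally a0))]. }
apply (tends_mult (locally a0)).
- induction n as [|n IH]; [apply (tends_const (locally a0) 1) |].
  apply (tends_mult (locally a0)); [exact IH | apply Sh].
- apply (tends_comp (locally a0) (fun a : C => a + INR n) drGamma (a0 + INR n));
    [apply Sh | apply drGamma_continuous].
Qed.

Lemma tends_bounded {T} (F : (T -> Prop) -> Prop) {FF : Filter F} (f : T -> C) (l : C) :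
  tends F f l -> F (fun x => (Cmod (f x) <= Cmod l + 1)%R).
Proof.
intros H; generalize (H 1%R Rlt_0_1); apply filter_imp; intros x Hx.
replace (f x) with (l + (f x - l)) by ring; triangle; lra.
Qed.

Lemma INR_le_pow2 n : (INR n <= 2 ^ n)%R.
Proof.
induction n as [|n IH]; [simpl; lra |].
rewrite S_INR; simpl; assert (1 <= 2 ^ n)%R by (apply pow_R1_Rle; lra); lra.
Qed.

(** Locally uniform bound, valid also around the poles of [psi]: past finitely
    many indices the increments are [rGamma a / (a + k)]. *)
Lemma dpoch_bound (a0 : C) :
  exists M, locally a0 (fun a => forall n, (Cmod (dpoch a n) <= M * 2 ^ n)%R).
Proof.
(* The shift by [2] leaves [Re (a + k) >= 1] for all [a] with [|a - a0| < 1]. *)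
destruct (eventually_Re_pos (a0 - 2)) as [N HN].
assert (Fin : exists M0, (0 <= M0)%R /\
  locally a0 (fun a => forall n, (n <= N)%nat -> (Cmod (dpoch a n) <= M0)%R)).
{ clear HN; induction N as [|N [M0 [P0 HM]]].
  - exists (Cmod (dpoch a0 0) + 1)%R; split; [generalize (Cmod_ge_0 (dpoch a0 0)); lra |].
    generalize (tends_bounded _ _ _ (dpoch_continuous 0 a0)); apply filter_imp.
    intros a Ha n Hn; now replace n with 0%nat by lia.
  - exists (M0 + (Cmod (dpoch a0 (S N)) + 1))%R.
    split; [generalize (Cmod_ge_0 (dpoch a0 (S N))); lra |].
    generalize (filter_and _ _ HM (tends_bounded _ _ _ (dpoch_continuous (S N) a0))).
    apply filter_imp; intros a [A1 A2] n Hn.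
    destruct (Nat.eq_dec n (S N)) as [-> | Hne]; [lra |].
    generalize (A1 n ltac:(lia)) (Cmod_ge_0 (dpoch a0 (S N))); lra. }
destruct Fin as [M0 [P0 HM0]].
set (M1 := (Cmod (rGamma a0) + 1)%R).
assert (P1 : (0 <= M1)%R) by (unfold M1; generalize (Cmod_ge_0 (rGamma a0)); lra).
exists (M0 + M1)%R.
generalize (filter_and _ _ HM0 (filter_and _ _ (tends_bounded _ _ _ (rGamma_continuous a0))
  (tends_locally_id a0 1%R Rlt_0_1))).
apply filter_imp; intros a [A0 [A1 A2]]; fold M1 in A1.
assert (B : forall n, (Cmod (dpoch a n) <= M0 + M1 * INR n)%R).
{ induction n as [|n IH]; [simpl; generalize (A0 0%nat ltac:(lia)); lra |].
  destruct (Nat.le_gt_cases (S n) N) as [Hn | Hn].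
  - generalize (A0 (S n) Hn) (pos_INR (S n)); nra.
  - rewrite dpoch_S, S_INR; specialize (HN n ltac:(lia)).
    triangle; rewrite Cmod_opp.
    cut (Cmod (poch a n * rGamma (a + INR n + 1)) <= M1)%R; [lra |].
    assert (G : (a + INR n) * (poch a n * rGamma (a + INR n + 1)) = rGamma a).
    { rewrite (rGamma_poch a (S n)), poch_S, INR_S_C, Cplus_assoc; ring. }
    assert (L : (1 <= Cmod (a + INR n))%R).
    { apply Rle_trans with (2 := re_le_Cmod _), Rle_trans with (2 := Rle_abs _).
      generalize (re_le_Cmod (a - a0)) (Rle_abs (Re (- (a - a0)))).
      assert (R1 : Rabs (Re (- (a - a0))) = Rabs (Re (a - a0))).
      { rewrite <- Rabs_Ropp; f_equal; destruct a, a0; simpl; ring. }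
      rewrite R1; destruct a, a0; simpl in *; lra. }
    apply Rle_trans with (2 := A1); rewrite <- G, (Cmod_mult (a + INR n)).
    generalize (Cmod_ge_0 (poch a n * rGamma (a + INR n + 1))); nra. }
intros n; apply Rle_trans with (1 := B n).
assert (1 <= 2 ^ n)%R by (apply pow_R1_Rle; lra).
generalize (INR_le_pow2 n); nra.
Qed.

Lemma dpoch_summable a y : summable (fun n => dpoch a n * (y ^ n / cfact n)).
Proof.
destruct (dpoch_bound a) as [M HM]; apply locally_singleton in HM.
exact (exp_type_summable _ y M 2 HM).
Qed.

Lemma dpoch_series_continuous (a0 : C) y :
  tends (locally a0) (fun a => dpoch_series a y) (dpoch_series a0 y).
Proof.
destruct (dpoch_bound a0) as [M HM].
apply (tannery (locally a0)) with (fun n => M * ((2 * Cmod y) ^ n / INR (fact n)))%R.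
- eexists; apply exp_type_majorant.
- generalize HM; apply filter_imp; intros a Ha n; now apply exp_type_term.
- intros n; apply exp_type_term, (locally_singleton _ _ HM).
- intros n; apply (tends_mult (locally a0)); [apply dpoch_continuous | apply (tends_const (locally a0))].
Qed.

Lemma row_log_sum a b y rho : ~ nonpos_int (a + b) ->
  CSeries (fun n => row_log a b n rho * (y ^ n / cfact n)) = main_term a b y rho.
Proof.
intros Rc; apply CSeries_unique; unfold main_term.
set (k := (2 * euler_gamma + Clog rho) * (rGamma a * rGamma b) - rGamma a * drGamma b).
replace (- / rGamma (a + b) * (Cexp y * k - rGamma b * dpoch_series a y)) with
  (- / rGamma (a + b) * (k * Cexp y + - rGamma b * dpoch_series a y)) by ring.
apply Cis_series_ext with (2 := Cis_series_scal (- / rGamma (a + b)) _ _ (Cis_series_plus _ _ _ _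
  (Cis_series_scal k _ _ (Cexp_series y))
  (Cis_series_scal (- rGamma b) _ _ (CSeries_is_series _ (dpoch_summable a y))))).
intros n; rewrite (row_log_eq a b n rho Rc); unfold k; ring.
Qed.

Lemma inv_shift_bounded a : exists M, (0 <= M)%R /\ forall n, (Cmod (/ (a + INR n)) <= M)%R.
Proof.
destruct (eventually_Re_pos (a - 1)) as [N HN].
apply (bounded_of_tail (fun n => Cmod (/ (a + INR n))) N 1); intros n Hn.
specialize (HN n Hn).
assert (L : (1 <= Cmod (a + INR n))%R).
{ apply Rle_trans with (2 := re_le_Cmod _), Rle_trans with (2 := Rle_abs _).
  destruct a; simpl in *; lra. }
rewrite Cmod_inv by (apply Cmod_gt_0; lra).
rewrite <- Rinv_1; apply Rinv_le_contravar; lra.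
Qed.

Lemma poch_1 n : poch 1 n = cfact n.
Proof.
induction n as [|n IH]; [reflexivity |].
rewrite poch_S, IH, cfact_S, INR_S_C; ring.
Qed.

Lemma poch_2 n : poch 2 n = cfact (S n).
Proof.
rewrite <- poch_1, poch_shift; replace (1 + 1) with (RtoC 2) by (rewrite <- RtoC_plus; f_equal; lra).
ring.
Qed.

(** The general term of the double series divided by [a], which makes it symmetric
    enough for absolute convergence to be visible: the Beta factor is at most [1]. *)
Definition kampe_term (a y : C) (n m : nat) : C :=
  / (a + INR n) * beta_nk m n * (y ^ m / cfact m) * (y ^ n / cfact n).

Lemma RtoC_fact_neq_0 n : RtoC (INR (fact n)) <> 0.
Proof. apply RtoC_neq_0, INR_fact_neq_0. Qed.

Lemma kampe_term_eq a y n m : 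
  y * kampe_term a y n m = / (a + INR n) * (y ^ (m + S n) / cfact (m + S n)).
Proof.
unfold kampe_term, beta_nk, cfact; rewrite Nat.add_succ_r, Cpow_S, Cpow_add_r.
unfold Rdiv; rewrite !RtoC_mult, RtoC_inv by apply INR_fact_neq_0.
assert (H1 := RtoC_fact_neq_0 m); assert (H2 := RtoC_fact_neq_0 n).
assert (H3 := RtoC_fact_neq_0 (S (m + n))).
set (i := / (a + INR n)); field; repeat split; trivial.
Qed.

Lemma exp_terms_summable y : summable (fun n => y ^ n / cfact n).
Proof.
apply summable_ext with (fun n => 1 * (y ^ n / cfact n)); [intros; ring |].
apply (exp_type_summable _ y 1 1); intros n; rewrite Cmod_1, pow1; lra.
Qed.

Lemma kampe_term_summable a y n : summable (kampe_term a y n).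
Proof.
apply summable_ext with (fun m => (/ (a + INR n) * (y ^ n / cfact n)) * ((y ^ m / cfact m) * beta_nk m n)).
- intros m; unfold kampe_term; ring.
- apply summable_scal, (summable_weight (fun m => y ^ m / cfact m)); [apply exp_terms_summable |].
  intros m; apply beta_nk_le_1.
Qed.

Lemma kampe_rows_summable a y : summable (fun n => CSeries (kampe_term a y n)).
Proof.
destruct (inv_shift_bounded a) as [M [M0 HM]].
assert (Se := exp_terms_summable y).
set (X := Series (fun m => Cmod (y ^ m / cfact m))).
apply summable_le with (fun n => M * X * Cmod (y ^ n / cfact n))%R;
  [| now apply (ex_series_scal (V := R_NormedModule))].
intros n; apply Rle_trans with (Series (fun m => M * Cmod (y ^ n / cfact n) * Cmod (y ^ m / cfact m)))%R.
- apply Cmod_CSeries_le; [| now apply (ex_series_scal (V := R_NormedModule))].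
  intros m; unfold kampe_term; rewrite !Cmod_mult.
  assert (P := Cmod_ge_0 (y ^ n / cfact n)); assert (P' := Cmod_ge_0 (y ^ m / cfact m)).
  replace (Cmod (/ (a + INR n)) * Cmod (beta_nk m n) * Cmod (y ^ m / cfact m) * Cmod (y ^ n / cfact n))%R
    with (Cmod (/ (a + INR n)) * Cmod (beta_nk m n) * (Cmod (y ^ n / cfact n) * Cmod (y ^ m / cfact m)))%R
    by ring.
  rewrite Rmult_assoc with (r1 := M); apply Rmult_le_compat_r; [now apply Rmult_le_pos |].
  rewrite <- (Rmult_1_r M); apply Rmult_le_compat; try apply Cmod_ge_0; [apply HM | apply beta_nk_le_1].
- rewrite Series_scal_l; fold X; right; ring.
Qed.

Lemma kampe_eq a y : ~ nonpos_int a ->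
  y / a * kampe_de_feriet 1 a 1 2 (a + 1) y y = y * CSeries (fun n => CSeries (kampe_term a y n)).
Proof.
intros Ra; assert (A0 := regular_neq_0 a Ra).
assert (E : kampe_de_feriet 1 a 1 2 (a + 1) y y = a * CSeries (fun n => CSeries (kampe_term a y n))).
{ unfold kampe_de_feriet, CSeries2.
  rewrite <- CSeries_scal by apply kampe_rows_summable; apply CSeries_ext; intros n.
  rewrite <- CSeries_scal by apply kampe_term_summable; apply CSeries_ext; intros m.
  rewrite !poch_1, poch_2; unfold kampe_term.
  assert (N1 := regular_add_neq_0 a n Ra).
  assert (N2 : poch (a + 1) n <> 0).
  { apply poch_neq_0; replace (a + 1) with (a + INR 1) by (simpl; ring); now apply regular_add. }
  assert (P : a * poch (a + 1) n = poch a n * (a + INR n)) by now rewrite <- poch_shift.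
  replace (poch a n) with (a * poch (a + 1) n / (a + INR n)) by (rewrite P; field; exact N1).
  unfold beta_nk, Rdiv, cfact; rewrite !RtoC_mult, RtoC_inv by apply INR_fact_neq_0.
  assert (H1 := RtoC_fact_neq_0 m); assert (H2 := RtoC_fact_neq_0 n).
  assert (H3 := RtoC_fact_neq_0 (S (m + n))).
  field; repeat split; trivial. }
rewrite E; field; exact A0.
Qed.

Definition harmonic (a : C) (n : nat) : C :=
  match n with O => 0 | S m => sum_n (fun k => / (a + INR k)) m end.

Lemma dpoch_harmonic a n : ~ nonpos_int a -> dpoch a n = drGamma a - rGamma a * harmonic a n.
Proof.
intros Ra; induction n as [|n IH]; [unfold dpoch; simpl; rewrite Cplus_0_r; ring |].
rewrite dpoch_S, IH.
assert (N := regular_add_neq_0 a n Ra).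
assert (G : poch a n * rGamma (a + INR n + 1) = rGamma a * / (a + INR n)).
{ rewrite (rGamma_poch a (S n)), poch_S, INR_S_C, Cplus_assoc; field; exact N. }
rewrite G; destruct n as [|n]; unfold harmonic; [rewrite Csum_O | rewrite Csum_Sn]; ring.
Qed.

(** Exchanging the order of summation in [sum_n y^n / n! sum_(k < n) 1 / (a + k)]
    produces the double series of the statement. *)
Lemma harmonic_series a y :
  Cis_series (fun n => harmonic a n * (y ^ n / cfact n))
    (y * CSeries (fun n => CSeries (kampe_term a y n))).
Proof.
destruct (inv_shift_bounded a) as [M [M0 HM]].
set (f := fun k n => if Nat.ltb n (S k) then RtoC 0 else / (a + INR k) * (y ^ n / cfact n)).
assert (Row : forall k, Cis_series (f k) (y * CSeries (kampe_term a y k))).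
{ intros k.
  assert (X := Cis_series_shift _ _ (S k) (Cis_series_scal y _ _
    (CSeries_is_series _ (kampe_term_summable a y k)))).
  apply Cis_series_ext with (2 := X); intros n; unfold f.
  destruct (Nat.ltb n (S k)) eqn:L; trivial.
  apply Nat.ltb_ge in L; rewrite kampe_term_eq; now replace (n - S k + S k)%nat with n by lia. }
(* Since [f k n] vanishes unless [k < n], a factor [2 ^ (n - k)] may be inserted, which
   separates the variables. *)
assert (Bd : forall k n, (Cmod (f k n) <= M * (/ 2) ^ k * ((2 * Cmod y) ^ n / INR (fact n)))%R).
{ intros k n; unfold f; destruct (Nat.ltb n (S k)) eqn:L.
  - rewrite Cmod_0; repeat apply Rmult_le_pos; trivial; [apply pow_le; lra | |].
    + apply pow_le; generalize (Cmod_ge_0 y); lra.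
    + left; apply Rinv_0_lt_compat, INR_fact_lt_0.
  - apply Nat.ltb_ge in L.
    rewrite Cmod_mult, Cmod_div, Cmod_pow, Cmod_cfact, Rpow_mult_distr by apply cfact_neq_0.
    assert (P : (0 <= Cmod y ^ n / INR (fact n))%R)
      by (apply Rmult_le_pos; [apply pow_le, Cmod_ge_0 | left; apply Rinv_0_lt_compat, INR_fact_lt_0]).
    replace (M * (/ 2) ^ k * (2 ^ n * Cmod y ^ n / INR (fact n)))%R with
      (M * ((/ 2) ^ k * 2 ^ n) * (Cmod y ^ n / INR (fact n)))%R by (unfold Rdiv; ring).
    apply Rmult_le_compat_r; [exact P |].
    apply Rle_trans with (1 := HM k); rewrite <- (Rmult_1_r M) at 1; apply Rmult_le_compat_l; trivial.
    replace n with (k + (n - k))%nat by lia; rewrite pow_add, <- Rmult_assoc, <- Rpow_mult_distr.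
    rewrite Rinv_l, pow1, Rmult_1_l by lra; apply pow_R1_Rle; lra. }
assert (HA : ex_series (fun k => M * (/ 2) ^ k)%R).
{ apply (ex_series_scal (V := R_NormedModule) M); eexists; apply is_series_geom.
  rewrite Rabs_pos_eq; lra. }
assert (HB : ex_series (fun n => (2 * Cmod y) ^ n / INR (fact n))%R)
  by (eexists; apply pow_fact_series).
assert (Fub := CSeries_fubini_prod f _ _ Bd HA HB).
rewrite (CSeries_ext (fun i => CSeries (f i)) (fun k => y * CSeries (kampe_term a y k))) in Fub
  by (intros k; apply CSeries_unique, Row).
rewrite <- CSeries_scal by apply kampe_rows_summable; rewrite <- Fub.
assert (Col : forall n, CSeries (fun k => f k n) = harmonic a n * (y ^ n / cfact n)).
{ intros n; apply CSeries_unique, Cis_series_tends.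
  apply (tends_ext eventually (fun _ => harmonic a n * (y ^ n / cfact n)));
    [| apply (tends_const eventually)].
  destruct n as [|n].
  - exists 0%nat; intros N _; unfold harmonic; rewrite Cmult_0_l.
    induction N as [|N IH]; [rewrite Csum_O; reflexivity |].
    rewrite Csum_Sn, <- IH; unfold f; simpl; ring.
  - exists n; intros N HN; unfold harmonic.
    rewrite Cmult_comm, <- Csum_scal.
    transitivity (sum_n (fun k => / (a + INR k) * (y ^ S n / cfact (S n))) n);
      [apply Csum_ext; intros; ring |].
    symmetry; exact (sum_n_truncate (fun k => / (a + INR k) * (y ^ S n / cfact (S n))) n N HN). }
apply Cis_series_ext with (fun n => CSeries (fun k => f k n)); [exact Col |].
apply CSeries_is_series, summable_le with (fun n => Series (fun k => M * (/ 2) ^ k)%R * ((2 * Cmod y) ^ n / INR (fact n)))%R.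
- intros n; rewrite <- Series_scal_r; apply Cmod_CSeries_le; [intros k; apply Bd |].
  now apply ex_series_scal_r.
- now apply (ex_series_scal (V := R_NormedModule)).
Qed.

Lemma dpoch_series_kampe a y : ~ nonpos_int a ->
  dpoch_series a y
  = Cexp y * drGamma a - rGamma a * (y / a * kampe_de_feriet 1 a 1 2 (a + 1) y y).
Proof.
intros Ra; rewrite (kampe_eq a y Ra), Cmult_comm; apply CSeries_unique.
apply Cis_series_ext with (2 := Cis_series_minus _ _ _ _
  (Cis_series_scal (drGamma a) _ _ (Cexp_series y))
  (Cis_series_scal (rGamma a) _ _ (harmonic_series a y))).
intros n; rewrite (dpoch_harmonic a n Ra); ring.
Qed.

Lemma rhs_generic_main_term a b y rho :
  ~ nonpos_int a -> ~ nonpos_int b -> ~ nonpos_int (a + b) ->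
  rhs_generic a b y rho = main_term a b y rho.
Proof.
intros Ra Rb Rc; unfold rhs_generic, main_term.
rewrite (dpoch_series_kampe a y Ra), !Gamma_rGamma, !psi_rGamma by trivial.
assert (N1 := rGamma_neq_0 a Ra); assert (N2 := rGamma_neq_0 b Rb); assert (N3 := rGamma_neq_0 _ Rc).
set (K := y / a * _); field; repeat split; trivial.
Qed.

(** Continuity also at the exceptional parameters is what the factors [1 / Gamma]
    are for. *)
Lemma main_term_continuous (a b y rho : C) : ~ nonpos_int (a + b) ->
  tends (locally (a, b)) (fun p : C * C => main_term (fst p) (snd p) y rho) (main_term a b y rho).
Proof.
intros Rc.
assert (F1 : tends (locally (a, b)) (fun p : C * C => fst p) a).
{ apply (tends_filterlim (locally (a, b))), (continuous_fst (U := C_UniformSpace) (V := C_UniformSpace)). }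
assert (F2 : tends (locally (a, b)) (fun p : C * C => snd p) b).
{ apply (tends_filterlim (locally (a, b))), (continuous_snd (U := C_UniformSpace) (V := C_UniformSpace)). }
assert (Cp : forall f : C -> C, (forall z : C, tends (locally z) f (f z)) -> forall g l,
  tends (locally (a, b)) g l -> tends (locally (a, b)) (fun p : C * C => f (g p)) (f l)).
{ intros f Hf g l Hg; apply (tends_comp (locally (a, b)) g f l); [exact Hg | apply Hf]. }
assert (A1 := Cp _ rGamma_continuous _ _ F1); assert (A2 := Cp _ rGamma_continuous _ _ F2).
assert (A3 := Cp _ drGamma_continuous _ _ F2).
assert (A4 := Cp _ (fun z => dpoch_series_continuous z y) _ _ F1).
assert (A5 := Cp _ rGamma_continuous _ _ (tends_plus (locally (a, b)) _ _ _ _ F1 F2)).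
assert (A6 := tends_inv (locally (a, b)) _ _ (rGamma_neq_0 _ Rc) A5).
assert (K : forall k : C, tends (locally (a, b)) (fun _ : C * C => k) k)
  by (intros k; apply (tends_const (locally (a, b)))).
cbv beta in *.
exact (tends_mult _ _ _ _ _ (tends_opp _ _ _ A6)
  (tends_minus _ _ _ _ _ (tends_mult _ _ _ _ _ (K (Cexp y))
    (tends_minus _ _ _ _ _ (tends_mult _ _ _ _ _ (K (2 * euler_gamma + Clog rho))
        (tends_mult _ _ _ _ _ A1 A2))
      (tends_mult _ _ _ _ _ A1 A3)))
    (tends_mult _ _ _ _ _ A2 A4))).
Qed.

(** A small purely imaginary shift makes both parameters regular. *)
Lemma regular_params_proper (a b : C) : ProperFilter (within regular_params (locally (a, b))).
Proof.
split; [| apply within_filter, locally_filter].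
intros P [eps HP].
assert (He := cond_pos eps).
(* Each parameter excludes one value of [e], so one of three candidates is left. *)
assert (Ex : exists e : R, (0 < e < eps)%R /\ (Im a + e <> 0)%R /\ (Im b + e <> 0)%R).
{ destruct (Req_dec (Im a + eps / 2) 0) as [A | A];
    destruct (Req_dec (Im b + eps / 2) 0) as [B | B];
    destruct (Req_dec (Im a + eps / 3) 0) as [A' | A'];
    destruct (Req_dec (Im b + eps / 3) 0) as [B' | B'];
    first [exists (eps / 2)%R; split; [lra | split; lra] | exists (eps / 3)%R; split; [lra | split; lra]
      | exists (eps / 4)%R; split; [lra | split; lra]]. }
destruct Ex as [e [H1 [H2 H3]]].
exists (a + (0, e)%R, b + (0, e)%R); apply HP.
- assert (Bl : forall z : C, ball z eps (z + (0, e)%R)).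
  { intros z; apply C_NormedModule_mixin_compat1.
    replace (minus (z + (0, e)%R) z) with ((0, e)%R : C)
      by (destruct z; unfold minus, plus, opp; simpl; apply injective_projections; simpl; ring).
    replace ((0, e)%R : C) with (Ci * RtoC e) by (unfold Ci; apply injective_projections; simpl; ring).
    rewrite Cmod_mult, Cmod_Ci, Cmod_RtoC_pos; lra. }
  split; apply Bl.
- assert (Rg : forall z : C, (Im z + e <> 0)%R -> ~ nonpos_int (z + (0, e)%R)).
  { intros z Hz [n Hn]; apply Hz; apply (f_equal Im) in Hn; destruct z; simpl in *; lra. }
  split; simpl; now apply Rg.
Qed.

(** Near [(a, b)] the sum [a + b] stays regular because [rGamma] does not vanish
    there; this lets the generic formula be used along the limit. *)
Lemma rhs_main_term a b y rho : ~ nonpos_int (a + b) -> rhs a b y rho = main_term a b y rho.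
Proof.
intros Rc; unfold rhs; destruct (excluded_middle_informative _) as [[Ra Rb] | _].
- now apply rhs_generic_main_term.
- assert (PF := regular_params_proper a b).
  apply (Flim_unique _ _ PF), (tends_filterlim (within regular_params (locally (a, b)))).
  apply (tends_ext (within regular_params (locally (a, b)))
    (fun p : C * C => main_term (fst p) (snd p) y rho)).
  + assert (S1 : tends (locally (a, b)) (fun p : C * C => rGamma (fst p + snd p)) (rGamma (a + b))).
    { apply (tends_comp (locally (a, b)) (fun p : C * C => fst p + snd p) rGamma (a + b));
        [| apply rGamma_continuous].
      apply (tends_plus (locally (a, b))); apply (tends_filterlim (locally (a, b)));
        [apply (continuous_fst (U := C_UniformSpace) (V := C_UniformSpace))
        | apply (continuous_snd (U := C_UniformSpace) (V := C_UniformSpace))]. }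
    assert (N := rGamma_neq_0 _ Rc).
    unfold within; generalize (S1 _ (proj1 (Cmod_gt_0 _) N)); apply filter_imp.
    intros [a' b'] Hp [Ra Rb]; simpl in *; symmetry; apply rhs_generic_main_term; trivial.
    intros Q; apply rGamma_eq_0 in Q; rewrite Q in Hp.
    replace (0 - rGamma (a + b)) with (- rGamma (a + b)) in Hp by ring.
    rewrite Cmod_opp in Hp; lra.
  + intros eps He; generalize (main_term_continuous a b y rho Rc eps He); unfold within.
    apply filter_imp; intros p Hp _; exact Hp.
Qed.

Theorem theorem3p12 (a b y : C) (hab : ~ nonpos_int (a + b)) :
  filterlim
    (fun rho : C => Phi1 a b (a + b) (1 - rho) y - rhs a b y rho)
    (within (fun rho : C => rho <> 0 /\ (Rabs (Carg rho) < PI)%R)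
       (locally (0 : C)))
    (locally (0 : C)).
Proof.
apply (tends_filterlim slit).
apply (tends_ext slit (fun rho => Phi1 a b (a + b) (1 - rho) y
  - CSeries (fun n => row_log a b n rho * (y ^ n / cfact n)))); [| now apply Phi1_asymptotics].
apply filter_forall; intros rho; now rewrite row_log_sum, rhs_main_term.
Qed.
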